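(* Let $T$ be a rooted tree with $n$ vertices, and let weighted data $(y,w)$ be given on its vertices, i.e. $y(v)\in\mathbb{R}$ and $w(v)\ge 0$ for each vertex $v$. Then an $L_\infty$ isotonic regression of the data on $T$ can be determined in $\Theta(n)$ time.
   Context: The tree is viewed as a directed acyclic graph with edges directed towards the root, and $u \preceq v$ iff there is a directed path (possibly empty) from $u$ to $v$, i.e. iff $v$ lies on the path from $u$ to the root. A real-valued function $f$ on the vertices is isotonic if $u \preceq v$ implies $f(u) \le f(v)$. An $L_\infty$ isotonic regression is an isotonic function $f$ minimizing $\max_{v} w(v)\,|y(v)-f(v)|$ over all isotonic functions (any minimizer is acceptable). Times refer to a standard RAM model with real-number arithmetic. *)

(* Defs.v *)
From HB Require Import structures.
From mathcomp Require Import all_boot all_order all_algebra.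
From mathcomp Require Import reals.

Set Implicit Arguments.
Unset Strict Implicit.
Unset Printing Implicit Defensive.

Import Order.TTheory GRing.Theory Num.Theory.

Local Open Scope ring_scope.

(* The edge relation of a parent map, directed towards the root. *)
Definition parent_edge n (parent : 'I_n -> option 'I_n) : rel 'I_n :=
  fun u v => parent u == Some v.

(* Reachability of the root from every vertex excludes cycles, since each
   vertex has at most one outgoing edge and the root has none.  The labels
   'I_n are arbitrary: no compatibility with the tree order is required. *)
Record rooted_tree (n : nat) := RootedTree {
  tree_root : 'I_n;
  parent : 'I_n -> option 'I_n;
  parent_tree_root : parent tree_root = None;
  connect_tree_root : forall v, connect (parent_edge parent) v tree_root
}.

Definition tree_le n (T : rooted_tree n) : rel 'I_n :=
  connect (parent_edge (parent T)).

Definition isotonic (R : realType) n (T : rooted_tree n) (f : 'I_n -> R) :=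
  forall u v, tree_le T u v -> f u <= f v.

(* The neutral element 0 of the iterated maximum is harmless: the terms are
   nonnegative when w is. *)
Definition Linf_error (R : realType) n (y w f : 'I_n -> R) : R :=
  \big[Num.max/0]_(v < n) (w v * `|y v - f v|).

Definition is_Linf_isotonic_regression (R : realType) n (T : rooted_tree n)
    (y w f : 'I_n -> R) :=
  isotonic T f /\
  forall g, isotonic T g -> Linf_error y w f <= Linf_error y w g.

(* A unit-cost RAM with real arithmetic.  A program is one finite list of
   instructions, used for all input sizes.  Natural numbers and reals live in
   separate registers and separate memories.  A program addresses registers
   directly (hence uses finitely many of them); memory cells are addressed
   indirectly through natural-number registers.  Integer arithmetic is limited
   to addition and truncated subtraction, and there is neither a rounding
   operation nor any other conversion from reals to naturals, so that
   unit-cost operations on numbers of unbounded size cannot be used to pack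
   data.  The only real constants are integers.  In the constructors below d
   is the destination register, a and b are source registers and l is a
   jump target, i.e. a position in the program. *)
Variant instr :=
  | IConst (d k : nat)
  | IAdd (d a b : nat)
  | ISub (d a b : nat)
  | ILoad (d a : nat)
  | IStore (a b : nat)       (* the address is in a, the value in b *)
  | RConst (d : nat) (k : int)
  | RAdd (d a b : nat)
  | RSub (d a b : nat)
  | RMul (d a b : nat)
  | RDiv (d a b : nat)
  | RLoad (d a : nat)
  | RStore (a b : nat)       (* the address is in a, the value in b *)
  | Jump (l : nat)
  | IJumpLt (a b l : nat)
  | RJumpLt (a b l : nat)
  | Halt.

Definition program := seq instr.

Record config (R : realType) := Config {
  pc : nat;
  ireg : nat -> nat;
  rreg : nat -> R;
  imem : nat -> nat;
  rmem : nat -> R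
}.

Definition fetch (R : realType) (P : program) (c : config R) : instr :=
  nth Halt P (pc c).

(* There is no successor after Halt, and division by zero blocks the machine
   without halting it. *)
Definition step (R : realType) (P : program) (c : config R) :
    option (config R) :=
  let: Config p ir rr im rm := c in
  let set_ir d x := Some (Config p.+1 [eta ir with d |-> x] rr im rm) in
  let set_rr d x := Some (Config p.+1 ir [eta rr with d |-> x] im rm) in
  let goto q := Some (Config q ir rr im rm) in
  match fetch P c with
  | IConst d k => set_ir d k
  | IAdd d a b => set_ir d (ir a + ir b)%N
  | ISub d a b => set_ir d (ir a - ir b)%N
  | ILoad d a => set_ir d (im (ir a))
  | IStore a b => Some (Config p.+1 ir rr [eta im with ir a |-> ir b] rm)
  | RConst d k => set_rr d k%:~R
  | RAdd d a b => set_rr d (rr a + rr b)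
  | RSub d a b => set_rr d (rr a - rr b)
  | RMul d a b => set_rr d (rr a * rr b)
  | RDiv d a b => if rr b == 0 then None else set_rr d (rr a / rr b)
  | RLoad d a => set_rr d (rm (ir a))
  | RStore a b => Some (Config p.+1 ir rr im [eta rm with ir a |-> rr b])
  | Jump l => goto l
  | IJumpLt a b l => goto (if (ir a < ir b)%N then l else p.+1)
  | RJumpLt a b l => goto (if rr a < rr b then l else p.+1)
  | Halt => None
  end.

Fixpoint run (R : realType) (P : program) (t : nat) (c : config R) :
    option (config R) :=
  if t is t'.+1 then obind (run P t') (step P c) else Some c.

Definition halts_in (R : realType) (P : program) (c : config R) (t : nat)
    (c' : config R) :=
  run P t c = Some c' /\ fetch P c' = Halt.

(* Input convention: n is in register 0 of the naturals; cell v < n of the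
   memory of naturals contains p + 1 if p is the parent of v, and 0 if v is the
   root; cells v and n + v of the real memory contain y v and w v; everything
   else is 0. *)
Definition input_config (R : realType) n (T : rooted_tree n)
    (y w : 'I_n -> R) : config R :=
  {| pc := 0%N;
     ireg := [eta (fun=> 0%N) with 0%N |-> n];
     rreg := fun=> 0;
     imem := fun a => if obind (parent T) (insub a) is Some p
                      then (val p).+1 else 0%N;
     rmem := fun a => if insub a is Some v then y v
                      else if insub (a - n)%N is Some v then w v else 0 |}.

(* The output f v overwrites y v. *)
Definition output (R : realType) n (c : config R) : 'I_n -> R :=
  fun v => rmem c v.
Arguments output {R} n c _.

(* m is the maximum running time of P over all inputs with n vertices. *)
Definition is_worst_case_time (R : realType) (P : program) (n m : nat) :=
  (forall (T : rooted_tree n) (y w : 'I_n -> R), (forall v, 0 <= w v) ->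
     exists t c, halts_in P (input_config T y w) t c /\ (t <= m)%N) /\
  (exists (T : rooted_tree n) (y w : 'I_n -> R), (forall v, 0 <= w v) /\
     exists c, halts_in P (input_config T y w) m c).
Arguments is_worst_case_time : clear implicits.

(* Main.v *)
(* For a given error [eps] the admissible values of [f v] form an interval whose end points
   are affine functions of [eps], and the least candidate for [f] arises from propagating the
   lower end points towards the root.  Feasibility of [eps] is thus decided in linear time, and
   the least feasible [eps] is found by prune and search.  A round pairs a constant fraction
   of the vertices, each with its parent or with a sibling leaf, and replaces the constraints
   inside the pairs by a lower bound for [eps].  Of the two lines of a pair only the larger one
   at the optimum matters, and this is known as soon as the optimum is located with respect to
   their crossing.  Testing a value that lies between a quarter of the crossings on either side
   therefore resolves a quarter of the pairs; if it succeeds for the lower and for the upper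
   lines, the two vertices are merged.  The splitting value comes from merging sorted blocks to
   four times their length and dropping every other element, until one block is left: the
   lengths decrease geometrically, so that this takes linear time without a selection routine.

   The algorithm is a program with counted loops, which has a total semantics and a cost, and
   which is compiled to the RAM. *)

(* The obstacle is that a merged pair has four lines and may keep only two, without moving the
   optimum. Upper lines are therefore imposed on proper descendants only: contracting [u] into [v]
   then loses just the constraint between the lower line of [u] and the upper line of [v], which has
   the form [cross <= x] and is absorbed by the lower bound [e]. To treat sibling leaves alike,
   whose own upper lines bind nothing, a leaf takes over the upper line of its parent. Feasibility
   is monotone in the error, so lines have to be compared only in a left neighbourhood of the
   optimum. An internal vertex can be contracted into its parent only if it is an only child;
   counting leaves against branching vertices shows that there are still at least a sixth as many
   pairs as vertices. Once a single vertex is left, the only constraint is [e <= x], so that [e] is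
   the optimum. The feasibility test ignores the upper line of a vertex at the vertex itself. For
   the final output this bound comes from the minimality of the propagated function. *)
Require Import Defs.
From mathcomp Require Import all_boot all_order all_algebra.
From mathcomp Require Import boolp classical_sets filter reals topology normedtype landau.
From mathcomp Require Import zify ring lra.
Import numFieldNormedType.Exports.

Set Implicit Arguments.
Unset Strict Implicit.
Unset Printing Implicit Defensive.
Import Order.TTheory GRing.Theory Num.Theory.

Local Open Scope ring_scope.

(** * A language with counted loops and its compilation to the RAM *)

Section Lang.
Variable R : realType.

(* Scalar variables, arrays indexed by all naturals, and the first [bnd] memory cells, which
   hold the input and the output. *)
Record state := State {
  iv : nat -> nat; rv : nat -> R;
  ia : nat -> nat -> nat; ra : nat -> nat -> R;
  iraw : nat -> nat; rraw : nat -> R; bnd : nat }.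

Definition upd T (f : nat -> T) x v := fun y => if eqn y x then v else f y.

Definition seti x v s := State (upd (iv s) x v) (rv s) (ia s) (ra s) (iraw s) (rraw s) (bnd s).
Definition setr x v s := State (iv s) (upd (rv s) x v) (ia s) (ra s) (iraw s) (rraw s) (bnd s).
Definition setia i k v s := State (iv s) (rv s) (upd (ia s) i (upd (ia s i) k v)) (ra s) (iraw s) (rraw s) (bnd s).
Definition setra i k v s := State (iv s) (rv s) (ia s) (upd (ra s) i (upd (ra s i) k v)) (iraw s) (rraw s) (bnd s).
(** Accesses beyond [bnd] are void. The compiled code tests the address, so that an access to the
    input never touches the arrays stored behind it. *)
Definition setraw k v s := State (iv s) (rv s) (ia s) (ra s) (iraw s) (if (k < bnd s)%N then upd (rraw s) k v else rraw s) (bnd s).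

(* [Ild] and [Rld] read arrays, [Iraw] and [Rraw] the input cells.  [For k l c] runs [c] for
   [k = 0, ..., l - 1]; as [c] must not assign [k] and [l], every program terminates. *)
Inductive iexp := Iv (x : nat) | Ic (k : nat) | Iadd (e f : iexp) | Isub (e f : iexp)
  | Ild (i : nat) (e : iexp) | Iraw (e : iexp).
Inductive rexp := Rv (x : nat) | Rc (k : int) | Radd (e f : rexp) | Rsub (e f : rexp)
  | Rmul (e f : rexp) | Rdiv (e f : rexp) | Rld (i : nat) (e : iexp) | Rraw (e : iexp).
Inductive cmd := Skip | ISet (x : nat) (e : iexp) | RSet (x : nat) (e : rexp)
  | ISt (i : nat) (e f : iexp) | RSt (i : nat) (e : iexp) (f : rexp) | RawSt (e : iexp) (f : rexp)
  | Seq (c d : cmd) | IfI (e f : iexp) (c d : cmd) | IfR (e f : rexp) (c d : cmd)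
  | For (k l : nat) (c : cmd).

Fixpoint evi e s := match e with
  | Iv x => iv s x | Ic k => k | Iadd e f => (evi e s + evi f s)%N
  | Isub e f => (evi e s - evi f s)%N | Ild i e => ia s i (evi e s)
  | Iraw e => let a := evi e s in if (a < bnd s)%N then iraw s a else 0%N end.
Fixpoint evr e s : R := match e with
  | Rv x => rv s x | Rc k => k%:~R | Radd e f => evr e s + evr f s
  | Rsub e f => evr e s - evr f s | Rmul e f => evr e s * evr f s
  | Rdiv e f => evr e s / evr f s | Rld i e => ra s i (evi e s)
  | Rraw e => let a := evi e s in if (a < bnd s)%N then rraw s a else 0 end.

(** The counter is set after each pass, so that the body finds the number of finished passes in
    it. *)
Fixpoint loop (k : nat) (f : state -> state) (n : nat) (s : state) : state :=
  if n is n'.+1 then seti k n (f (loop k f n' s)) else seti k 0 s.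

Fixpoint eval c s := match c with
  | Skip => s
  | ISet x e => seti x (evi e s) s
  | RSet x e => setr x (evr e s) s
  | ISt i e f => setia i (evi e s) (evi f s) s
  | RSt i e f => setra i (evi e s) (evr f s) s
  | RawSt e f => setraw (evi e s) (evr f s) s
  | Seq c d => eval d (eval c s)
  | IfI e f c d => if (evi e s < evi f s)%N then eval c s else eval d s
  | IfR e f c d => if evr e s < evr f s then eval c s else eval d s
  | For k l c => loop k (eval c) (iv s l) s
  end.

Fixpoint iexp_wf e := match e with
  | Iv _ | Ic _ => true | Iadd e f | Isub e f => iexp_wf e && iexp_wf f
  | Ild i e => (i < 16)%N && iexp_wf e | Iraw e => iexp_wf e end.
Fixpoint rexp_wf e := match e with
  | Rv _ | Rc _ => true | Radd e f | Rsub e f | Rmul e f | Rdiv e f => rexp_wf e && rexp_wf f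
  | Rld i e => (i < 16)%N && iexp_wf e | Rraw e => iexp_wf e end.

(* Even registers hold the variables and odd ones the intermediate values of expressions;
   the natural-number register 1 holds [bnd]. *)
Definition itmp d := d.*2.+3.
Definition rtmp d := d.*2.+1.

(* The arrays are interleaved: entry [k] of array [i] is in cell [16 k + i + bnd]. *)
Definition addr_code d d' i :=
  [:: IAdd (itmp d) (itmp d) (itmp d); IAdd (itmp d) (itmp d) (itmp d);
      IAdd (itmp d) (itmp d) (itmp d); IAdd (itmp d) (itmp d) (itmp d);
      IConst (itmp d') i; IAdd (itmp d) (itmp d) (itmp d'); IAdd (itmp d) (itmp d) 1].
Lemma size_addr_code d d' i : size (addr_code d d' i) = 7.
Proof. by []. Qed.

(** The value is left in [itmp d] and the temporaries below [d] survive; [p] is the position of the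
    code, on which jump targets depend. Lacking a move instruction, a register is copied by adding
    it to 0. *)
Fixpoint icode (p d : nat) e : seq instr := match e with
  | Iv x => [:: IConst (itmp d) 0; IAdd (itmp d) (itmp d) x.*2]
  | Ic k => [:: IConst (itmp d) k]
  | Iadd e f => let c1 := icode p d e in
      c1 ++ icode (p + size c1) d.+1 f ++ [:: IAdd (itmp d) (itmp d) (itmp d.+1)]
  | Isub e f => let c1 := icode p d e in
      c1 ++ icode (p + size c1) d.+1 f ++ [:: ISub (itmp d) (itmp d) (itmp d.+1)]
  | Ild i e => icode p d e ++ addr_code d d.+1 i ++ [:: ILoad (itmp d) (itmp d)]
  | Iraw e => let c1 := icode p d e in let q := (p + size c1)%N in
      c1 ++ [:: IJumpLt (itmp d) 1 (q + 3); IConst (itmp d) 0; Jump (q + 4); ILoad (itmp d) (itmp d)]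
  end.

(** Division by zero blocks the machine, whereas the language has [x / 0 = 0]. Lacking an equality
    test, the code compares the divisor with 0 in both directions and returns 0 if neither
    comparison succeeds. *)
Fixpoint rcode (p d : nat) e : seq instr := match e with
  | Rv x => [:: RConst (rtmp d) 0; RAdd (rtmp d) (rtmp d) x.*2]
  | Rc k => [:: RConst (rtmp d) k]
  | Radd e f => let c1 := rcode p d e in
      c1 ++ rcode (p + size c1) d.+1 f ++ [:: RAdd (rtmp d) (rtmp d) (rtmp d.+1)]
  | Rsub e f => let c1 := rcode p d e in
      c1 ++ rcode (p + size c1) d.+1 f ++ [:: RSub (rtmp d) (rtmp d) (rtmp d.+1)]
  | Rmul e f => let c1 := rcode p d e in
      c1 ++ rcode (p + size c1) d.+1 f ++ [:: RMul (rtmp d) (rtmp d) (rtmp d.+1)]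
  | Rdiv e f => let c1 := rcode p d e in let c2 := rcode (p + size c1) d.+1 f in
      let q := (p + size c1 + size c2)%N in
      c1 ++ c2 ++ [:: RConst (rtmp d.+2) 0; RJumpLt (rtmp d.+1) (rtmp d.+2) (q + 5);
        RJumpLt (rtmp d.+2) (rtmp d.+1) (q + 5); RConst (rtmp d) 0; Jump (q + 6);
        RDiv (rtmp d) (rtmp d) (rtmp d.+1)]
  | Rld i e => icode p 0 e ++ addr_code 0 1 i ++ [:: RLoad (rtmp d) (itmp 0)]
  | Rraw e => let c1 := icode p 0 e in let q := (p + size c1)%N in
      c1 ++ [:: IJumpLt (itmp 0) 1 (q + 3); RConst (rtmp d) 0; Jump (q + 4); RLoad (rtmp d) (itmp 0)]
  end.

(** In a store of a real the value is computed before the address: real expressions use the integer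
    temporaries for their own addresses, while integer expressions leave the real registers
    alone. *)
Fixpoint ccode (p : nat) c : seq instr := match c with
  | Skip => [::]
  | ISet x e => icode p 0 e ++ [:: IConst x.*2 0; IAdd x.*2 x.*2 (itmp 0)]
  | RSet x e => rcode p 0 e ++ [:: RConst x.*2 0; RAdd x.*2 x.*2 (rtmp 0)]
  | ISt i e f => let c1 := icode p 0 e in c1 ++ icode (p + size c1) 1 f ++
      addr_code 0 2 i ++ [:: IStore (itmp 0) (itmp 1)]
  | RSt i e f => let c1 := rcode p 0 f in c1 ++ icode (p + size c1) 0 e ++
      addr_code 0 1 i ++ [:: RStore (itmp 0) (rtmp 0)]
  | RawSt e f => let c1 := rcode p 0 f in let c2 := icode (p + size c1) 0 e in
      let q := (p + size c1 + size c2)%N in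
      c1 ++ c2 ++ [:: IJumpLt (itmp 0) 1 (q + 2); Jump (q + 3); RStore (itmp 0) (rtmp 0)]
  | Seq c d => let c1 := ccode p c in c1 ++ ccode (p + size c1) d
  | IfI e f c d => let c1 := icode p 0 e in let c2 := icode (p + size c1) 1 f in
      let q := (p + size c1 + size c2)%N in
      let c3 := ccode q.+1 d in let q1 := (q + size c3).+2 in
      let c4 := ccode q1 c in
      c1 ++ c2 ++ IJumpLt (itmp 0) (itmp 1) q1 :: c3 ++ Jump (q1 + size c4) :: c4
  | IfR e f c d => let c1 := rcode p 0 e in let c2 := rcode (p + size c1) 1 f in
      let q := (p + size c1 + size c2)%N in
      let c3 := ccode q.+1 d in let q1 := (q + size c3).+2 in
      let c4 := ccode q1 c in
      c1 ++ c2 ++ RJumpLt (rtmp 0) (rtmp 1) q1 :: c3 ++ Jump (q1 + size c4) :: c4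
  | For k l c => let c1 := ccode (p + 3) c in
      [:: IConst k.*2 0; IJumpLt k.*2 l.*2 (p + 3); Jump (p + size c1 + 6)] ++ c1 ++
      [:: IConst (itmp 0) 1; IAdd k.*2 k.*2 (itmp 0); Jump p.+1]
  end.

Fixpoint ilen e := match e with
  | Iv _ => 2 | Ic _ => 1 | Iadd e f | Isub e f => ilen e + ilen f + 1
  | Ild _ e => ilen e + 8 | Iraw e => ilen e + 4 end%N.
Fixpoint rlen e := match e with
  | Rv _ => 2 | Rc _ => 1 | Radd e f | Rsub e f | Rmul e f => rlen e + rlen f + 1
  | Rdiv e f => rlen e + rlen f + 6 | Rld _ e => ilen e + 8 | Rraw e => ilen e + 4 end%N.

Lemma size_ci p d e : size (icode p d e) = ilen e.
Proof.
elim: e p d => //= [e IHe f IHf|e IHe f IHf|i e IHe|e IHe] p d;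
  rewrite !size_cat ?size_addr_code /= ?IHe ?IHf //; lia.
Qed.

Lemma size_cr p d e : size (rcode p d e) = rlen e.
Proof.
elim: e p d => //= [e IHe f IHf|e IHe f IHf|e IHe f IHf|e IHe f IHf|i e|e] p d;
  rewrite !size_cat ?size_addr_code /= ?IHe ?IHf ?size_ci //; lia.
Qed.

(** An upper bound for the number of steps. In a loop, 4 counts the test and the three instructions
    that advance the counter and jump back, and 3 counts the initialisation, the failing test and
    the exit jump. *)
Fixpoint cost c s := match c with
  | Skip => 0
  | ISet x e => ilen e + 2
  | RSet x e => rlen e + 2
  | ISt i e f => ilen e + ilen f + 8
  | RSt i e f => ilen e + rlen f + 8
  | RawSt e f => ilen e + rlen f + 2
  | Seq c d => cost c s + cost d (eval c s)
  | IfI e f c d => ilen e + ilen f + (if evi e s < evi f s then cost c s + 1 else cost d s + 2)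
  | IfR e f c d => rlen e + rlen f + (if (evr e s < evr f s)%R then cost c s + 1 else cost d s + 2)
  | For k l c => \sum_(i < iv s l) (cost c (loop k (eval c) i s) + 4) + 3
  end%N.

(* A crude lower bound for the running time: a loop takes at least one step per iteration. *)
Fixpoint min_cost c s := match c with
  | Seq c d => min_cost c s + min_cost d (eval c s)
  | For k l c => iv s l
  | _ => 0 end%N.

Fixpoint mod_iv c := match c with
  | ISet x _ => [:: x] | Seq c d | IfI _ _ c d | IfR _ _ c d => mod_iv c ++ mod_iv d
  | For k _ c => k :: mod_iv c | _ => [::] end.
Fixpoint mod_rv c := match c with
  | RSet x _ => [:: x] | Seq c d | IfI _ _ c d | IfR _ _ c d => mod_rv c ++ mod_rv d
  | For _ _ c => mod_rv c | _ => [::] end.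
Fixpoint mod_ia c := match c with
  | ISt x _ _ => [:: x] | Seq c d | IfI _ _ c d | IfR _ _ c d => mod_ia c ++ mod_ia d
  | For _ _ c => mod_ia c | _ => [::] end.
Fixpoint mod_ra c := match c with
  | RSt x _ _ => [:: x] | Seq c d | IfI _ _ c d | IfR _ _ c d => mod_ra c ++ mod_ra d
  | For _ _ c => mod_ra c | _ => [::] end.
Fixpoint mod_raw c := match c with
  | RawSt _ _ => true | Seq c d | IfI _ _ c d | IfR _ _ c d => mod_raw c || mod_raw d
  | For _ _ c => mod_raw c | _ => false end.

Fixpoint cmd_wf c := match c with
  | Skip => true | ISet _ e => iexp_wf e | RSet _ e => rexp_wf e
  | ISt i e f => [&& (i < 16)%N, iexp_wf e & iexp_wf f] | RSt i e f => [&& (i < 16)%N, iexp_wf e & rexp_wf f]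
  | RawSt e f => iexp_wf e && rexp_wf f | Seq c d => cmd_wf c && cmd_wf d
  | IfI e f c d => [&& iexp_wf e, iexp_wf f, cmd_wf c & cmd_wf d]
  | IfR e f c d => [&& rexp_wf e, rexp_wf f, cmd_wf c & cmd_wf d]
  | For k l c => [&& k != l, k \notin mod_iv c, l \notin mod_iv c & cmd_wf c] end.

(** * Frame properties: what a command leaves unchanged *)

Section Frame.
Variables (x : nat) (c : cmd).
Lemma loop_frame T (p : state -> T) k f n s :
  (forall y v s, y = k -> p (seti y v s) = p s) -> (forall s, p (f s) = p s) -> p (loop k f n s) = p s.
Proof. by move=> H1 H2; elim: n => [|n IH] /=; rewrite H1 // H2 IH. Qed.

Lemma frame_iv s : x \notin mod_iv c -> iv (eval c s) x = iv s x.
Proof.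
elim: c s => //=.
- by move=> y e s; rewrite inE /upd -eqE eqE => /negbTE ->.
- by move=> c1 IH1 d IH2 s; rewrite mem_cat negb_or => /andP[h1 h2]; rewrite IH2 ?IH1.
- by move=> e f c1 IH1 d IH2 s; rewrite mem_cat negb_or => /andP[h1 h2]; case: ifP => _; rewrite ?IH2 ?IH1.
- by move=> e f c1 IH1 d IH2 s; rewrite mem_cat negb_or => /andP[h1 h2]; case: ifP => _; rewrite ?IH2 ?IH1.
- move=> k l c1 IH s; rewrite inE negb_or => /andP[/negbTE nx h].
  apply: (@loop_frame _ (fun s => iv s x)) => [y v s' -> /=|s']; last exact: IH.
  by rewrite /upd (_ : eqn x k = false).
Qed.
Lemma frame_rv s : x \notin mod_rv c -> rv (eval c s) x = rv s x.
Proof.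
elim: c s => //=.
- by move=> y e s; rewrite inE /upd -eqE eqE => /negbTE ->.
- by move=> c1 IH1 d IH2 s; rewrite mem_cat negb_or => /andP[h1 h2]; rewrite IH2 ?IH1.
- by move=> e f c1 IH1 d IH2 s; rewrite mem_cat negb_or => /andP[h1 h2]; case: ifP => _; rewrite ?IH2 ?IH1.
- by move=> e f c1 IH1 d IH2 s; rewrite mem_cat negb_or => /andP[h1 h2]; case: ifP => _; rewrite ?IH2 ?IH1.
- by move=> k l c1 IH s h; apply: (@loop_frame _ (fun s => rv s x)) => // s'; apply: IH.
Qed.
Lemma frame_ia s : x \notin mod_ia c -> ia (eval c s) x = ia s x.
Proof.
elim: c s => //=.
- by move=> y e f s; rewrite inE /upd -eqE eqE => /negbTE ->.
- by move=> c1 IH1 d IH2 s; rewrite mem_cat negb_or => /andP[h1 h2]; rewrite IH2 ?IH1.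
- by move=> e f c1 IH1 d IH2 s; rewrite mem_cat negb_or => /andP[h1 h2]; case: ifP => _; rewrite ?IH2 ?IH1.
- by move=> e f c1 IH1 d IH2 s; rewrite mem_cat negb_or => /andP[h1 h2]; case: ifP => _; rewrite ?IH2 ?IH1.
- by move=> k l c1 IH s h; apply: (@loop_frame _ (fun s => ia s x)) => // s'; apply: IH.
Qed.
Lemma frame_ra s : x \notin mod_ra c -> ra (eval c s) x = ra s x.
Proof.
elim: c s => //=.
- by move=> y e f s; rewrite inE /upd -eqE eqE => /negbTE ->.
- by move=> c1 IH1 d IH2 s; rewrite mem_cat negb_or => /andP[h1 h2]; rewrite IH2 ?IH1.
- by move=> e f c1 IH1 d IH2 s; rewrite mem_cat negb_or => /andP[h1 h2]; case: ifP => _; rewrite ?IH2 ?IH1.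
- by move=> e f c1 IH1 d IH2 s; rewrite mem_cat negb_or => /andP[h1 h2]; case: ifP => _; rewrite ?IH2 ?IH1.
- by move=> k l c1 IH s h; apply: (@loop_frame _ (fun s => ra s x)) => // s'; apply: IH.
Qed.
Lemma frame_rraw s : ~~ mod_raw c -> rraw (eval c s) = rraw s.
Proof.
elim: c s => //=.
- by move=> c1 IH1 d IH2 s; rewrite negb_or => /andP[h1 h2]; rewrite IH2 ?IH1.
- by move=> e f c1 IH1 d IH2 s; rewrite negb_or => /andP[h1 h2]; case: ifP => _; rewrite ?IH2 ?IH1.
- by move=> e f c1 IH1 d IH2 s; rewrite negb_or => /andP[h1 h2]; case: ifP => _; rewrite ?IH2 ?IH1.
- by move=> k l c1 IH s h; apply: (@loop_frame _ rraw) => // s'; apply: IH.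
Qed.
Lemma frame_iraw s : iraw (eval c s) = iraw s.
Proof.
elim: c s => //=.
- by move=> c1 IH1 d IH2 s; rewrite IH2 ?IH1.
- by move=> e f c1 IH1 d IH2 s; case: ifP => _; rewrite ?IH2 ?IH1.
- by move=> e f c1 IH1 d IH2 s; case: ifP => _; rewrite ?IH2 ?IH1.
- by move=> k l c1 IH s; apply: (@loop_frame _ iraw) => // s'; apply: IH.
Qed.
Lemma frame_bnd s : bnd (eval c s) = bnd s.
Proof.
elim: c s => //=.
- by move=> c1 IH1 d IH2 s; rewrite IH2 ?IH1.
- by move=> e f c1 IH1 d IH2 s; case: ifP => _; rewrite ?IH2 ?IH1.
- by move=> e f c1 IH1 d IH2 s; case: ifP => _; rewrite ?IH2 ?IH1.
- by move=> k l c1 IH s; apply: (@loop_frame _ bnd) => // s'; apply: IH.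
Qed.
End Frame.

Definition code_at (P : program) p (c : seq instr) :=
  forall i, (i < size c)%N -> nth Halt P (p + i) = nth Halt c i.

Definition same c s0 s := [/\ forall x, x \notin mod_iv c -> iv s x = iv s0 x,
  forall x, x \notin mod_rv c -> rv s x = rv s0 x,
  forall x, x \notin mod_ia c -> ia s x = ia s0 x,
  forall x, x \notin mod_ra c -> ra s x = ra s0 x
  & [/\ ~~ mod_raw c -> rraw s = rraw s0, iraw s = iraw s0 & bnd s = bnd s0]].

Lemma eval_same c s : same c s (eval c s).
Proof.
split=> [x|x|x|x|]; [exact: frame_iv|exact: frame_rv|exact: frame_ia|exact: frame_ra|].
by split; [exact: frame_rraw|exact: frame_iraw|exact: frame_bnd].
Qed.

(** The number of passes is fixed on entry. The rule supplies [same] at every pass, so that an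
    invariant has to speak only of what the loop changes. *)
Lemma For_ind k l c s0 (P : nat -> state -> Prop) : P 0%N (seti k 0 s0) ->
  (forall i s, (i < iv s0 l)%N -> iv s k = i -> same (For k l c) s0 s -> P i s ->
     P i.+1 (seti k i.+1 (eval c s))) ->
  P (iv s0 l) (eval (For k l c) s0).
Proof.
move=> P0 PS /=; have H n : (n <= iv s0 l)%N -> [/\ P n (loop k (eval c) n s0),
    iv (loop k (eval c) n s0) k = n & same (For k l c) s0 (loop k (eval c) n s0)].
  elim: n => [|n IH] lt.
    split=> //=; first by rewrite /upd (eqxx k : eqn k k = true).
    by split=> // x; rewrite /= inE negb_or /upd => /andP[/negbTE nk _]; rewrite (nk : eqn x k = false).
  have [h1 h2 h3] := IH (ltnW lt); split; first exact: PS.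
    by rewrite /= /upd (eqxx k : eqn k k = true).
  have [a1 a2 a3 a4 [a5 a6 a7]] := h3.
  have [b1 b2 b3 b4 [b5 b6 b7]] := eval_same c (loop k (eval c) n s0).
  split=> /= [x|x h|x h|x h|]; last by split=> [h||]; rewrite ?b5 ?a5 ?b6 ?b7.
  - rewrite inE negb_or /upd => /andP[nk h]; rewrite (negbTE nk : eqn x k = false) b1 //.
    by rewrite a1 // inE negb_or nk.
  - by rewrite b2 // a2.
  - by rewrite b3 // a3.
  - by rewrite b4 // a4.
by have [] := H _ (leqnn _).
Qed.

(** * Correctness and running time of the compiled code *)

Lemma code_at_cat P p c1 c2 :
  code_at P p (c1 ++ c2) -> code_at P p c1 /\ code_at P (p + size c1) c2.
Proof.
move=> H; split=> i hi.
  by rewrite H ?size_cat ?ltn_addr // nth_cat hi.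
by rewrite -addnA H ?size_cat ?ltn_add2l // nth_cat ltnNge leq_addr /= addKn.
Qed.

Lemma code_at_cons P p i c : code_at P p (i :: c) -> nth Halt P p = i /\ code_at P p.+1 c.
Proof.
move=> H; split; first by have := H 0%N isT; rewrite addn0.
by move=> j hj; rewrite addSnnS H.
Qed.

Lemma run_add P t1 t2 (c c' : config R) :
  run P t1 c = Some c' -> run P (t1 + t2) c = run P t2 c'.
Proof.
elim: t1 c => [|t1 IH] c /=; first by case=> ->.
by case: (step P c) => //= c1; apply: IH.
Qed.

Definition represents s (c : config R) :=
  [/\ forall x, ireg c x.*2 = iv s x,
      forall x, rreg c x.*2 = rv s x,
      ireg c 1%N = bnd s,
      (forall i k, (i < 16)%N -> imem c (16 * k + i + bnd s)%N = ia s i k) /\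
      (forall i k, (i < 16)%N -> rmem c (16 * k + i + bnd s)%N = ra s i k)
    & (forall a, (a < bnd s)%N -> imem c a = iraw s a) /\
      (forall a, (a < bnd s)%N -> rmem c a = rraw s a)].

(** Time is bounded from both sides, because the worst-case time is to be linear from below as
    well. *)
Definition reach P (c : config R) lo hi (Q : config R -> Prop) :=
  exists t c', [/\ (lo <= t <= hi)%N, run P t c = Some c' & Q c'].

Lemma reach_trans P c l1 h1 l2 h2 (Q Q' : config R -> Prop) :
  reach P c l1 h1 Q -> (forall c', Q c' -> reach P c' l2 h2 Q') ->
  reach P c (l1 + l2) (h1 + h2) Q'.
Proof.
move=> [t1 [c1 [/andP[a1 b1] e1 q1]]] /(_ _ q1) [t2 [c2 [/andP[a2 b2] e2 q2]]].
exists (t1 + t2)%N, c2; split=> //; first by rewrite !leq_add.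
by rewrite (run_add _ e1).
Qed.

Lemma reach_step P c c' l h (Q : config R -> Prop) :
  step P c = Some c' -> reach P c' l.-1 h Q -> reach P c l h.+1 Q.
Proof.
move=> e [t [c2 [/andP[a b] r q]]]; exists t.+1, c2; split=> //=; last by rewrite e.
by rewrite ltnS b andbT; case: l a.
Qed.

Lemma reach0 P c (Q : config R -> Prop) : Q c -> reach P c 0 0 Q.
Proof. by move=> q; exists 0%N, c. Qed.

Lemma reach_weaken P c l h l' h' (Q Q' : config R -> Prop) :
  (l' <= l)%N -> (h <= h')%N -> (forall c', Q c' -> Q' c') ->
  reach P c l h Q -> reach P c l' h' Q'.
Proof.
move=> ll hh qq [t [c' [/andP[a b] r q]]]; exists t, c'; split=> //; last exact: qq.
by rewrite (leq_trans ll) // (leq_trans b).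
Qed.

Lemma tiE d x : (((itmp d == x.*2) = false) * ((x.*2 == itmp d) = false) *
  ((itmp d == 1%N) = false) * ((1%N == itmp d) = false))%type.
Proof. by rewrite /itmp; do !split; apply/eqP; lia. Qed.

Lemma trE d x : (((rtmp d == x.*2) = false) * ((x.*2 == rtmp d) = false))%type.
Proof. by rewrite /rtmp; do !split; apply/eqP; lia. Qed.

Lemma ti_eq d d' : (itmp d == itmp d') = (d == d').
Proof. by rewrite /itmp; apply/eqP/eqP; lia. Qed.

Lemma tr_eq d d' : (rtmp d == rtmp d') = (d == d').
Proof. by rewrite /rtmp; apply/eqP/eqP; lia. Qed.

Lemma neqSn n : ((n == n.+1) = false) * ((n.+1 == n) = false).
Proof. by split; apply/eqP; lia. Qed.

(** The program counter 0 in the hypothesis is a dummy: [represents] does not look at it. *)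
Lemma represents_ti s p ir rr im rm d v :
  represents s (Config 0 ir rr im rm) ->
  represents s (Config p [eta ir with itmp d |-> v] rr im rm).
Proof. by case=> h1 h2 h3 h4 h5; split=> //= x; rewrite tiE. Qed.

Lemma represents_tr s p ir rr im rm d v :
  represents s (Config 0 ir rr im rm) ->
  represents s (Config p ir [eta rr with rtmp d |-> v] im rm).
Proof. by case=> h1 h2 h3 h4 h5; split=> //= x; rewrite trE. Qed.

Definition ires s (c : config R) p d v (c' : config R) :=
  [/\ pc c' = p, represents s c', ireg c' (itmp d) = v,
    forall d', (d' < d)%N -> ireg c' (itmp d') = ireg c (itmp d') & rreg c' = rreg c].

Lemma addn16 k : (k + k + (k + k) + (k + k + (k + k)) +
  (k + k + (k + k) + (k + k + (k + k))) = 16 * k)%N.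
Proof. by lia. Qed.

Ltac stp := match goal with H : nth Halt ?P ?p = _ |- reach ?P (Config ?p _ _ _ _) _ _ _ =>
   eapply (reach_step (c' := Config _ _ _ _ _));
   [rewrite /step /fetch /= H /=; reflexivity|]; clear H end.

Lemma addr_code_ok s P p d d' i c :
  code_at P p (addr_code d d' i) -> represents s c -> pc c = p -> d != d' ->
  reach P c 0 7 (fun c' => [/\ pc c' = (p + 7)%N, represents s c',
    ireg c' (itmp d) = (16 * ireg c (itmp d) + i + bnd s)%N,
    forall d'', d'' != d -> d'' != d' -> ireg c' (itmp d'') = ireg c (itmp d'')
    & rreg c' = rreg c]).
Proof.
case: c => [q ir rr im rm] /code_at_cons[g1 /code_at_cons[g2 /code_at_cons[g3
    /code_at_cons[g4 /code_at_cons[g5 /code_at_cons[g6 /code_at_cons[g7 _]]]]]]] rp /= qp dd; subst q.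
apply: (@reach_weaken _ _ 0 7 _ _ _ _ _ _ (fun c' H => H)) => //.
do 7!stp; apply: reach0; split=> //=.
- by lia.
- by do 7! apply: represents_ti; exact: rp.
- have dd' : d' != d by rewrite eq_sym.
  rewrite !ti_eq !eqxx ?(negbTE dd) ?(negbTE dd') ?tiE /= ?eqxx addn16.
  by case: rp => /= _ _ ->.
- by move=> d'' h1 h2; rewrite !ti_eq (negbTE h1) (negbTE h2).
Qed.
Opaque addr_code.

Lemma icode_ok e s P p d c :
  code_at P p (icode p d e) -> represents s c -> pc c = p -> iexp_wf e ->
  reach P c 0 (size (icode p d e)) (ires s c (p + size (icode p d e)) d (evi e s)).
Proof.
elim: e p d c => /= [x|k|e IHe f IHf|e IHe f IHf|i e IHe|e IHe] p d [q ir rr im rm] + + /= qp; subst q.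
- move=> /code_at_cons[h1 /code_at_cons[h2 _]] rp _.
  apply: (@reach_weaken _ _ 0 2 _ _ _ _ _ _ (fun c' H => H)) => //.
  stp; stp; apply: reach0; split=> //=.
  + by lia.
  + by do 2! apply: represents_ti; exact: rp.
  + by rewrite eqxx tiE; case: rp => /= ->.
  + by move=> d' hd; rewrite !ti_eq ltn_eqF.
- move=> /code_at_cons[h1 _] rp _.
  apply: (@reach_weaken _ _ 0 1 _ _ _ _ _ _ (fun c' H => H)) => //.
  stp; apply: reach0; split=> //=.
  + by lia.
  + by apply: represents_ti; exact: rp.
  + by rewrite eqxx.
  + by move=> d' hd; rewrite !ti_eq ltn_eqF.
- move=> /code_at_cat[h1 /code_at_cat[h2 /code_at_cons[h3 _]]] rp /andP[w1 w2].
  apply: (@reach_weaken _ _ (0 + (0 + 0)) (size (icode p d e) + (size (icode (p + size (icode p d e)) d.+1 f) + 1)) _ _ _ _ _ _ (fun c' H => H)) => //.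
    by rewrite !size_cat ?size_addr_code.
  apply: reach_trans (IHe _ _ _ h1 rp erefl w1) _ => -[q1 ir1 rr1 im1 rm1] /= [/= ? r1 v1 k1 ?]; subst q1 rr1.
  apply: reach_trans (IHf _ _ _ h2 r1 erefl w2) _ => -[q2 ir2 rr2 im2 rm2] /= [/= ? r2 v2 k2 ?]; subst q2 rr2.
  stp; apply: reach0; split=> //=.
  + by rewrite !size_cat ?size_addr_code /=; lia.
  + by apply: represents_ti; exact: r2.
  + by rewrite eqxx v2 k2 // v1.
  + by move=> d' hd; rewrite !ti_eq ltn_eqF // k2 ?k1 // ltnW.
- move=> /code_at_cat[h1 /code_at_cat[h2 /code_at_cons[h3 _]]] rp /andP[w1 w2].
  apply: (@reach_weaken _ _ (0 + (0 + 0)) (size (icode p d e) + (size (icode (p + size (icode p d e)) d.+1 f) + 1)) _ _ _ _ _ _ (fun c' H => H)) => //.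
    by rewrite !size_cat ?size_addr_code.
  apply: reach_trans (IHe _ _ _ h1 rp erefl w1) _ => -[q1 ir1 rr1 im1 rm1] /= [/= ? r1 v1 k1 ?]; subst q1 rr1.
  apply: reach_trans (IHf _ _ _ h2 r1 erefl w2) _ => -[q2 ir2 rr2 im2 rm2] /= [/= ? r2 v2 k2 ?]; subst q2 rr2.
  stp; apply: reach0; split=> //=.
  + by rewrite !size_cat ?size_addr_code /=; lia.
  + by apply: represents_ti; exact: r2.
  + by rewrite eqxx v2 k2 // v1.
  + by move=> d' hd; rewrite !ti_eq ltn_eqF // k2 ?k1 // ltnW.
- move=> /code_at_cat[h1 /code_at_cat[g1 /code_at_cons[g2 _]]] rp /andP[wi w1].
  apply: (@reach_weaken _ _ (0 + (0 + 0)) (size (icode p d e) + (7 + 1)) _ _ _ _ _ _ (fun c' H => H)) => //.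
    by rewrite !size_cat ?size_addr_code.
  apply: reach_trans (IHe _ _ _ h1 rp erefl w1) _ => -[q1 ir1 rr1 im1 rm1] /= [/= ? r1 v1 k1 ?]; subst q1 rr1.
  apply: reach_trans (addr_code_ok g1 r1 erefl _) _ => [|[q2 ir2 rr2 im2 rm2] /= [/= ? r2 v2 k2 ?]]; first by rewrite neqSn.
  subst q2 rr2; stp; apply: reach0; split=> //=.
  + by rewrite !size_cat ?size_addr_code /=; lia.
  + by apply: represents_ti; exact: r2.
  + by rewrite eqxx v2 v1; case: r2 => /= _ _ _ [-> //].
  + by move=> d' hd; rewrite !ti_eq ltn_eqF // k2 ?k1 ?ltn_eqF // ltnW.
- move=> /code_at_cat[h1 /code_at_cons[g1 /code_at_cons[g2 /code_at_cons[g3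
    /code_at_cons[g4 _]]]]] rp w1.
  apply: (@reach_weaken _ _ (0 + 0) (size (icode p d e) + 4) _ _ _ _ _ _ (fun c' H => H)) => //.
    by rewrite !size_cat ?size_addr_code.
  apply: reach_trans (IHe _ _ _ h1 rp erefl w1) _ => -[q1 ir1 rr1 im1 rm1] /= [/= ? r1 v1 k1 ?]; subst q1 rr1.
  stp; rewrite v1; have [_ _ eb _ [/= ei _]] := r1; rewrite -/(itmp d) /= in eb *; rewrite eb.
  case: ifP => lt.
    apply: (@reach_weaken _ _ 0 1 _ _ _ _ _ _ (fun c' H => H)) => //.
    rewrite !addnS addn0.
    stp; apply: reach0; split=> //=.
    + by rewrite !size_cat ?size_addr_code /=; lia.
    + by apply: represents_ti; exact: r1.
    + by rewrite eqxx v1 ei.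
    + by move=> d' hd; rewrite !ti_eq ltn_eqF // k1 // ltnW.
  apply: (@reach_weaken _ _ 0 2 _ _ _ _ _ _ (fun c' H => H)) => //.
  stp; stp; apply: reach0; split=> //=.
    + by rewrite !size_cat ?size_addr_code /=; lia.
    + by apply: represents_ti; exact: r1.
    + by rewrite eqxx.
    + by move=> d' hd; rewrite !ti_eq ltn_eqF // k1 // ltnW.
Qed.

Definition rres s (c : config R) p d v (c' : config R) :=
  [/\ pc c' = p, represents s c', rreg c' (rtmp d) = v &
    forall d', (d' < d)%N -> rreg c' (rtmp d') = rreg c (rtmp d')].

Lemma rcode_ok e s P p d c :
  code_at P p (rcode p d e) -> represents s c -> pc c = p -> rexp_wf e ->
  reach P c 0 (size (rcode p d e)) (rres s c (p + size (rcode p d e)) d (evr e s)).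
Proof.
(* Addition, subtraction and multiplication share one argument. *)
have binop o op f g :
  (forall p d c, code_at P p (rcode p d f) -> represents s c -> pc c = p -> rexp_wf f ->
     reach P c 0 (size (rcode p d f)) (rres s c (p + size (rcode p d f)) d (evr f s))) ->
  (forall p d c, code_at P p (rcode p d g) -> represents s c -> pc c = p -> rexp_wf g ->
     reach P c 0 (size (rcode p d g)) (rres s c (p + size (rcode p d g)) d (evr g s))) ->
  (forall p d ir rr im rm, nth Halt P p = o (rtmp d) (rtmp d) (rtmp d.+1) ->
     step P (@Config R p ir rr im rm) = Some (Config p.+1 ir
       [eta rr with rtmp d |-> op (rr (rtmp d)) (rr (rtmp d.+1))] im rm)) ->
  forall p d c, code_at P p (rcode p d f ++ rcode (p + size (rcode p d f)) d.+1 g ++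
      [:: o (rtmp d) (rtmp d) (rtmp d.+1)]) -> represents s c -> pc c = p -> rexp_wf f && rexp_wf g ->
    reach P c 0 (size (rcode p d f ++ rcode (p + size (rcode p d f)) d.+1 g ++
      [:: o (rtmp d) (rtmp d) (rtmp d.+1)])) (rres s c (p + size (rcode p d f ++ rcode (p + size (rcode p d f)) d.+1 g ++
      [:: o (rtmp d) (rtmp d) (rtmp d.+1)])) d (op (evr f s) (evr g s))).
- move=> IHe IHf so {}p {}d {}c; case: c => [q ir rr im rm] /code_at_cat[h1 /code_at_cat[h2 /code_at_cons[h3 _]]] rp /= qp /andP[w1 w2]; subst q.
  apply: (@reach_weaken _ _ (0 + (0 + 0)) (size (rcode p d f) + (size (rcode (p + size (rcode p d f)) d.+1 g) + 1)) _ _ _ _ _ _ (fun c' H => H)) => //.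
    by rewrite !size_cat.
  apply: reach_trans (IHe _ _ _ h1 rp erefl w1) _ => -[q1 ir1 rr1 im1 rm1] /= [/= ? r1 v1 k1]; subst q1.
  apply: reach_trans (IHf _ _ _ h2 r1 erefl w2) _ => -[q2 ir2 rr2 im2 rm2] /= [/= ? r2 v2 k2]; subst q2.
  apply: reach_step; first exact: so h3.
  apply: reach0; split=> //=.
  + by rewrite !size_cat /=; lia.
  + by apply: represents_tr; exact: r2.
  + by rewrite eqxx v2 k2 // v1.
  + by move=> d' hd; rewrite !tr_eq ltn_eqF // k2 ?k1 // ltnW.
elim: e p d c => [x|k|e IHe f IHf|e IHe f IHf|e IHe f IHf|e IHe f IHf|i e|e] p d c.
- case: c => [q ir rr im rm] /code_at_cons[h1 /code_at_cons[h2 _]] rp /= qp _; subst q.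
  stp; stp; apply: reach0; split=> //=.
  + by lia.
  + by do 2! apply: represents_tr; exact: rp.
  + by rewrite eqxx trE add0r; case: rp => /= _ ->.
  + by move=> d' hd; rewrite !tr_eq ltn_eqF.
- case: c => [q ir rr im rm] /code_at_cons[h1 _] rp /= qp _; subst q.
  stp; apply: reach0; split=> //=.
  + by lia.
  + by apply: represents_tr; exact: rp.
  + by rewrite eqxx.
  + by move=> d' hd; rewrite !tr_eq ltn_eqF.
- by apply: (binop RAdd +%R) => // p0 d0 ir rr im rm H; rewrite /step /fetch /= H.
- by apply: (binop RSub (fun x y => x - y)) => // p0 d0 ir rr im rm H; rewrite /step /fetch /= H.
- by apply: (binop RMul *%R) => // p0 d0 ir rr im rm H; rewrite /step /fetch /= H.
- case: c => [q ir rr im rm] /= /code_at_cat[h1 /code_at_cat[h2 /code_at_cons[g1 /code_at_cons[g2 /code_at_cons[g3 /code_at_cons[g4 /code_at_cons[g5 /code_at_cons[g6 _]]]]]]]] rp /= qp /andP[w1 w2]; subst q.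
  apply: (@reach_weaken _ _ (0 + (0 + 0)) (size (rcode p d e) + (size (rcode (p + size (rcode p d e)) d.+1 f) + 6)) _ _ _ _ _ _ (fun c' H => H)) => //.
    by rewrite !size_cat.
  apply: reach_trans (IHe _ _ _ h1 rp erefl w1) _ => -[q1 ir1 rr1 im1 rm1] /= [/= ? r1 v1 k1]; subst q1.
  apply: reach_trans (IHf _ _ _ h2 r1 erefl w2) _ => -[q2 ir2 rr2 im2 rm2] /= [/= ? r2 v2 k2]; subst q2.
  rewrite !size_cat /=.
  set q := (p + _ + _)%N in g1 g2 g3 g4 g5 g6 *.
  have rd1 : rr2 (rtmp d) = evr e s by rewrite k2 // v1.
  pose rr3 := [eta rr2 with rtmp d.+2 |-> 0].
  have rd3 : rr3 (rtmp d) = evr e s by rewrite /= tr_eq -(addn2 d) -[X in X == _]addn0 eqn_add2l.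
  have rd4 : rr3 (rtmp d.+1) = evr f s by rewrite /= tr_eq neqSn.
  have rd5 : rr3 (rtmp d.+2) = 0 by rewrite /= eqxx.
  have r3 p' : represents s (Config p' ir2 rr3 im2 rm2) by apply: represents_tr; exact: r2.
  have k3 d' : (d' < d)%N -> rr3 (rtmp d') = rr (rtmp d').
    by move=> hd; rewrite /= tr_eq ltn_eqF ?k2 ?k1 //; lia.
  apply: reach_step; first by rewrite /step /fetch /= g1.
  rewrite -/rr3; move: rr3 rd3 rd4 rd5 r3 k3 => rr3 rd3 rd4 rd5 r3 k3.
  have fin : evr f s != 0 -> reach P (Config (q + 5) ir2 rr3 im2 rm2) 0 3
     (rres s (Config p ir rr im rm) (p + (size (rcode p d e) + (size (rcode (p + size (rcode p d e)) d.+1 f) + 6))) d (evr e s / evr f s)).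
    move=> nz; apply: (@reach_weaken _ _ 0 1 _ _ _ _ _ _ (fun c' H => H)) => //.
    apply: reach_step; first by rewrite /step /fetch /= !addnS addn0 g6 rd4 (negbTE nz).
    apply: reach0; split=> //=.
    + by rewrite /q; lia.
    + by apply: represents_tr; exact: r3.
    + by rewrite eqxx rd3.
    + by move=> d' hd; rewrite tr_eq ltn_eqF // k3.
  apply: reach_step; first by rewrite /step /fetch /= g2 rd4 rd5.
  case: ltP => [lt0|ge0].
    by apply: (@reach_weaken _ _ 0 3 _ _ _ _ _ _ (fun c' H => H)) (fin _); rewrite // lt_eqF.
  apply: reach_step; first by rewrite /step /fetch /= g3 rd4 rd5.
  case: ltP => [gt0|le0]; first by apply: fin; rewrite gt_eqF.
  have -> : evr f s = 0 by apply/eqP; rewrite eq_le le0 ge0.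
  apply: (@reach_weaken _ _ 0 2 _ _ _ _ _ _ (fun c' H => H)) => //.
  stp; stp; apply: reach0; split=> //=.
    + by rewrite /q; lia.
    + by apply: represents_tr; exact: r3.
    + by rewrite eqxx invr0 mulr0.
    + by move=> d' hd; rewrite tr_eq ltn_eqF // k3.
- case: c => [q ir rr im rm] /= /code_at_cat[h1 /code_at_cat[g1 /code_at_cons[g2 _]]] rp /= qp /andP[wi w1]; subst q.
  apply: (@reach_weaken _ _ (0 + (0 + 0)) (size (icode p 0 e) + (7 + 1)) _ _ _ _ _ _ (fun c' H => H)) => //.
    by rewrite !size_cat size_addr_code.
  apply: reach_trans (icode_ok h1 rp erefl w1) _ => -[q1 ir1 rr1 im1 rm1] /= [/= ? r1 v1 k1 ?]; subst q1 rr1.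
  apply: reach_trans (addr_code_ok g1 r1 erefl _) _ => // -[q2 ir2 rr2 im2 rm2] /= [/= ? r2 v2 k2 ?].
  subst q2 rr2; stp; apply: reach0; split=> //=.
  + by rewrite !size_cat size_addr_code /=; lia.
  + by apply: represents_tr; exact: r2.
  + by rewrite eqxx v2 v1; case: r2 => /= _ _ _ [_ -> //].
  + by move=> d' hd; rewrite tr_eq ltn_eqF.
- case: c => [q ir rr im rm] /= /code_at_cat[h1 /code_at_cons[g1 /code_at_cons[g2 /code_at_cons[g3
    /code_at_cons[g4 _]]]]] rp /= qp w1; subst q.
  apply: (@reach_weaken _ _ (0 + 0) (size (icode p 0 e) + 4) _ _ _ _ _ _ (fun c' H => H)) => //.
    by rewrite !size_cat.
  apply: reach_trans (icode_ok h1 rp erefl w1) _ => -[q1 ir1 rr1 im1 rm1] /= [/= ? r1 v1 k1 ?]; subst q1 rr1.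
  have [_ _ /= eb _ [_ /= ei]] := r1.
  apply: reach_step; first by rewrite /step /fetch /= g1 v1 eb.
  case: ifP => lt.
    apply: (@reach_weaken _ _ 0 1 _ _ _ _ _ _ (fun c' H => H)) => //.
    rewrite !addnS addn0.
    stp; apply: reach0; split=> //=.
    + by rewrite !size_cat /=; lia.
    + by apply: represents_tr; exact: r1.
    + by rewrite eqxx v1 ei.
    + by move=> d' hd; rewrite tr_eq ltn_eqF.
  apply: (@reach_weaken _ _ 0 2 _ _ _ _ _ _ (fun c' H => H)) => //.
  stp; stp; apply: reach0; split=> //=.
    + by rewrite !size_cat /=; lia.
    + by apply: represents_tr; exact: r1.
    + by rewrite eqxx.
    + by move=> d' hd; rewrite tr_eq ltn_eqF.
Qed.

Lemma eqn_eq (x y : nat) : eqn x y = (x == y).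
Proof. by []. Qed.

Lemma double_eq x y : (x.*2 == y.*2) = (x == y).
Proof. by apply/eqP/eqP; lia. Qed.

Lemma represents_seti s p ir ir' rr im rm x v :
  (forall y, ir' y = if y == x.*2 then v else ir y) ->
  represents s (Config 0 ir rr im rm) -> represents (seti x v s) (Config p ir' rr im rm).
Proof.
move=> E [/= h1 h2 h3 h4 h5]; split=> //= [y|]; rewrite E.
  by rewrite double_eq /upd eqn_eq h1.
by rewrite (_ : _ == _ = false) //; apply/eqP; lia.
Qed.

Lemma represents_setr s p ir rr rr' im rm x v :
  (forall y, rr' y = if y == x.*2 then v else rr y) ->
  represents s (Config 0 ir rr im rm) -> represents (setr x v s) (Config p ir rr' im rm).
Proof.
by move=> E [/= h1 h2 h3 h4 h5]; split=> //= y; rewrite E double_eq /upd eqn_eq h2.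
Qed.

Lemma addr_eq i k j l b : (i < 16)%N -> (j < 16)%N ->
  (16 * k + i + b == 16 * l + j + b)%N = (i == j) && (k == l).
Proof. by move=> h1 h2; apply/eqP/andP => [|[/eqP-> /eqP->]] //; split; apply/eqP; lia. Qed.

Lemma represents_setia s p ir rr im im' rm i k v : (i < 16)%N ->
  (forall a, im' a = if (a == 16 * k + i + bnd s)%N then v else im a) ->
  represents s (Config 0 ir rr im rm) -> represents (setia i k v s) (Config p ir rr im' rm).
Proof.
move=> hi E [/= h1 h2 h3 [h4 h4'] [h5 h5']]; split=> //=; split=> //; [move=> j l hj | move=> a ha]; rewrite E.
  rewrite addr_eq // /upd !eqn_eq; case: eqP => [->|_] /=; rewrite ?h4 //.
by rewrite ltn_eqF ?h5 // ltn_addl.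
Qed.

Lemma represents_setra s p ir rr im rm rm' i k v : (i < 16)%N ->
  (forall a, rm' a = if (a == 16 * k + i + bnd s)%N then v else rm a) ->
  represents s (Config 0 ir rr im rm) -> represents (setra i k v s) (Config p ir rr im rm').
Proof.
move=> hi E [/= h1 h2 h3 [h4 h4'] [h5 h5']]; split=> //=; split=> //; [move=> j l hj | move=> a ha]; rewrite E.
  rewrite addr_eq // /upd !eqn_eq; case: eqP => [->|_] /=; rewrite ?h4' //.
by rewrite ltn_eqF ?h5' // ltn_addl.
Qed.

Lemma represents_setraw s p ir rr im rm rm' k v : (k < bnd s)%N ->
  (forall a, rm' a = if (a == k)%N then v else rm a) ->
  represents s (Config 0 ir rr im rm) -> represents (setraw k v s) (Config p ir rr im rm').
Proof.
move=> hi E [/= h1 h2 h3 [h4 h4'] [h5 h5']]; split=> //=; split=> //; [move=> j l hj | move=> a ha]; rewrite E.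
  by rewrite gtn_eqF ?h4' //; lia.
by rewrite hi /upd eqn_eq h5'.
Qed.

Definition cres s p (c' : config R) := pc c' = p /\ represents s c'.

(** Induction on the command. Only loops contribute to the lower time bound, so the other cases use
    the trivial bound 0 for their expressions. *)
Lemma code_ok e s P p c :
  code_at P p (ccode p e) -> represents s c -> pc c = p -> cmd_wf e ->
  reach P c (min_cost e s) (cost e s) (cres (eval e s) (p + size (ccode p e))).
Proof.
elim: e s p c => [|x e|x e|i e f|i e f|e f|e IHe f IHf|e f c1 IH1 c2 IH2|e f c1 IH1 c2 IH2|k l e IH] s p c /=.
- by move=> _ rp pq _; apply: reach0; split=> //=; rewrite addn0.
- case: c => [q ir rr im rm] /code_at_cat[h1 /code_at_cons[g1 /code_at_cons[g2 _]]] rp /= qp w; subst q.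
  rewrite size_cat /= -(size_ci p 0).
  apply: (@reach_trans _ _ 0 _ 0) (icode_ok h1 rp erefl w) _ => -[q1 ir1 rr1 im1 rm1] /= [/= ? r1 v1 k1 ?]; subst q1 rr1.
  stp; stp; apply: reach0; split=> //=; first by lia.
  apply: represents_seti r1 => y /=; case: eqP => // _; first by rewrite eqxx tiE v1.
- case: c => [q ir rr im rm] /code_at_cat[h1 /code_at_cons[g1 /code_at_cons[g2 _]]] rp /= qp w; subst q.
  rewrite size_cat /= -(size_cr p 0).
  apply: (@reach_trans _ _ 0 _ 0) (rcode_ok h1 rp erefl w) _ => -[q1 ir1 rr1 im1 rm1] /= [/= ? r1 v1 k1]; subst q1.
  stp; stp; apply: reach0; split=> //=; first by lia.
  by apply: represents_setr r1 => y /=; case: eqP => // _; rewrite eqxx trE v1 add0r.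
- case: c => [q ir rr im rm] /code_at_cat[h1 /code_at_cat[h2 /code_at_cat[g1 /code_at_cons[g2 _]]]] rp /= qp /and3P[wi w1 w2]; subst q.
  rewrite !size_cat size_addr_code.
  rewrite -(size_ci p 0) -(size_ci (p + size (icode p 0 e)) 1) -[8%N]/(7 + 1)%N -addnA.
  apply: (@reach_trans _ _ 0 _ 0) (icode_ok h1 rp erefl w1) _ => -[q1 ir1 rr1 im1 rm1] /= [/= ? r1 v1 k1 ?]; subst q1 rr1.
  apply: (@reach_trans _ _ 0 _ 0) (icode_ok h2 r1 erefl w2) _ => -[q2 ir2 rr2 im2 rm2] /= [/= ? r2 v2 k2 ?]; subst q2 rr2.
  apply: (@reach_trans _ _ 0 _ 0) (addr_code_ok g1 r2 erefl _) _ => // -[q3 ir3 rr3 im3 rm3] /= [/= ? r3 v3 k3 ?]; subst q3 rr3.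
  stp; apply: reach0; split=> //=; first by lia.
  by apply: represents_setia r3 => // a /=; rewrite v3 k2 // v1 k3 // v2.
- case: c => [q ir rr im rm] /code_at_cat[h1 /code_at_cat[h2 /code_at_cat[g1 /code_at_cons[g2 _]]]] rp /= qp /and3P[wi w1 w2]; subst q.
  rewrite !size_cat size_addr_code.
  rewrite [(ilen e + _)%N]addnC -(size_cr p 0) -(size_ci (p + size (rcode p 0 f)) 0) -[8%N]/(7 + 1)%N -addnA.
  apply: (@reach_trans _ _ 0 _ 0) (rcode_ok h1 rp erefl w2) _ => -[q1 ir1 rr1 im1 rm1] /= [/= ? r1 v1 k1]; subst q1.
  apply: (@reach_trans _ _ 0 _ 0) (icode_ok h2 r1 erefl w1) _ => -[q2 ir2 rr2 im2 rm2] /= [/= ? r2 v2 k2 ?]; subst q2 rr2.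
  apply: (@reach_trans _ _ 0 _ 0) (addr_code_ok g1 r2 erefl _) _ => // -[q3 ir3 rr3 im3 rm3] /= [/= ? r3 v3 k3 ?]; subst q3 rr3.
  stp; apply: reach0; split=> //=; first by lia.
  by apply: represents_setra r3 => // a /=; rewrite v3 v2 v1.
- case: c => [q ir rr im rm] /code_at_cat[h1 /code_at_cat[h2 /code_at_cons[g1 /code_at_cons[g2 /code_at_cons[g3 _]]]]] rp /= qp /andP[w1 w2]; subst q.
  rewrite !size_cat.
  rewrite [(ilen e + _)%N]addnC -(size_cr p 0) -(size_ci (p + size (rcode p 0 f)) 0) -addnA.
  apply: (@reach_trans _ _ 0 _ 0) (rcode_ok h1 rp erefl w2) _ => -[q1 ir1 rr1 im1 rm1] /= [/= ? r1 v1 k1]; subst q1.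
  apply: (@reach_trans _ _ 0 _ 0) (icode_ok h2 r1 erefl w1) _ => -[q2 ir2 rr2 im2 rm2] /= [/= ? r2 v2 k2 ?]; subst q2 rr2.
  have [_ _ /= eb _ _] := r2.
  apply: reach_step; first by rewrite /step /fetch /= g1 v2 eb.
  case: ifP => lt.
    rewrite addnS addnS addn0; stp; apply: reach0; split=> //=; first by lia.
    by apply: represents_setraw r2 => //= a; rewrite v2 v1.
  stp; apply: reach0; split=> //=; first by lia.
  by rewrite /setraw lt; case: r2.
- move=> /code_at_cat[h1 h2] rp qp /andP[w1 w2]; rewrite size_cat addnA.
  apply: reach_trans (IHe _ _ _ h1 rp qp w1) _ => c' [q' r'].
  exact: IHf.
- case: c => [q ir rr im rm] /code_at_cat[h1 /code_at_cat[h2 /code_at_cons[g1 /code_at_cat[h3 /code_at_cons[g2 h4]]]]] rp /= qp /and4P[w1 w2 w3 w4]; subst q.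
  rewrite -(size_ci p 0) -(size_ci (p + size (icode p 0 e)) 1) -addnA.
  rewrite !size_cat /= !size_cat /=.
  apply: (@reach_trans _ _ 0 _ 0) (icode_ok h1 rp erefl w1) _ => -[q1 ir1 rr1 im1 rm1] /= [/= ? r1 v1 k1 ?]; subst q1 rr1.
  apply: (@reach_trans _ _ 0 _ 0) (icode_ok h2 r1 erefl w2) _ => -[q2 ir2 rr2 im2 rm2] /= [/= ? r2 v2 k2 ?]; subst q2 rr2.
  set q := (p + _ + _)%N in g1 g2 h3 h4 *.
  have r2' p' : represents s (Config p' ir2 rr im2 rm2) by exact: r2.
  case: ifP => lt; rewrite ?addn1 ?addn2.
    apply: reach_step; first by rewrite /step /fetch /= g1 v2 (k2 0%N isT) v1 lt.
    rewrite addSn in h4.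
    apply: (@reach_weaken _ _ (min_cost c1 s) (cost c1 s)) (IH1 s _ (Config _ _ _ _ _) h4 (r2' _) erefl w3) => // c' [e' r'].
    by split=> //; rewrite e' /q; lia.
  apply: reach_step; first by rewrite /step /fetch /= g1 v2 (k2 0%N isT) v1 lt.
  rewrite -[(cost c2 s).+1]addn1.
  apply: (@reach_trans _ _ 0 _ 0).
    exact: (@reach_weaken _ _ (min_cost c2 s) (cost c2 s) _ _ _ _ _ _ (fun c' H => H)) (IH2 s _ (Config _ _ _ _ _) h3 (r2' _) erefl w4).
  move=> [q3 ir3 rr3 im3 rm3] [/= ? r3]; subst q3.
  stp; apply: reach0; split=> //=; rewrite /q; lia.
- case: c => [q ir rr im rm] /code_at_cat[h1 /code_at_cat[h2 /code_at_cons[g1 /code_at_cat[h3 /code_at_cons[g2 h4]]]]] rp /= qp /and4P[w1 w2 w3 w4]; subst q.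
  rewrite -(size_cr p 0) -(size_cr (p + size (rcode p 0 e)) 1) -addnA.
  rewrite !size_cat /= !size_cat /=.
  apply: (@reach_trans _ _ 0 _ 0) (rcode_ok h1 rp erefl w1) _ => -[q1 ir1 rr1 im1 rm1] /= [/= ? r1 v1 k1]; subst q1.
  apply: (@reach_trans _ _ 0 _ 0) (rcode_ok h2 r1 erefl w2) _ => -[q2 ir2 rr2 im2 rm2] /= [/= ? r2 v2 k2]; subst q2.
  set q := (p + _ + _)%N in g1 g2 h3 h4 *.
  have r2' p' : represents s (Config p' ir2 rr2 im2 rm2) by exact: r2.
  case: ifP => lt; rewrite ?addn1 ?addn2.
    apply: reach_step; first by rewrite /step /fetch /= g1 v2 (k2 0%N isT) v1 lt.
    rewrite addSn in h4.
    apply: (@reach_weaken _ _ (min_cost c1 s) (cost c1 s)) (IH1 s _ (Config _ _ _ _ _) h4 (r2' _) erefl w3) => // c' [e' r'].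
    by split=> //; rewrite e' /q; lia.
  apply: reach_step; first by rewrite /step /fetch /= g1 v2 (k2 0%N isT) v1 lt.
  rewrite -[(cost c2 s).+1]addn1.
  apply: (@reach_trans _ _ 0 _ 0).
    exact: (@reach_weaken _ _ (min_cost c2 s) (cost c2 s) _ _ _ _ _ _ (fun c' H => H)) (IH2 s _ (Config _ _ _ _ _) h3 (r2' _) erefl w4).
  move=> [q3 ir3 rr3 im3 rm3] [/= ? r3]; subst q3.
  stp; apply: reach0; split=> //=; rewrite /q; lia.
- case: c => [q ir rr im rm] /code_at_cons[g1 /code_at_cons[g2 /code_at_cons[g3 /code_at_cat[h1 /code_at_cons[g4 /code_at_cons[g5 /code_at_cons[g6 _]]]]]]] rp /= qp /and4P[/negbTE nkl kl1 kl2 w]; subst q.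
  rewrite -addn3 in h1 g4 g5 g6.
  set L := iv s l; set B := loop k (eval e).
  rewrite (addnS _ 2).
  apply: reach_step; first by rewrite /step /fetch /= g1.
  have lpos n : iv (B n s) l = L.
    elim: n => [|n IHn]; rewrite /B /= /upd eqn_eq eq_sym nkl // frame_iv //.
  have kpos n : iv (B n s) k = n.
    by rewrite /B; case: n => [|m] /=; rewrite /upd eqn_eq eqxx.
  (* The invariant holds at the test instruction [p.+1]; [n] passes take at least [n] steps. *)
  have main n : (n <= L)%N -> reach P (Config p.+1 [eta ir with k.*2 |-> 0%N] rr im rm)
      n (\sum_(i < n) (cost e (B i s) + 4)) (cres (B n s) p.+1).
    elim: n => [_|n IHn lt].
      rewrite big_ord0; apply: reach0; split=> //.
      by apply: represents_seti rp => y.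
    rewrite big_ord_recr; apply: (@reach_weaken _ _ (n + 1) _ _ _ _ _ _ _ (fun c' H => H)); first 1 last; [exact: leqnn| |by lia].
    apply: reach_trans (IHn (ltnW lt)) _ => -[q1 ir1 rr1 im1 rm1] [/= ? r1]; subst q1.
    have vk : ir1 k.*2 = n.
      by case: r1 => /= -> _ _ _ _; rewrite kpos.
    have vl : ir1 l.*2 = L by case: r1 => /= -> _ _ _ _.
    have r1' p' : represents (B n s) (Config p' ir1 rr1 im1 rm1) by exact: r1.
    rewrite (addnS _ 3); apply: reach_step; first by rewrite /step /fetch /= g2 vk vl lt.
    apply: (@reach_trans _ _ 0 _ 0).
      exact: (@reach_weaken _ _ (min_cost e (B n s)) (cost e (B n s)) _ _ _ _ _ _ (fun c' H => H)) (IH _ _ (Config _ _ _ _ _) h1 (r1' _) erefl w).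
    move=> [q2 ir2 rr2 im2 rm2] [/= ? r2]; subst q2.
    stp; stp; stp; apply: reach0; split=> //.
    have vk2 : ir2 k.*2 = n.
      case: r2 => /= -> _ _ _ _; rewrite frame_iv // kpos.
    apply: represents_seti (represents_ti 0 0 1%N (r2 : represents _ (Config 0 _ _ _ _))) => y /=.
    by case: eqP => // _; rewrite ?eqxx tiE vk2 addn1.
  apply: (@reach_weaken _ _ (L + 0) _ _ _ _ _ _ _ (fun c' H => H)); first 1 last; [exact: leqnn| |by lia].
  apply: reach_trans (main L (leqnn _)) _.
  move=> [q1 ir1 rr1 im1 rm1] [/= ? r1]; subst q1.
  have [/= v1 _ _ _ _] := r1.
  apply: reach_step; first by rewrite /step /fetch /= g2 !v1 lpos kpos ltnn.
  stp; apply: reach0; split=> //=.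
  by rewrite size_cat /=; lia.
Qed.
End Lang.

(** * Lower and upper lines on a tree *)

Section Instances.
Variable R : realType.

(* A tree on [0, ..., sz - 1] with root 0, where every vertex has a lower line
   [la - ls * x] and the negative [na - ns * x] of an upper line. *)
Record inst := Inst { sz : nat; par : nat -> nat;
  la : nat -> R; ls : nat -> R; na : nat -> R; ns : nat -> R }.

Definition lo_line I k (x : R) := la I k - ls I k * x.
Definition up_line I k (x : R) := na I k - ns I k * x.

Definition inst_wf I := [/\ (0 < sz I)%N, forall k, (0 < k < sz I)%N -> (par I k < k)%N
  & forall k, (k < sz I)%N -> 0 < ls I k /\ 0 < ns I k].

(* The upper line of a vertex bounds the values at its proper descendants only: the constraint
   of a vertex with itself is part of the lower bound [e]. *)
Definition feas I (e x : R) := e <= x /\ exists g : nat -> R,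
  (forall k, (k < sz I)%N -> lo_line I k x <= g k) /\
  (forall k, (0 < k < sz I)%N -> g k <= g (par I k) /\ g k + up_line I (par I k) x <= 0).

Definition opt I e eps := feas I e eps /\ forall x, x < eps -> ~ feas I e x.

Lemma par_lt I k : inst_wf I -> (0 < k < sz I)%N -> (par I k < sz I)%N.
Proof. by case=> _ h _ hk; apply: ltn_trans (h _ hk) _; case/andP: hk. Qed.

(** All slopes are positive, so a larger [x] lowers every lower line and raises every upper one, and
    the same [g] serves. *)
Lemma feas_mono I e x x' : inst_wf I -> feas I e x -> x <= x' -> feas I e x'.
Proof.
move=> w [ex [g [g1 g2]]] le; split; first exact: le_trans le.
have [_ _ sl] := w.
exists g; split=> [k hk|k hk].
  apply: le_trans (g1 _ hk); have [h _] := sl _ hk.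
  by rewrite /lo_line lerB // ler_wpM2l // ltW.
have [h1 h2] := g2 _ hk; split=> //; apply: le_trans h2.
have [_ h] := sl _ (par_lt w hk).
by rewrite lerD // lerB // ler_wpM2l // ltW.
Qed.

(* By monotonicity, only the feasibility of values just below the optimum matters. *)
Lemma opt_near I I' e e' eps d : inst_wf I -> inst_wf I' -> d < eps ->
  (forall x, d <= x <= eps -> (feas I e x <-> feas I' e' x)) ->
  opt I e eps -> opt I' e' eps.
Proof.
move=> w w' de H [h1 h2]; split.
  by apply/H => //; rewrite ltW ?lexx.
move=> x xe fx; apply: (h2 (Num.max x d)); first by rewrite gt_max xe.
apply/H; first by rewrite le_max lexx orbT ge_max !ltW.
by apply: feas_mono fx _ => //; rewrite le_max lexx.
Qed.

Lemma opt_le I e eps t : inst_wf I -> opt I e eps -> feas I e t <-> eps <= t.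
Proof.
move=> w [h1 h2]; split=> [ft|]; last exact: feas_mono.
by rewrite leNgt; apply/negP => /h2.
Qed.

Definition side (sg t eps : R) := (sg = -1 /\ eps <= t) \/ (sg = 1 /\ t < eps).

(** If [t] is infeasible, the interval from [t] to the optimum lies beyond [t]; if it is feasible,
    everything up to the optimum lies below [t], and any left end will do. *)
Lemma side_near sg t eps : side sg t eps ->
  exists2 d, d < eps & forall x, d <= x <= eps -> 0 <= sg * (x - t).
Proof.
case=> -[-> h].
  by exists (eps - 1) => [|x /andP[_ h2]]; [lra | nra].
by exists t => // x /andP[h2 _]; rewrite mul1r subr_ge0.
Qed.

(* With x / 0 = 0, parallel lines get crossing 0, for which the statement holds too. *)
Lemma larger_line (a1 s1 a2 s2 sg x : R) : let c := (a1 - a2) / (s1 - s2) in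
  sg * sg = 1 -> a2 - s2 * (c + sg) <= a1 - s1 * (c + sg) -> 0 <= sg * (x - c) ->
  a2 - s2 * x <= a1 - s1 * x.
Proof.
move=> c; have [e|ne] := eqVneq (s1 - s2) 0.
  have -> : s1 = s2 by lra.
  lra.
have e : a1 - a2 = (s1 - s2) * c by rewrite /c mulrC divfK.
move: c e => c e sg2 h1 h2.
have h3 : 0 <= - (s1 - s2) * sg by nra.
have h4 : 0 <= - (s1 - s2) * (x - c).
  have -> : - (s1 - s2) * (x - c) = (- (s1 - s2) * sg) * (sg * (x - c)).
    by rewrite -[LHS]mul1r -sg2; ring.
  exact: mulr_ge0.
nra.
Qed.

Definition leaf I k := forall j, (0 < j < sz I)%N -> par I j <> k.

(* Contracting [u] into [v] loses no constraint but the one between the lower line of [u] and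
   the upper line of [v]. *)
Definition mergeable I u v := [/\ (v < u)%N, (u < sz I)%N &
  (par I u = v /\ (leaf I u \/ forall k, (0 < k < sz I)%N -> par I k = v -> k = u)) \/
  [/\ (0 < v)%N, par I u = par I v, leaf I u & leaf I v]].

(* The upper line of a leaf is irrelevant; that of its parent is a convenient choice. *)
Definition leaf_up I := forall k, (0 < k < sz I)%N -> leaf I k ->
  forall x, up_line I k x = up_line I (par I k) x.

Definition cross I u v := (la I u + na I v) / (ls I u + ns I v).

Lemma cross_le I u v x : inst_wf I -> (u < sz I)%N -> (v < sz I)%N ->
  (cross I u v <= x) = (lo_line I u x + up_line I v x <= 0).
Proof.
move=> [_ _ sl] hu hv; have [h1 _] := sl _ hu; have [_ h2] := sl _ hv.
rewrite /cross ler_pdivrMr ?addr_gt0 // /lo_line /up_line; apply/idP/idP; lra.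
Qed.

(** If [u] is a child of [v], then [g u] lies between the two lines. If both are leaves, the upper
    line of [v] is that of the common parent, which bounds [g u] as well. *)
Lemma feas_cross I e u v x : inst_wf I -> leaf_up I -> mergeable I u v -> feas I e x ->
  cross I u v <= x.
Proof.
move=> w lu [vu um k] [_ [g [g1 g2]]].
have u0 : (0 < u < sz I)%N by rewrite um andbT (leq_ltn_trans _ vu).
have vm : (v < sz I)%N by apply: ltn_trans um.
rewrite cross_le //; have [h1 h2] := g2 _ u0; have h3 := g1 _ um.
case: k => [[e1 _]|[v0 e1 l1 l2]]; first by move: h2; rewrite e1; lra.
by rewrite lu ?v0 //; move: h2; rewrite e1; lra.
Qed.

(** By [feas_cross] every feasible [x] is beyond all crossings of mergeable pairs. Hence [e] may be
    replaced by its maximum with them, which is characterised here as a least upper bound. *)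
Lemma feas_raise I e e' (ps : seq (nat * nat)) x : inst_wf I -> leaf_up I ->
  (forall p, p \in ps -> mergeable I p.1 p.2) -> e <= e' ->
  (forall y, e <= y -> (forall p, p \in ps -> cross I p.1 p.2 <= y) -> e' <= y) ->
  feas I e x <-> feas I e' x.
Proof.
move=> w lu pm ee min; split=> [f|[h1 h2]]; last by split=> //; apply: le_trans ee h1.
have [h1 h2] := f; split=> //; apply: min => // p /pm mp; exact: feas_cross mp f.
Qed.

(** Upper lines enter the constraints only through parents, and a leaf is the parent of no
    vertex. *)
Lemma feas_leaf I e x b r : inst_wf I ->
  (forall k, (k < sz I)%N -> b k = na I k /\ r k = ns I k \/ leaf I k) ->
  feas I e x <-> feas (Inst (sz I) (par I) (la I) (ls I) b r) e x.
Proof.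
move=> w H; suff E k : (0 < k < sz I)%N -> up_line (Inst (sz I) (par I) (la I) (ls I) b r) (par I k) x = up_line I (par I k) x.
  by split=> -[h1 [g [g1 g2]]]; split=> //; exists g; split=> // k hk; move: (g2 k hk) => /=; rewrite E.
by move=> hk; case: (H (par I k)) => [|[h1 h2]|/(_ k hk)//]; [exact: par_lt|rewrite /up_line /= h1 h2].
Qed.

(** [tg u] is the vertex into which [u] is to be merged and [sr] is the partial inverse: every
    vertex absorbs at most one other, and no vertex occurs in both roles. *)
Definition pairing (tg sr : nat -> option nat) :=
  (forall u v, tg u = Some v <-> sr v = Some u) /\ (forall u v, tg u = Some v -> tg v = None /\ sr u = None).

(** Giving [v] the larger of the two lower lines of its pair is harmless, since [g v] may be raised
    to its maximum with [g u]: a child [u] has [g u <= g v] anyway, and a sibling [u] is subject to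
    the same upper constraints as [v]. *)
Lemma feas_lower I e x a s tg sr : inst_wf I -> pairing tg sr ->
  (forall u v, tg u = Some v -> mergeable I u v) ->
  (forall v, sr v = None -> a v = la I v /\ s v = ls I v) ->
  (forall u v, tg u = Some v -> [/\ lo_line I u x <= a v - s v * x,
     lo_line I v x <= a v - s v * x &
     (a v = la I u /\ s v = ls I u) \/ (a v = la I v /\ s v = ls I v)]) ->
  feas I e x <-> feas (Inst (sz I) (par I) a s (na I) (ns I)) e x.
Proof.
move=> w [tgsr _] mg same win; split=> -[ex [g [g1 g2]]]; split=> //; last first.
  exists g; split=> // k hk; apply: le_trans (g1 k hk); rewrite {2}/lo_line /=.
  case E: (sr k) => [u|]; first by have/tgsr/win[] := E.
  by have [-> ->] := same _ E.
pose g' k := if sr k is Some u then Num.max (g k) (g u) else g k.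
have gg' k : g k <= g' k by rewrite /g'; case: (sr k) => // u; rewrite le_max lexx.
exists g'; split=> k hk /=.
  rewrite /lo_line /= /g'; case E: (sr k) => [u|]; last first.
    by have [-> ->] := same _ E; apply: g1.
  have um : (u < sz I)%N by have/tgsr/mg[] := E.
  rewrite le_max; have/tgsr/win[_ _ [[-> ->]|[-> ->]]] := E; apply/orP.
    by right; apply: g1.
  by left; apply: g1.
have [h1 h2] := g2 k hk.
suff main : forall z, g z <= g (par I k) -> g z + up_line I (par I k) x <= 0 ->
    g z <= g' (par I k) /\ g z + up_line I (par I k) x <= 0.
  rewrite {1 3}/g'; case E: (sr k) => [u|]; last exact: main.
  have/tgsr/mg[vu um [[eq _]|[_ eq _ _]]] := E.
    have := g2 u; rewrite um (leq_ltn_trans _ vu) // eq => /(_ isT)[h _].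
    by rewrite max_l //; apply: main.
  have := g2 u; rewrite um (leq_ltn_trans _ vu) // eq => /(_ isT)[h h'].
  by case: (leP (g k) (g u)) => _; apply: main.
by move=> z hz1 hz2; split=> //; apply: le_trans (gg' _).
Qed.

Definition assoc (ps : seq (nat * nat)) u :=
  if u \in unzip1 ps then Some (nth 0%N (unzip2 ps) (index u (unzip1 ps))) else None.

Lemma assocP ps u v : uniq (unzip1 ps) -> assoc ps u = Some v <-> (u, v) \in ps.
Proof.
rewrite /assoc; elim: ps => //= -[u1 v1] ps IH /= /andP[nin un].
rewrite !inE xpair_eqE [u == u1]eq_sym; have [e|ne] /= := eqVneq u1 u; last exact: IH.
subst u1; split=> [[->]|]; first by rewrite eqxx.
by case/orP => [/eqP-> //|h]; rewrite (map_f fst h) in nin.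
Qed.

Definition swap (p : nat * nat) := (p.2, p.1).
Definition src ps := assoc (map swap ps).

Lemma srcP ps u v : uniq (unzip2 ps) -> src ps v = Some u <-> (u, v) \in ps.
Proof.
move=> un; rewrite /src assocP; last by rewrite /unzip1 -map_comp.
rewrite (_ : (v, u) = swap (u, v)) // mem_map //.
by move=> [a b] [a' b'] [-> ->].
Qed.

Lemma pairing_of ps : uniq (unzip1 ps ++ unzip2 ps) -> pairing (assoc ps) (src ps).
Proof.
rewrite cat_uniq => /and3P[u1 h u2]; split=> u v; first by rewrite assocP // srcP.
move=> /(assocP _ _ u1) h1; split.
  rewrite /assoc; case: ifP => // h3; case/negP: h; apply/hasP; exists v => //.
  exact: (map_f snd h1).
case E: (src ps u) => [w|] //; have /(srcP _ _ u2) h3 := E.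
by case/negP: h; apply/hasP; exists u; [exact: (map_f snd h3)|exact: (map_f fst h1)].
Qed.

(** * Contraction of pairs *)

Section Contract.
Variables (m : nat) (tg : nat -> option nat).
Definition alive k := tg k == None.
Definition survivors := [seq k <- iota 0 m | alive k].
Definition rank k := count alive (iota 0 k).
Definition target k := odflt k (tg k).

Lemma nth_survivors k : (k < m)%N -> alive k ->
  (rank k < size survivors)%N /\ nth 0%N survivors (rank k) = k.
Proof.
move=> km ak; rewrite /survivors /rank.
have -> : m = (k + (m - k.+1).+1)%N by lia.
rewrite iotaD filter_cat add0n /= ak size_cat size_filter; split; first (rewrite -addn1 leq_add2l /=; by []).
by rewrite nth_cat size_filter ltnn subnn.
Qed.

Lemma survivors_rank j : (j < size survivors)%N ->
  let k := nth 0%N survivors j in [/\ (k < m)%N, alive k & rank k = j].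
Proof.
move=> hj k; have : k \in survivors by apply: mem_nth.
rewrite mem_filter mem_iota /= add0n => /andP[ak km]; split=> //.
have [h1 h2] := nth_survivors km ak.
have un : uniq survivors by rewrite filter_uniq ?iota_uniq.
by apply/eqP; rewrite -(nth_uniq 0%N h1 hj un) h2.
Qed.

Lemma rank_lt i k : (i < k)%N -> alive i -> (rank i < rank k)%N.
Proof.
move=> ik ai; rewrite /rank (_ : k = i + (k - i.+1).+1)%N; last by lia.
by rewrite iotaD count_cat add0n /= ai; lia.
Qed.

(** Renumbering by [rank] preserves the order of the survivors, hence parents still precede
    children. Only the upper lines [b], [r] are passed separately; the lower lines of [I] are meant
    to be resolved already. *)
Definition contract I (b r : nat -> R) := Inst (size survivors)
  (fun j => rank (target (par I (nth 0%N survivors j))))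
  (fun j => la I (nth 0%N survivors j)) (fun j => ls I (nth 0%N survivors j))
  (fun j => b (nth 0%N survivors j)) (fun j => r (nth 0%N survivors j)).

End Contract.

Section ContractFeas.
Variables (I : inst) (tg sr : nat -> option nat) (b r : nat -> R).
Hypotheses (w : inst_wf I) (pr : pairing tg sr).
Hypothesis mg : forall u v, tg u = Some v -> mergeable I u v.

Lemma alive_target k : alive tg (target tg k).
Proof. by rewrite /alive /target; case E: (tg k) => [v|] /=; [have [_ /(_ _ _ E)[->]] := pr|rewrite E]. Qed.

Lemma target_le k : (target tg k <= k)%N.
Proof. by rewrite /target; case E: (tg k) => [v|] //=; have [/ltnW] := mg E. Qed.

Lemma target_alive k : alive tg k -> target tg k = k.
Proof. by rewrite /alive /target => /eqP ->. Qed.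

Lemma alive0 : alive tg 0.
Proof. by rewrite /alive; case E: (tg 0) => [v|] //; have [] := mg E. Qed.

Lemma contract_wf : (forall k, (k < sz I)%N -> alive tg k -> 0 < r k) -> inst_wf (contract (sz I) tg I b r).
Proof.
have [m0 pl sl] := w => rp; split=> /=.
- by have [h _] := nth_survivors m0 alive0; apply: leq_ltn_trans h.
- move=> j /andP[j0 /survivors_rank[]]; set k := nth _ _ _ => km ak jk.
  rewrite -[X in (_ < X)%N]jk; apply: rank_lt; last exact: alive_target.
  apply: leq_ltn_trans (target_le _) _; apply: pl; rewrite km andbT lt0n.
  by apply: contraL j0 => /eqP k0; rewrite -jk k0.
- move=> j /survivors_rank[]; set k := nth _ _ _ => km ak jk.
  by have [h _] := sl _ km; split=> //; apply: rp.
Qed.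

(** Towards the contracted tree a merged vertex gets the maximum of the two values. Backwards, a
    removed vertex gets the largest value that its partner permits; its own lower line does not
    exceed this value, because the partner has the larger lower line and [e] accounts for the
    constraint inside the pair. *)
Lemma feas_contract e x : leaf_up I ->
  (forall v, sr v = None -> b v = na I v /\ r v = ns I v) ->
  (forall u v, tg u = Some v -> [/\ up_line I u x <= b v - r v * x,
     up_line I v x <= b v - r v * x &
     (b v = na I u /\ r v = ns I u) \/ (b v = na I v /\ r v = ns I v)]) ->
  (forall u v, tg u = Some v -> lo_line I u x <= lo_line I v x) ->
  (forall u v, tg u = Some v -> e <= x -> lo_line I u x + up_line I v x <= 0) ->
  feas I e x <-> feas (contract (sz I) tg I b r) e x.
Proof.
have [m0 pl sl] := w; have [tgsr dis] := pr => lu same win low int.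
pose N' k := b k - r k * x.
(* The contracted instance, with its vertices under their old numbers. *)
pose mid := exists G : nat -> R,
  (forall k, (k < sz I)%N -> alive tg k -> lo_line I k x <= G k) /\
  (forall k, (0 < k < sz I)%N -> alive tg k ->
     G k <= G (target tg (par I k)) /\ G k + N' (target tg (par I k)) <= 0).
have tgm k : (0 < k < sz I)%N -> (target tg (par I k) < sz I)%N.
  by move=> hk; apply: leq_ltn_trans (target_le _) (par_lt w hk).
suff E : e <= x -> ((exists g : nat -> R, (forall k, (k < sz I)%N -> lo_line I k x <= g k) /\
  (forall k, (0 < k < sz I)%N -> g k <= g (par I k) /\ g k + up_line I (par I k) x <= 0)) <-> mid).
  split=> -[ex h]; split=> //.
    have /E[h1 _] := ex; have [G [G1 G2]] := h1 h.
    exists (fun j => G (nth 0%N (survivors (sz I) tg) j)); split=> j /=.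
      by move=> /survivors_rank[] km ak jk; apply: G1.
    case/andP => j0 /survivors_rank[]; rewrite /up_line /=; set k := nth _ _ _ => km ak jk.
    have k0 : (0 < k < sz I)%N.
      rewrite km andbT lt0n; apply: contraL j0 => /eqP k0; by rewrite -jk k0.
    have [_ ->] := nth_survivors (tgm _ k0) (alive_target _).
    exact: G2.
  have /E[_ h1] := ex; apply: h1; case: h => G [/= G1 G2].
  exists (fun k => G (rank tg k)); split=> k hk ak.
    have [h1 h2] := nth_survivors hk ak.
    by have := G1 _ h1; rewrite /lo_line /= h2.
  have [h1 h2] := nth_survivors (andP hk).2 ak.
  have h3 : (0 < rank tg k)%N.
    by have /andP[h3 _] := hk; rewrite -[0%N]/(rank tg 0); apply: rank_lt alive0.
  have := G2 (rank tg k); rewrite h3 h1 => /(_ isT); rewrite /up_line /= h2.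
  by have [_ ->] := nth_survivors (tgm _ hk) (alive_target _).
move=> ex; split=> -[g [g1 g2]].
  pose G k := if sr k is Some u then Num.max (g k) (g u) else g k.
  have gG k : g k <= G (target tg k).
    rewrite /target /G; case E: (tg k) => [v|] /=.
      by have/tgsr-> := E; rewrite le_max lexx orbT.
    by case: (sr k) => // u; rewrite le_max lexx.
  exists G; split=> k hk ak.
    by apply: le_trans (g1 k hk) _; have := gG k; rewrite target_alive.
  have main z : (0 < z < sz I)%N -> par I z = par I k -> (z <> k -> sr k = Some z /\ leaf I z) ->
     g z <= G (target tg (par I k)) /\ g z + N' (target tg (par I k)) <= 0.
    move=> hz ez zk; have [h1 h2] := g2 z hz; rewrite ez in h1 h2.
    split; first exact: le_trans h1 (gG _).
    rewrite /target; case E: (tg (par I k)) => [P|] /=.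
      (* [par I k] is no leaf, so it has been merged into its own parent [P]; the upper lines of
         both bound [g z]. *)
      have [Pu um kd] := mg E.
      have E0 : par I (par I k) = P by case: kd => [[] //|[_ _ l _]]; case: (l _ hk).
      have := g2 (par I k); rewrite E0 um (leq_ltn_trans _ Pu) // => /(_ isT)[h3 h4].
      by rewrite /N'; have [_ _ [[-> ->]|[-> ->]]] := win _ _ E; rewrite -/(up_line I _ x); lra.
    (* Here [uu] has been merged into [par I k]. If its upper line has won, either [uu] is a leaf
       and has the line of its parent, or it is the only child, hence equal to [k], which was not
       removed. *)
    rewrite /N'; case E' : (sr (par I k)) => [uu|]; last by have [-> ->] := same _ E'.
    have/tgsr E2 := E'; have [_ _ [[-> ->]|[-> ->]]] := win _ _ E2; rewrite -/(up_line I _ x) //.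
    have [vu um kd] := mg E2; have u0 : (0 < uu < sz I)%N by rewrite um andbT (leq_ltn_trans _ vu).
    case: kd => [[e1 [l|un]]|[_ _ _ l]]; last by case: (l _ hk).
      by rewrite lu // e1.
    have ku : k = uu by apply: un.
    by move: ak; rewrite /alive ku E2.
  rewrite {1 3}/G; case E: (sr k) => [u|]; last by apply: main.
  have/tgsr/mg[vu um kd] := E; have u0 : (0 < u < sz I)%N by rewrite um andbT (leq_ltn_trans _ vu).
  case: kd => [[e1 _]|[_ e1 l1 l2]].
    by have [h1 _] := g2 u u0; rewrite e1 in h1; rewrite max_l //; apply: main.
  by case: (leP (g k) (g u)) => _; apply: main.
(* The largest value allowed for a vertex below [v] is the minimum of [g v] and the upper line of
   [v]. *)
pose G k := if tg k is Some v then Num.min (g v) (- up_line I v x) else g k.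
have NN k : up_line I k x <= N' (target tg k).
  rewrite /target; case E: (tg k) => [v|] /=; first by have [] := win _ _ E.
  by rewrite /N'; case E' : (sr k) => [u|]; [have/tgsr/win[] := E'|have [-> ->] := same _ E'].
have main k : (0 < k < sz I)%N -> alive tg k -> g k <= G (par I k) /\ g k + up_line I (par I k) x <= 0.
  move=> hk ak; have [h1 h2] := g2 _ hk ak; have h3 := NN (par I k).
  split; last by lra.
  move: h1 h2; rewrite /G /target; case E: (tg (par I k)) => [v|] //= h1 h2.
  rewrite le_min h1 /=; have [_ h4 _] := win _ _ E; rewrite /N' in h2; lra.
exists G; split=> k hk.
  rewrite /G; case E: (tg k) => [v|]; last by apply: g1; rewrite // /alive E.
  have [vu _ _] := mg E; have vm := ltn_trans vu hk.
  rewrite le_min (le_trans (low _ _ E)) ?g1 //=; last by rewrite /alive; have [->] := dis _ _ E.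
  by have := int _ _ E ex; lra.
rewrite {1 3}/G; case E: (tg k) => [v|]; last by apply: main; rewrite // /alive E.
have [vu um kd] := mg E; have av : alive tg v by rewrite /alive; have [->] := dis _ _ E.
case: kd => [[e1 _]|[v0 e1 l1 l2]].
  rewrite e1 /G; move: av; rewrite /alive => /eqP ->; split; first by rewrite ge_min lexx.
  have : Num.min (g v) (- up_line I v x) <= - up_line I v x by rewrite ge_min lexx orbT.
  lra.
have hv : (0 < v < sz I)%N by rewrite v0 (ltn_trans vu).
have [h1 h2] := main v hv av; rewrite e1.
have h3 : Num.min (g v) (- up_line I v x) <= g v by rewrite ge_min lexx.
by split; [exact: le_trans h3 h1|lra].
Qed.

End ContractFeas.
End Instances.

(** * The algorithm *)

Coercion Iv : nat >-> iexp.
Coercion Rv : nat >-> rexp.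
Notation "x <~ e" := (ISet x e) (at level 80).
Notation "x <~r e" := (RSet x e) (at level 80).
Notation "c ;; d" := (Seq c d) (at level 85, right associativity).

(** [vM] is the current number of vertices, [vNP] the number of pairs and [vNN] its truncation. [aQ]
    is the topological order, [aPOS] its inverse and [aPAR] the parent map in the new numbering;
    [aU], [aV] hold the pairs, [aDEL] is the merge target plus one, or 0 for survivors, and [aNU]
    the new number. [fA], [fS] are the lower lines, [fB], [fT] the negated upper ones, [fX] the
    propagated values and [fC] the crossings. *)
Notation vN := 0%N. Notation vM := 1%N. Notation vK := 2%N. Notation vIt := 3%N.
Notation vL := 4%N. Notation vP := 5%N. Notation vV := 6%N. Notation vU := 7%N.
Notation vF := 8%N. Notation vNP := 9%N. Notation vQ := 10%N. Notation vNN := 11%N.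
Notation vB := 12%N. Notation vB2 := 13%N. Notation vB4 := 14%N. Notation vLEN := 15%N.
Notation vI := 16%N. Notation vJ := 17%N. Notation vIE := 18%N. Notation vJE := 19%N.
Notation vC := 20%N. Notation vOdd := 21%N. Notation vBB := 22%N.
Notation rC := 0%N. Notation rZ := 1%N. Notation rT := 2%N. Notation rSG := 3%N.
Notation rE := 4%N. Notation rBD := 5%N. Notation rW := 6%N.
Notation aCH := 0%N. Notation aQ := 1%N. Notation aPOS := 2%N. Notation aPAR := 3%N.
Notation aPEND := 4%N. Notation aDEL := 5%N. Notation aU := 6%N. Notation aV := 7%N.
Notation aNU := 8%N.
Notation fA := 0%N. Notation fS := 1%N. Notation fB := 2%N. Notation fT := 3%N.
Notation fX := 4%N. Notation fC := 5%N. Notation fW := 6%N. Notation fW2 := 7%N.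

Definition line_at a s (k : iexp) (x : rexp) := Rsub (Rld a k) (Rmul (Rld s k) x).

(* The sign [rSG] tells on which side of the tested value [rT] the optimum lies: [-1] if [rT]
   is feasible, [1] otherwise. *)
Definition test :=
  For vK vM (RSt fX vK (line_at fA fS vK rT));;
  IfR rT rE (rSG <~r Rc 1) (rSG <~r Rc (-1));;
  vU <~ Isub vM (Ic 1);;
  For vK vU (vV <~ Isub vU vK;; vP <~ Ild aPAR vV;;
    IfR (Rc 0) (Radd (Rld fX vV) (line_at fB fT vP rT)) (rSG <~r Rc 1) Skip;;
    IfR (Rld fX vP) (Rld fX vV) (RSt fX vP (Rld fX vV)) Skip).

(* Leaves are removed repeatedly, as in Kahn's algorithm; the positions are assigned from the
   last one down, so that parents precede their children. *)
Definition topo :=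
  For vK vN (vP <~ Iraw vK;; IfI (Ic 0) vP (vP <~ Isub vP (Ic 1);;
    ISt aCH vP (Iadd (Ild aCH vP) (Ic 1))) Skip);;
  vF <~ vN;;
  For vK vN (IfI (Ild aCH vK) (Ic 1)
    (vF <~ Isub vF (Ic 1);; ISt aQ vF vK;; ISt aPOS vK vF) Skip);;
  For vK vN (vV <~ Ild aQ (Isub (Isub vN (Ic 1)) vK);; vP <~ Iraw vV;;
    IfI (Ic 0) vP (vP <~ Isub vP (Ic 1);; ISt aCH vP (Isub (Ild aCH vP) (Ic 1));;
      IfI (Ild aCH vP) (Ic 1)
        (vF <~ Isub vF (Ic 1);; ISt aQ vF vP;; ISt aPOS vP vF) Skip) Skip).

(** The sum of [y * y + 1] over all vertices dominates every [|y|] without any comparison. *)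
Definition bound :=
  rBD <~r Rc 0;;
  For vK vN (rBD <~r Radd rBD (Radd (Rmul (Rraw vK) (Rraw vK)) (Rc 1))).

(* A vertex of weight 0 gets lines that never bind, as [rBD] exceeds all [|y v|]. *)
Definition load :=
  For vK vN (vV <~ Ild aQ vK;; ISt aPAR vK (Ild aPOS (Isub (Iraw vV) (Ic 1)));;
    rW <~r Rraw (Iadd vN vV);;
    IfR (Rc 0) rW
      (RSt fA vK (Rraw vV);; rW <~r Rdiv (Rc 1) rW;; RSt fS vK rW;;
       RSt fB vK (Rsub (Rc 0) (Rraw vV));; RSt fT vK rW)
      (RSt fA vK (Rsub (Rc 0) rBD);; RSt fS vK (Rc 1);;
       RSt fB vK (Rsub (Rc 0) rBD);; RSt fT vK (Rc 1)));;
  vM <~ vN.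

(** The last loop establishes [leaf_up]. *)
Definition prepare :=
  vU <~ Isub vM (Ic 1);;
  For vK vM (ISt aCH vK (Ic 0);; ISt aPEND vK (Ic 0);; ISt aDEL vK (Ic 0));;
  For vK vU (vP <~ Ild aPAR (Iadd vK (Ic 1));; ISt aCH vP (Iadd (Ild aCH vP) (Ic 1)));;
  For vK vU (vV <~ Iadd vK (Ic 1);; IfI (Ild aCH vV) (Ic 1)
    (vP <~ Ild aPAR vV;; RSt fB vV (Rld fB vP);; RSt fT vV (Rld fT vP)) Skip).

Definition emit (u : iexp) :=
  ISt aU vNP u;; ISt aV vNP vV;; vNP <~ Iadd vNP (Ic 1).

(* Vertices are visited from the last one to the root; [aPEND p = c.+1] if the child [c] of [p]
   is to be paired with the next sibling leaf or else with [p]. *)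
Definition matching :=
  vNP <~ Ic 0;;
  For vK vM (vV <~ Isub (Isub vM vK) (Ic 1);;
    IfI (Ic 0) (Ild aPEND vV) (emit (Isub (Ild aPEND vV) (Ic 1)))
      (IfI (Ic 0) vV
         (vP <~ Ild aPAR vV;;
          IfI (Ild aCH vV) (Ic 1)
            (IfI (Ic 0) (Ild aPEND vP)
               (emit (Isub (Ild aPEND vP) (Ic 1));; ISt aPEND vP (Ic 0))
               (ISt aPEND vP (Iadd vV (Ic 1))))
            (IfI (Ild aCH vP) (Ic 2) (ISt aPEND vP (Iadd vV (Ic 1))) Skip))
         Skip)).

(** Saves the constraints inside the pairs before lines are dropped. *)
Definition raise :=
  For vK vNP (vU <~ Ild aU vK;; vV <~ Ild aV vK;;
    rC <~r Rdiv (Radd (Rld fA vU) (Rld fB vV)) (Radd (Rld fS vU) (Rld fT vV));;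
    IfR rE rC (rE <~r rC) Skip).

(** One loop performs all merges: [vI] and [vJ] run through two adjacent blocks up to [vIE] and
    [vJE], and when both are exhausted the next two blocks start at [vK], as many values having been
    written as read. *)
Definition merge_pass src dst (b : nat) :=
  vI <~ Ic 0;; vIE <~ Ic 0;; vJ <~ Ic 0;; vJE <~ Ic 0;;
  For vK vLEN (
    IfI vI vIE Skip (IfI vJ vJE Skip
      (vI <~ vK;; vIE <~ Iadd vK b;; vJ <~ vIE;; vJE <~ Iadd vIE b));;
    IfI vI vIE
      (IfI vJ vJE
        (IfR (Rld src vJ) (Rld src vI)
          (RSt dst vK (Rld src vJ);; vJ <~ Iadd vJ (Ic 1))
          (RSt dst vK (Rld src vI);; vI <~ Iadd vI (Ic 1)))
        (RSt dst vK (Rld src vI);; vI <~ Iadd vI (Ic 1)))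
      (RSt dst vK (Rld src vJ);; vJ <~ Iadd vJ (Ic 1))).

Definition halve :=
  vC <~ Ic 0;; vOdd <~ Ic 0;;
  For vK vLEN (IfI (Ic 0) vOdd
    (RSt fW vC (Rld fW vK);; vC <~ Iadd vC (Ic 1);; vOdd <~ Ic 0) (vOdd <~ Ic 1));;
  vLEN <~ vC.

(** [vB2] and [vB4] trail [vB] by one and two doublings; they provide its half and its quarter
    without a division. *)
Definition level :=
  merge_pass fW fW2 vB;; vBB <~ Iadd vB vB;; merge_pass fW2 fW vBB;; halve;;
  vB4 <~ vB2;; vB2 <~ vB;; vB <~ vBB.

(** For [4 ^ h] values, [h] levels suffice and the remaining passes are idle. The quarter position,
    rather than the middle, makes up for the bias of the sampling: dropping the first of every two
    values underestimates initial segments. *)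
Definition splitter :=
  vB <~ Ic 1;; vB2 <~ Ic 0;; vB4 <~ Ic 0;; vLEN <~ vNN;;
  For vL vNN (IfI vB vLEN level Skip);;
  rT <~r Rld fW vB4.

(* The largest power of 4 up to the number of pairs. *)
Definition truncate :=
  vNN <~ Ic 1;;
  For vK vNP (vC <~ Iadd vNN vNN;; vC <~ Iadd vC vC;; IfI vNP vC Skip (vNN <~ vC)).

Definition crossings fa fs :=
  For vK vNN (vU <~ Ild aU vK;; vV <~ Ild aV vK;;
    rC <~r Rdiv (Rsub (Rld fa vU) (Rld fa vV)) (Rsub (Rld fs vU) (Rld fs vV));;
    RSt fC vK rC;; RSt fW vK rC).

(* A pair is resolved if the optimum is not on the far side of [rT] from its crossing [rC]; the
   lines are then compared at [rC + rSG], beyond the crossing. *)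
Definition resolve fa fs :=
  vQ <~ Ic 0;;
  For vK vNN (vU <~ Ild aU vK;; vV <~ Ild aV vK;; rC <~r Rld fC vK;;
    IfR (Rc 0) (Rmul rSG (Rsub rC rT)) Skip
      (rZ <~r Radd rC rSG;;
       IfR (line_at fa fs vV rZ) (line_at fa fs vU rZ)
         (RSt fa vV (Rld fa vU);; RSt fs vV (Rld fs vU)) Skip;;
       ISt aU vQ vU;; ISt aV vQ vV;; vQ <~ Iadd vQ (Ic 1)));;
  vNP <~ vQ.

Definition prune fa fs :=
  truncate;; crossings fa fs;; splitter;; test;; resolve fa fs.

Definition mark := For vK vNP (ISt aDEL (Ild aU vK) (Iadd (Ild aV vK) (Ic 1))).

(** A single ascending pass works in place: parents and merge targets have smaller numbers, so that
    their new numbers are known, and the writing position never overtakes the reading one. *)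
Definition compact :=
  vQ <~ Ic 0;;
  For vK vM (IfI (Ic 0) (Ild aDEL vK) (ISt aNU vK (Ild aNU (Isub (Ild aDEL vK) (Ic 1))))
    (ISt aNU vK vQ;; ISt aPAR vQ (Ild aNU (Ild aPAR vK));;
     RSt fA vQ (Rld fA vK);; RSt fS vQ (Rld fS vK);;
     RSt fB vQ (Rld fB vK);; RSt fT vQ (Rld fT vK);; vQ <~ Iadd vQ (Ic 1)));;
  vM <~ vQ.

Definition round :=
  prepare;; matching;; raise;; prune fA fS;; prune fB fT;; mark;; compact.

(** The rounds destroy the instance, which is therefore loaded again; a last [test] at the optimum
    leaves the regression in [fX]. *)
Definition main :=
  topo;; bound;; load;; rE <~r Rc 0;;
  For vIt vN (IfI (Ic 1) vM round Skip);;
  load;; rT <~r rE;; test;;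
  For vK vN (RawSt (Ild aQ vK) (Rld fX vK)).

Lemma cmd_wf_main : cmd_wf main. Proof. by []. Qed.

(** * Rewriting rules for program states *)

Section Frames.
Variable R : realType.
Implicit Types s : state R.

Lemma updE T (f : nat -> T) (x : nat) v (y : nat) : upd f x v y = if y == x then v else f y.
Proof. by []. Qed.
Lemma evalS c d s : eval (c;; d) s = eval d (eval c s). Proof. by []. Qed.

Lemma evalIfI e f c d s :
  eval (IfI e f c d) s = if (evi e s < evi f s)%N then eval c s else eval d s.
Proof. by []. Qed.
Lemma evalIfR e f c d s :
  eval (IfR e f c d) s = if evr e s < evr f s then eval c s else eval d s.
Proof. by []. Qed.

Lemma same_iv (x : nat) c s0 s : same c s0 s -> x \notin mod_iv c -> iv s x = iv s0 x.
Proof. by case=> h _ _ _ _; apply: h. Qed.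
Lemma same_rv (x : nat) c s0 s : same c s0 s -> x \notin mod_rv c -> rv s x = rv s0 x.
Proof. by case=> _ h _ _ _; apply: h. Qed.
Lemma same_ia (x : nat) c s0 s : same c s0 s -> x \notin mod_ia c -> ia s x = ia s0 x.
Proof. by case=> _ _ h _ _; apply: h. Qed.
Lemma same_ra (x : nat) c s0 s : same c s0 s -> x \notin mod_ra c -> ra s x = ra s0 x.
Proof. by case=> _ _ _ h _; apply: h. Qed.
Lemma same_rraw c s0 s : same c s0 s -> ~~ mod_raw c -> rraw s = rraw s0.
Proof. by case=> _ _ _ _ []. Qed.
Lemma same_iraw c s0 s : same c s0 s -> iraw s = iraw s0.
Proof. by case=> _ _ _ _ []. Qed.
Lemma same_bnd c s0 s : same c s0 s -> bnd s = bnd s0.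
Proof. by case=> _ _ _ _ []. Qed.

End Frames.

(** Carries components back across a command that does not assign them; the side conditions are
    decided by computation. *)
Ltac fr sm := repeat match goal with
 | |- context [iv ?s' ?x] => rewrite (@same_iv _ x _ _ s' sm isT)
 | |- context [rv ?s' ?x] => rewrite (@same_rv _ x _ _ s' sm isT)
 | |- context [ia ?s' ?x] => rewrite (@same_ia _ x _ _ s' sm isT)
 | |- context [ra ?s' ?x] => rewrite (@same_ra _ x _ _ s' sm isT)
 end.

(* [clearbody] alone leaves the body of [s] visible to the kernel, which then tries to run
   the program in conversion tests. *)
Ltac seal s := clearbody s; generalize dependent s; intros.

Ltac ev := rewrite /=; do 4 rewrite ?updE /=.

(** * The feasibility test *)

Section Specs.
Variable R : realType.
Implicit Types s : state R.

Definition inst_of s := Inst (iv s vM) (ia s aPAR) (ra s fA) (ra s fS) (ra s fB) (ra s fT).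

(** The propagated [X] is the least monotone function above the lower lines. If it violates an upper
    constraint, so does every candidate; otherwise it is a witness itself. *)
Lemma test_spec s s' (I := inst_of s) (t := rv s rT) (X := ra s' fX) :
  inst_wf I -> s' = eval test s ->
  [/\ forall k, (k < sz I)%N -> lo_line I k t <= X k,
      forall k, (0 < k < sz I)%N -> X k <= X (par I k),
      forall g, (forall k, (k < sz I)%N -> lo_line I k t <= g k) ->
        (forall k, (0 < k < sz I)%N -> g k <= g (par I k)) -> forall k, (k < sz I)%N -> X k <= g k &
      (rv s' rSG = -1 /\ feas I (rv s rE) t /\
        forall k, (0 < k < sz I)%N -> X k + up_line I (par I k) t <= 0)
      \/ (rv s' rSG = 1 /\ ~ feas I (rv s rE) t)].
Proof.
move=> w; rewrite /test !evalS; set s1 := (X in eval (IfR _ _ _ _) X).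
set s2 := eval (IfR _ _ _ _) s1; set s3 := eval (ISet _ _) s2 => ds.
pose m := sz I; have [m0 pl _] := w.
have F1 : same (For vK vM (RSt fX vK (line_at fA fS vK rT))) s s1 by exact: eval_same.
have X1 k : (k < m)%N -> ra s1 fX k = lo_line I k t.
  pose P i s' := forall k, (k < i)%N -> ra s' fX k = lo_line I k t.
  apply: (For_ind (P := P)) => // i s'' hi ek sm IH j /=.
  rewrite ltnS; ev; rewrite ek; have [-> _|ne jl] := eqVneq j i; first by fr sm.
  by apply: IH; rewrite ltn_neqAle ne.
have sg2 : rv s2 rSG = if rv s rE <= t then -1 else 1.
  by rewrite /s2 /=; fr F1; rewrite -/t leNgt; case: ifP => _; rewrite /= ?mulrN1z.
have F3 : same (IfR rT rE (rSG <~r Rc 1) (rSG <~r Rc (-1));; vU <~ Isub vM (Ic 1)) s1 s3.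
  exact: eval_same.
(* After [i] passes the vertices from [m - i] on have been handled. *)
pose P i (s' : state R) := let X := ra s' fX in
  [/\ forall k, (k < m)%N -> lo_line I k t <= X k,
   forall k, (0 < k < m)%N -> (m - i <= k)%N -> X k <= X (par I k),
   forall g, (forall k, (k < m)%N -> lo_line I k t <= g k) ->
     (forall k, (0 < k < m)%N -> g k <= g (par I k)) -> forall k, (k < m)%N -> X k <= g k &
   (rv s' rSG = -1 /\ rv s rE <= t /\
     forall k, (0 < k < m)%N -> (m - i <= k)%N -> X k + up_line I (par I k) t <= 0)
   \/ (rv s' rSG = 1 /\ ~ feas I (rv s rE) t)].
have LU : (m - 1)%N = iv s3 vU by rewrite /s3 /= /s2 frame_iv // (same_iv F1).
have : P (m - 1)%N s'.
  rewrite LU ds; apply: (For_ind (P := P)) => [|i s4 hi ek sm].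
    rewrite /P /=; have XE k : (k < m)%N -> ra s3 fX k = lo_line I k t.
      by move=> km; fr F3; apply: X1.
    rewrite sg2; split=> [k km|k km|g g1 _ k km|].
    - by rewrite XE.
    - by lia.
    - by rewrite XE // g1.
    - case: ifP => et; [left|right]; split=> //; first by split=> // k; lia.
      by case=> h _; rewrite h in et.
  have hi' : (i < m - 1)%N by rewrite LU.
  rewrite !evalS; set t1 := eval (vV <~ _) s4; set t2 := eval (vP <~ _) t1.
  pose v := (m - 1 - i)%N; have hv : (0 < v < m)%N by rewrite /v; lia.
  have vv : iv t2 vV = v by rewrite /t2 /t1; ev; rewrite ek; fr sm; rewrite -LU.
  have vp : iv t2 vP = par I v by rewrite /t2 /t1; ev; rewrite ek; fr sm; rewrite -LU; fr F3; fr F1.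
  have F2 : same (vV <~ Isub vU vK;; vP <~ Ild aPAR vV) s4 t2 by exact: eval_same.
  clearbody t2; set t3 := eval (IfR _ _ _ _) t2.
  case=> p1 p2 p3 p4.
  set X4 := ra s4 fX in p1 p2 p3 p4.
  have e3 : rv t3 rSG = if 0 < X4 v + up_line I (par I v) t then 1 else rv s4 rSG.
    rewrite /t3 [LHS]/= vv vp; fr F2; rewrite -/X4; fr sm; fr F3; fr F1.
    by rewrite mulr0z; case: ifP => //= _; fr F2.
  have F5 : same (IfR (Rc 0) (Radd (Rld fX vV) (line_at fB fT vP rT)) (rSG <~r Rc 1) Skip) t2 t3.
    exact: eval_same.
  clearbody t3; have eX k : ra (eval (IfR (Rld fX vP) (Rld fX vV) (RSt fX vP (Rld fX vV)) Skip) t3) fX k =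
     if (k == par I v) && (X4 (par I v) < X4 v) then X4 v else X4 k.
    rewrite /=; fr F5; rewrite vv vp; fr F2; rewrite -/X4.
    by case: ifP => h; rewrite /= ?andbF; fr F5; fr F2; rewrite ?vp ?vv ?andbT ?updE.
  have eS : rv (eval (IfR (Rld fX vP) (Rld fX vV) (RSt fX vP (Rld fX vV)) Skip) t3) rSG = rv t3 rSG.
    by rewrite frame_rv.
  have pv := pl _ hv.
  rewrite /P; cbn [rv ra seti]; rewrite eS e3.
  set X5 := ra _ fX; have {}eX : forall k, X5 k = if (k == par I v) && (X4 (par I v) < X4 v) then X4 v else X4 k by [].
  have Xge k : X4 k <= X5 k.
    by rewrite eX; case: ifP => // /andP[/eqP-> /ltW].
  have Xsame k : (v <= k)%N -> X5 k = X4 k by move=> vk; rewrite eX gtn_eqF // (leq_trans pv).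
  split.
  - by move=> k km; apply: le_trans (p1 k km) (Xge k).
  - move=> k hk vk; have [kv|kv] := eqVneq k v.
      rewrite kv Xsame // [X in _ <= X]eX eqxx /=; case: ifP => [_|/negbT]; first by [].
      by rewrite -leNgt.
    by rewrite Xsame; [apply: le_trans (p2 k hk _) (Xge _)|]; lia.
  - move=> g g1 g2 k km; rewrite eX; case: ifP => [/andP[/eqP-> _]|_]; last exact: p3.
    by apply: le_trans (g2 v hv); apply: p3 => //; case/andP: hv.
  - case: p4 => [[e [et p4]]|[e nf]]; last first.
      by right; split=> //; case: ifP.
    case: ifP => h; last first.
      left; split=> //; split=> // k hk vk; rewrite Xsame; last by rewrite /v; lia.
      have [->|kv] := eqVneq k v; first by rewrite leNgt h.
      by apply: p4 => //; lia.
    right; split=> // -[_ [g [g1 g2]]]; have gv : X4 v <= g v.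
      by apply: p3 => //; [move=> k /g2[]|case/andP: hv].
    by have [_] := g2 v hv; lra.
case=> p1 p2 p3 p4; split=> [//|k hk|//|]; first by apply: p2 => //; lia.
case: p4 => [[e [et p4]]|[e nf]]; last by right.
left; split=> //; have p4' k : (0 < k < m)%N -> X k + up_line I (par I k) t <= 0.
  by move=> hk; apply: p4 => //; lia.
split=> //; split=> //; exists X; split=> // k hk; split; last exact: p4'.
by apply: p2 => //; lia.
Qed.
End Specs.

(** * The splitting value *)

Section Merge.
Variable R : realType.
Implicit Types (s : state R) (f d : nat -> R) (p : pred R).

(** That an array is rearranged is expressed by equal counts for all predicates, which is the form
    in which the quality of the splitting value is measured. *)
Definition cnt p f a n := count (fun i => p (f i)) (iota a n).

Lemma cntS p f a n : cnt p f a n.+1 = (cnt p f a n + p (f (a + n)))%N.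
Proof. by rewrite /cnt -addn1 iotaD count_cat /= addn0. Qed.

Lemma cntD p f a n m : cnt p f a (n + m) = (cnt p f a n + cnt p f (a + n) m)%N.
Proof. by rewrite /cnt iotaD count_cat. Qed.

Lemma eq_cnt p f d a n : (forall i, (i < n)%N -> f (a + i)%N = d (a + i)%N) -> cnt p f a n = cnt p d a n.
Proof.
move=> H; apply: eq_in_count => i; rewrite mem_iota => /andP[h1 h2].
by rewrite -(subnKC h1) H //; lia.
Qed.

Lemma cnt_le_size p f a n : (cnt p f a n <= n)%N.
Proof. by rewrite -[leqRHS](size_iota a); apply: count_size. Qed.

Definition blocks b n f := forall q i j, (q < n)%N -> (i <= j)%N -> (j < b)%N ->
  f (q * b + i)%N <= f (q * b + j)%N.

(* The state of a merge of the sorted blocks [f] at [S, S + b) and [S + b, S + 2b), where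
   [S = 2 b q], after [i] and [j] elements of them have been moved to [d]. *)
Definition merging b f q i j d := let S := (q * (b + b))%N in
  [/\ blocks (b + b) q d,
      forall x y, (x <= y)%N -> (y < i + j)%N -> d (S + x)%N <= d (S + y)%N,
      forall x, (x < i + j)%N -> ((i < b)%N -> d (S + x)%N <= f (S + i)%N) /\
        ((j < b)%N -> d (S + x)%N <= f (S + b + j)%N)
    & forall p, cnt p d 0 (S + (i + j)) = (cnt p f 0 (S + i) + cnt p f (S + b) j)%N].

Definition put d (k : nat) (v : R) := fun x : nat => if x == k then v else d x.

Lemma put_same d k v x : x != k -> put d k v x = d x.
Proof. by rewrite /put => /negbTE ->. Qed.

Lemma cnt_put p d k v n : (n <= k)%N -> cnt p (put d k v) 0 n = cnt p d 0 n.
Proof. by move=> nk; apply: eq_cnt => i hi; rewrite put_same //; lia. Qed.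

Section Step.
Variables (b nb : nat) (f : nat -> R).
Hypothesis bs : blocks b (nb + nb) f.

Lemma blockl q x y : (q < nb)%N -> (x <= y < b)%N ->
  f (q * (b + b) + x)%N <= f (q * (b + b) + y)%N.
Proof.
move=> h /andP[h1 h2]; have := bs (_ : q + q < nb + nb)%N h1 h2.
by rewrite mulnDl -mulnDr; apply; lia.
Qed.

Lemma blockr q x y : (q < nb)%N -> (x <= y < b)%N ->
  f (q * (b + b) + b + x)%N <= f (q * (b + b) + b + y)%N.
Proof.
move=> h /andP[h1 h2]; have := bs (_ : (q + q).+1 < nb + nb)%N h1 h2.
have -> : ((q + q).+1 * b = q * (b + b) + b)%N by rewrite mulSn mulnDl -mulnDr addnC.
by apply; lia.
Qed.

Lemma blocks_put q i j d v : (i + j < b + b)%N -> blocks (b + b) q d ->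
  blocks (b + b) q (put d (q * (b + b) + (i + j)) v).
Proof.
move=> ij H q' x y h1 h2 h3.
have ? : (q' * (b + b) + y < q * (b + b))%N by nia.
by rewrite !put_same; [apply: H| |]; lia.
Qed.

Lemma merging_l q i j d : (q < nb)%N -> (i < b)%N -> (j <= b)%N -> merging b f q i j d ->
  ((j < b)%N -> f (q * (b + b) + i)%N <= f (q * (b + b) + b + j)%N) ->
  merging b f q i.+1 j (put d (q * (b + b) + (i + j)) (f (q * (b + b) + i)%N)).
Proof.
move=> hq hi hj [h1 h2 h3 h4] le; set S := (q * (b + b))%N in h1 h2 h3 h4 le *.
have pe x : (x < i + j)%N -> put d (S + (i + j)) (f (S + i)%N) (S + x) = d (S + x)%N.
  by move=> hx; rewrite put_same //; lia.
have pn : put d (S + (i + j)) (f (S + i)%N) (S + (i + j)) = f (S + i)%N by rewrite /put eqxx.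
split.
- by apply: blocks_put => //; lia.
- move=> x y xy; rewrite addSn ltnS leq_eqVlt => /orP[/eqP yE|yl]; last first.
    by rewrite !pe ?h2 //; lia.
  rewrite yE pn; have [->|xne] := eqVneq x (i + j)%N; first by rewrite pn.
  have xl : (x < i + j)%N by lia.
  by rewrite pe //; have [h _] := h3 x xl; apply: h.
- move=> x; rewrite addSn ltnS leq_eqVlt => /orP[/eqP ->|xl].
    by rewrite pn; split=> // hi'; apply: blockl => //; lia.
  rewrite pe //; have [ha hb] := h3 x xl; split=> // hi'; apply: le_trans (ha hi) _.
  by apply: blockl => //; lia.
- move=> p; rewrite addSn addnS cntS add0n pn cnt_put // h4 addnS cntS add0n.
  by rewrite -!addnA [(_ + nat_of_bool _)%N]addnC.
Qed.

Lemma merging_r q i j d : (q < nb)%N -> (i <= b)%N -> (j < b)%N -> merging b f q i j d ->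
  ((i < b)%N -> f (q * (b + b) + b + j)%N <= f (q * (b + b) + i)%N) ->
  merging b f q i j.+1 (put d (q * (b + b) + (i + j)) (f (q * (b + b) + b + j)%N)).
Proof.
move=> hq hi hj [h1 h2 h3 h4] le; set S := (q * (b + b))%N in h1 h2 h3 h4 le *.
have pe x : (x < i + j)%N -> put d (S + (i + j)) (f (S + b + j)%N) (S + x) = d (S + x)%N.
  by move=> hx; rewrite put_same //; lia.
have pn : put d (S + (i + j)) (f (S + b + j)%N) (S + (i + j)) = f (S + b + j)%N by rewrite /put eqxx.
split.
- by apply: blocks_put => //; lia.
- move=> x y xy; rewrite addnS ltnS leq_eqVlt => /orP[/eqP yE|yl]; last first.
    by rewrite !pe ?h2 //; lia.
  rewrite yE pn; have [->|xne] := eqVneq x (i + j)%N; first by rewrite pn.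
  have xl : (x < i + j)%N by lia.
  by rewrite pe //; have [_ h] := h3 x xl; apply: h.
- move=> x; rewrite addnS ltnS leq_eqVlt => /orP[/eqP ->|xl].
    by rewrite pn; split=> // hi'; apply: blockr => //; lia.
  rewrite pe //; have [ha hb] := h3 x xl; split=> // hi'; apply: le_trans (hb hj) _.
  by apply: blockr => //; lia.
- by move=> p; rewrite !addnS cntS add0n pn cnt_put // h4 cntS addnA.
Qed.

Lemma merging_start q d : blocks (b + b) q d ->
  (forall p, cnt p d 0 (q * (b + b)) = cnt p f 0 (q * (b + b))) -> merging b f q 0 0 d.
Proof. by move=> h1 h2; split=> // p; rewrite !addn0 h2. Qed.

Lemma merging_end q d : merging b f q b b d -> blocks (b + b) q.+1 d /\
  forall p, cnt p d 0 (q.+1 * (b + b)) = cnt p f 0 (q.+1 * (b + b)).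
Proof.
case=> h1 h2 _ h4; split=> [q' x y hq' xy yb|p].
  move: hq'; rewrite ltnS leq_eqVlt => /orP[/eqP->|hq']; [exact: h2|exact: h1].
rewrite (_ : q.+1 * (b + b) = q * (b + b) + (b + b))%N; last by rewrite mulSn addnC.
by rewrite h4 addnA [RHS]cntD.
Qed.

End Step.

Lemma merge_pass_spec s s' src dst vb b nb : src != dst ->
  (vb == vB) || (vb == vBB) -> iv s vb = b -> iv s vLEN = (nb * (b + b))%N -> (0 < b)%N ->
  s' = eval (merge_pass src dst vb) s -> blocks b (nb + nb) (ra s src) ->
  blocks (b + b) nb (ra s' dst) /\
  forall p, cnt p (ra s' dst) 0 (nb * (b + b)) = cnt p (ra s src) 0 (nb * (b + b)).
Proof.
move=> sd hvb eb el b0; rewrite /merge_pass !evalS.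
set s1 := (X in eval (For _ _ _) X).
set body := (X in eval (For _ _ X) _) => ds bs.
pose f := ra s src.
have sb : vb \notin mod_iv (For vK vLEN body) by rewrite /= !inE; case/orP: hvb => /eqP ->.
have ssrc : src \notin mod_ra (For vK vLEN body) by rewrite /= !inE (negbTE sd).
have s1b : iv s1 vb = b by rewrite -eb; case/orP: hvb => /eqP ->.
(* [exh] describes the moments between two merges, after [q] of them are finished, and [mid] those
   inside merge number [q]. *)
pose exh q o (s' : state R) := [/\ o = (q * (b + b))%N, (iv s' vIE <= iv s' vI)%N,
  (iv s' vJE <= iv s' vJ)%N, blocks (b + b) q (ra s' dst) &
  forall p, cnt p (ra s' dst) 0 o = cnt p f 0 o].
pose mid q i j o (s' : state R) := [/\ (i <= b)%N /\ (j <= b)%N, o = (q * (b + b) + (i + j))%N,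
  [/\ iv s' vI = (q * (b + b) + i)%N, iv s' vIE = (q * (b + b) + b)%N,
  iv s' vJ = (q * (b + b) + b + j)%N & iv s' vJE = (q * (b + b) + b + b)%N] &
  merging b f q i j (ra s' dst)].
pose P o s' := exists q, exh q o s' \/ exists i j, (0 < i + j < b + b)%N /\ mid q i j o s'.
have : P (nb * (b + b))%N s'.
  have LL : iv s1 vLEN = (nb * (b + b))%N by rewrite -el.
  rewrite -LL ds; apply: (For_ind (P := P)) => [|o s2 ho ek sm IH].
    by exists 0%N; left; split.
  rewrite {}LL in ho.
  have e2b : iv s2 vb = b by rewrite (same_iv sm).
  have e2f : ra s2 src = f by rewrite (same_ra sm).
  rewrite /body evalS; set s3 := eval (IfI vI vIE _ _) s2.
  have [q [i [j [ij hm]]]] : exists q i j, (i + j < b + b)%N /\ mid q i j o s3.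
    case: IH => q [[oE hi hj hb hc]|[i [j [/andP[_ ij] hm]]]].
      exists q, 0%N, 0%N; split; first by lia.
      have -> : s3 = eval (vI <~ vK;; vIE <~ Iadd vK vb;; vJ <~ vIE;; vJE <~ Iadd vIE vb) s2.
        by rewrite /s3 [LHS]/= ltnNge hi /= ltnNge hj.
      have nb1 : (vb == vIE) = false by case/orP: hvb => /eqP ->.
      have nb2 : (vb == vI) = false by case/orP: hvb => /eqP ->.
      have nb3 : (vb == vJ) = false by case/orP: hvb => /eqP ->.
      split=> //; first by rewrite oE !addn0.
        by split; ev; rewrite ?nb1 ?nb2 ?nb3 ?ek ?e2b ?oE ?addn0.
      by apply: merging_start => //; rewrite -oE.
    exists q, i, j; split=> //; rewrite /s3 /=.
    have [_ _ [-> -> -> ->] _] := hm.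
    case: ifP => // h1; case: ifP => // h2; move: h1 h2; lia.
  have e3f : ra s3 src = f by rewrite frame_ra.
  have e3k : iv s3 vK = o by rewrite frame_iv.
  clearbody s3; have [[ib jb] oE [eI eIE eJ eJE] mg] := hm.
  have hq : (q < nb)%N by nia.
  have step i' j' v c : (i' + j' = (i + j).+1)%N -> merging b f q i' j' (put (ra s3 dst) o v) ->
     (i' <= b)%N -> (j' <= b)%N ->
     ra (eval c s3) dst = put (ra s3 dst) o v -> iv (eval c s3) vI = (q * (b + b) + i')%N ->
     iv (eval c s3) vJ = (q * (b + b) + b + j')%N -> iv (eval c s3) vIE = (q * (b + b) + b)%N ->
     iv (eval c s3) vJE = (q * (b + b) + b + b)%N -> P o.+1 (seti vK o.+1 (eval c s3)).
    move=> e mg' ib' jb' dE cI cJ cIE cJE.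
    have [e2|ne] := eqVneq (i' + j')%N (b + b)%N; last first.
      exists q; right; exists i', j'; split; first by lia.
      split=> //; first by lia.
      by rewrite [ra _ _]dE.
    have [ei' ej'] : i' = b /\ j' = b by lia.
    rewrite ei' ej' in mg' cI cJ; have [h1 h2] := merging_end mg'.
    have oE' : o.+1 = (q.+1 * (b + b))%N by rewrite mulSn; lia.
    exists q.+1; left; split=> //.
    - by ev; rewrite cI cIE.
    - by ev; rewrite cJ cJE.
    - by rewrite [ra _ _]dE.
    - by move=> p; rewrite [ra _ _]dE oE'; apply: h2.
  have left_ok : (i < b)%N -> ((j < b)%N -> f (q * (b + b) + i)%N <= f (q * (b + b) + b + j)%N) ->
     P o.+1 (seti vK o.+1 (eval (RSt dst vK (Rld src vI);; vI <~ Iadd vI (Ic 1)) s3)).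
    move=> hi le; have mg' := merging_l bs hq hi jb mg le; rewrite -oE in mg'.
    apply: (step i.+1 j _ _ _ mg') => //; ev; rewrite ?eqxx ?e3k ?e3f ?eI //.
    by rewrite addn1 addnS.
  have right_ok : (j < b)%N -> ((i < b)%N -> f (q * (b + b) + b + j)%N <= f (q * (b + b) + i)%N) ->
     P o.+1 (seti vK o.+1 (eval (RSt dst vK (Rld src vJ);; vJ <~ Iadd vJ (Ic 1)) s3)).
    move=> hj le; have mg' := merging_r bs hq ib hj mg le; rewrite -oE in mg'.
    apply: (step i j.+1 _ _ _ mg') => //; ev; rewrite ?eqxx ?e3k ?e3f ?eJ ?addnS //.
    by rewrite ?addn1 ?addnS ?addn0.
  rewrite evalIfI [evi _ _]/= [evi vIE _]/= eI eIE ltn_add2l.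
  case: ifP => hi; last by apply: right_ok; [lia|rewrite hi].
  rewrite evalIfI [evi _ _]/= [evi vJE _]/= eJ eJE ltn_add2l; case: ifP => hj; last by apply: left_ok; [|rewrite hj].
  rewrite evalIfR [evr _ _]/= [evr (Rld src vI) _]/= eI eJ e3f.
  by case: ltP => le; [apply: right_ok => // _; apply: ltW|apply: left_ok].
case=> q [[oE _ _ h1 h2]|[i [j [ij [_ oE _ _]]]]].
  have -> : nb = q by apply/eqP; rewrite -(eqn_pmul2r (_ : 0 < b + b)%N) ?oE //; lia.
  by split=> // p; rewrite -oE h2.
have [qn|qn] := leqP nb q; first by have := leq_mul qn (leqnn (b + b)); lia.
by have := leq_mul qn (leqnn (b + b)); rewrite mulSn; lia.
Qed.
End Merge.

(** * Sampling and the quality of the splitting value *)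

Section Halve.
Variable R : realType.
Implicit Types (s : state R) (f g : nat -> R) (p : pred R).

Definition down p := forall x y, x <= y -> p y -> p x.

(** In a sorted block the values satisfying a downward closed predicate form an initial segment. The
    sample contains half of them, rounded down, so every block contributes an error of at most 1. *)
Lemma cnt_odds c nb f g p : blocks (c + c) nb f -> down p ->
  (forall x, (x < nb * c)%N -> g x = f x.*2.+1) ->
  (2 * cnt p g 0 (nb * c) <= cnt p f 0 (nb * (c + c)) <= 2 * cnt p g 0 (nb * c) + nb)%N.
Proof.
move=> bs dp gE; have inb q x : (q < nb)%N -> (x <= c)%N ->
    (cnt p f (q * (c + c)) (x + x) = 2 * cnt p g (q * c) x)%N \/
    [/\ cnt p f (q * (c + c)) (x + x) = (2 * cnt p g (q * c) x).+1, (0 < x)%N &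
        ~~ p (f (q * (c + c) + (x + x).-1)%N)].
  move=> hq; elim: x => [_|x IH xc]; first by left.
  have gx : g (q * c + x)%N = f (q * (c + c) + (x + x).+1)%N.
    by rewrite gE; [congr (f _); lia|nia].
  have le1 : f (q * (c + c) + (x + x))%N <= f (q * (c + c) + (x + x).+1)%N.
    by apply: bs => //; lia.
  have imp := dp _ _ le1; rewrite addSn addnS !cntS gx.
  case: (IH (ltnW xc)) => [->|[-> x0 np]].
    case pv : (p (f (q * (c + c) + (x + x).+1)%N)); first by left; rewrite imp //; lia.
    case: (p (f (q * (c + c) + (x + x))%N)); [right|left; lia].
    by split; [lia| |rewrite /= ?pv].
  have le2 : f (q * (c + c) + (x + x).-1)%N <= f (q * (c + c) + (x + x))%N by apply: bs => //; lia.
  have npu : p (f (q * (c + c) + (x + x))%N) = false.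
    by apply/negP => /(dp _ _ le2); apply/negP.
  have npv : p (f (q * (c + c) + (x + x).+1)%N) = false.
    by apply/negP => /imp; rewrite npu.
  by right; rewrite npu npv; split; [lia| |rewrite /= ?npv].
have tot n : (n <= nb)%N ->
  (2 * cnt p g 0 (n * c) <= cnt p f 0 (n * (c + c)) <= 2 * cnt p g 0 (n * c) + n)%N.
  elim: n => [//|n IH hn]; rewrite !mulSnr [cnt p f 0 _]cntD [cnt p g 0 _]cntD !add0n; have := IH (ltnW hn).
  by case: (inb n c hn (leqnn c)) => [->|[-> _ _]]; lia.
exact: tot.
Qed.

Lemma halve_spec s s' c nb : s' = eval halve s -> iv s vLEN = (nb * (c + c))%N ->
  blocks (c + c) nb (ra s fW) ->
  [/\ iv s' vLEN = (nb * c)%N, blocks c nb (ra s' fW) &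
   forall p, down p ->
   (2 * cnt p (ra s' fW) 0 (nb * c) <= cnt p (ra s fW) 0 (nb * (c + c))
      <= 2 * cnt p (ra s' fW) 0 (nb * c) + nb)%N].
Proof.
rewrite /halve !evalS; set s1 := (X in eval (For _ _ _) X).
set body := (X in eval (For _ _ X) _); set s2 := eval (For _ _ _) s1 => -> el bs.
pose f := ra s fW; pose P i (s' : state R) := [/\ iv s' vC = i./2, iv s' vOdd = odd i,
  forall x, (x < i./2)%N -> ra s' fW x = f x.*2.+1 &
  forall x, (i./2 <= x)%N -> ra s' fW x = f x].
have [eC _ h1 _] : P (nb * (c + c))%N s2.
  have LL : iv s1 vLEN = (nb * (c + c))%N by rewrite -el.
  rewrite -LL; apply: (For_ind (P := P)) => [|i s3 hi ek sm [hC hO h1 h2]]; first by split.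
  rewrite /body /P evalIfI [evi _ _]/= [evi vOdd _]/= hO lt0n eqb0 negbK /= uphalf_half.
  case oi : (odd i) => /=; rewrite ?add0n ?add1n; split; ev => //.
  - by rewrite hC addn1.
  - move=> x; ev; rewrite ltnS leq_eqVlt hC => /orP[/eqP->|xl]; last by rewrite ltn_eqF // h1.
    have := odd_double_half i; rewrite oi eqxx ek h2; last by lia.
    by move=> oi'; congr f; lia.
  - by move=> x xl; ev; rewrite hC gtn_eqF // h2 // ltnW.
have hl : (nb * (c + c))./2 = (nb * c)%N by rewrite mulnDr addnn doubleK.
rewrite hl in eC h1; have E p : down p -> _ := fun dp => cnt_odds bs dp h1.
split; [by ev| |exact: E].
move=> q i j hq ij jc; change (ra s2 fW (q * c + i)%N <= ra s2 fW (q * c + j)%N).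
rewrite (h1 (q * c + i)%N); last by nia.
rewrite (h1 (q * c + j)%N); last by nia.
have -> : ((q * c + i).*2.+1 = q * (c + c) + i.*2.+1)%N by lia.
have -> : ((q * c + j).*2.+1 = q * (c + c) + j.*2.+1)%N by lia.
by apply: bs => //; lia.
Qed.

Lemma level_spec s s' b nb : s' = eval level s -> (0 < b)%N -> iv s vB = b ->
  iv s vLEN = (nb * 4 * b)%N -> blocks b (nb * 4) (ra s fW) ->
  [/\ iv s' vB = (2 * b)%N, iv s' vLEN = (nb * (2 * b))%N, blocks (2 * b) nb (ra s' fW),
   iv s' vB4 = iv s vB2 /\ iv s' vB2 = b &
   forall p, down p ->
   (2 * cnt p (ra s' fW) 0 (nb * (2 * b)) <= cnt p (ra s fW) 0 (nb * 4 * b)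
      <= 2 * cnt p (ra s' fW) 0 (nb * (2 * b)) + nb)%N].
Proof.
rewrite /level (evalS (merge_pass _ _ _)) (evalS (vBB <~ _)) (evalS (merge_pass _ _ _)) (evalS halve).
set s1 := eval (merge_pass _ _ _) s.
set s2 := eval (ISet _ _) s1; set s3 := eval (merge_pass _ _ _) s2.
set s4 := eval halve s3 => -> b0 eb el bs.
have L1 : iv s vLEN = (nb.*2 * (b + b))%N by rewrite el; lia.
have bs1 : blocks b (nb.*2 + nb.*2) (ra s fW) by rewrite (_ : _ + _ = nb * 4)%N //; lia.
have [a1 c1] := merge_pass_spec (isT : fW != fW2) (isT : (vB == vB) || (vB == vBB)) eb L1 b0 erefl bs1.
rewrite -/s1 in a1 c1.
have b1 : iv s1 vB = b by rewrite frame_iv.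
have b2 : iv s2 vBB = (b + b)%N by rewrite /s2; ev; rewrite b1.
have L2 : iv s2 vLEN = (nb * ((b + b) + (b + b)))%N.
  by rewrite frame_iv // frame_iv // el; lia.
have e21 : ra s2 fW2 = ra s1 fW2 by rewrite frame_ra.
have bs2 : blocks (b + b) (nb + nb) (ra s2 fW2) by rewrite e21 [(nb + nb)%N]addnn.
have b20 : (0 < b + b)%N by lia.
have [a3 c3] := merge_pass_spec (isT : fW2 != fW) (isT : (vBB == vB) || (vBB == vBB)) b2 L2 b20 erefl bs2.
rewrite -/s3 in a3 c3.
have L3 : iv s3 vLEN = (nb * ((b + b) + (b + b)))%N by rewrite frame_iv.
have [L4 a4 c4] := halve_spec erefl L3 a3; rewrite -/s4 in L4 a4 c4.
have F4 : same halve s3 s4 by exact: eval_same.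
have F3 : same (merge_pass fW2 fW vBB) s2 s3 by exact: eval_same.
have F2 : same (merge_pass fW fW2 vB;; vBB <~ Iadd vB vB) s s2 by exact: eval_same.
have e2 : (2 * b = b + b)%N by lia.
have c2 p : cnt p (ra s2 fW2) 0 (nb * (b + b + (b + b))) = cnt p (ra s fW) 0 (nb * 4 * b).
  have -> : (nb * (b + b + (b + b)) = nb.*2 * (b + b))%N by lia.
  by rewrite e21 c1; congr cnt; lia.
rewrite e2; seal s4; seal s3; seal s2; split.
- by ev; fr F4; fr F3; rewrite b2.
- by ev.
- by [].
- by split; ev; fr F4; fr F3; fr F2.
- by move=> p dp; have := c4 p dp; rewrite c3 c2.
Qed.

(** Without denominators cleared, the invariant is [c0 <= b * c + N / 2 * (1 - 1 / b)]. A level adds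
    an error of at most [b * nb = N / (4 * b)], by which the last term grows when [b] is doubled. *)
Lemma level_arith N b nb c c' c0 : (0 < b)%N -> (b * b * (nb * 4) = N)%N -> (b * c <= c0)%N ->
  (2 * c0 * b <= 2 * b * (b * c) + N * (b - 1))%N -> (2 * c' <= c)%N -> (c <= 2 * c' + nb)%N ->
  (2 * b * c' <= c0)%N /\ (2 * c0 * (2 * b) <= 2 * (2 * b) * (2 * b * c') + N * (2 * b - 1))%N.
Proof.
case: b => // b _ NE h1 h2 h3 h4.
have h5 := leq_mul (leqnn b.+1) h3; have h6 := leq_mul (leqnn (4 * b.+1 * b.+1)%N) h4.
have e : (2 * b.+1 - 1 = 2 * b + 1)%N by lia.
rewrite subn1 /= in h2; rewrite e; split; first by lia.
rewrite -NE in h2 *; lia.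
Qed.

(** The sampling error is below half of the [b * b] values, so at most a quarter of the sample
    stands for at most three quarters of the values. *)
Lemma splitter_arith b c1 c3 q : (0 < b)%N -> (4 * q <= b)%N -> (c3 <= q)%N ->
  (2 * c1 * b <= 2 * b * (b * c3) + b * b * (b - 1))%N -> (4 * c1 <= 3 * (b * b))%N.
Proof.
case: b => // b _ hq hc; rewrite subn1 /= => h.
have h1 : (8 * b.+1 * b.+1 * c3 <= 2 * b.+1 * b.+1 * b.+1)%N.
  by have := leq_mul (leqnn (2 * b.+1 * b.+1)%N) (leq_trans (leq_mul (leqnn 4) hc) hq); lia.
by rewrite -(leq_pmul2r (ltn0Sn b)); lia.
Qed.

(** Multiplied by [b], a count in the sample never exceeds the true one, which yields enough values
    up to [t]; it falls short by less than half of all values, which yields enough values from [t]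
    on. *)
Lemma splitter_spec s s' h (C := ra s fW) (N := (4 ^ h)%N) (t := rv s' rT) :
  s' = eval splitter s -> iv s vNN = N ->
  (N <= 4 * cnt [pred x | (x <= t)%R] C 0 N)%N /\ (N <= 4 * cnt [pred x | (t <= x)%R] C 0 N)%N.
Proof.
rewrite /t {t} /splitter !evalS; set s1 := (X in eval (For _ _ _) X).
set body := (X in eval (For _ _ X) _); set s2 := eval (For _ _ _) s1 => ds eN.
(* After [j] levels there are [4 ^ (h - j)] blocks of length [2 ^ j]; the minimum accounts for the
   idle passes. *)
pose P it (s' : state R) := let j := minn it h in let b := (2 ^ j)%N in let q := (4 ^ (h - j))%N in
  [/\ iv s' vB = b, iv s' vLEN = (q * b)%N, blocks b q (ra s' fW),
   (2 * iv s' vB2 <= b < 2 * iv s' vB2 + 2)%N /\ (4 * iv s' vB4 <= b < 4 * iv s' vB4 + 4)%N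
   & forall p, down p -> let c := cnt p (ra s' fW) 0 (q * b) in
     (b * c <= cnt p C 0 N)%N /\ (2 * cnt p C 0 N * b <= 2 * b * (b * c) + N * (b - 1))%N].
have pow j : (j <= h)%N -> (2 ^ j * 2 ^ j * 4 ^ (h - j) = N)%N.
  by move=> jh; rewrite -expnMn -expnD subnKC.
have : P N s2.
  have LL : iv s1 vNN = N by rewrite -eN.
  rewrite -{1}LL; apply: (For_ind (P := P)) => [|i s3 hi ek sm IH].
    rewrite /P min0n subn0 expn0 muln1; split=> //; try by ev.
      by move=> q x y _ xy y1; have -> : x = y by lia.
    move=> p _; have -> : cnt p (ra (seti vL 0 s1) fW) 0 (4 ^ h) = cnt p C 0 N by [].
    by rewrite /= subnn; lia.
  have [hj|hj] := leqP h i.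
    case: IH => e1 e2 bs e4 e5; rewrite /P (minn_idPr (leqW hj)); rewrite (minn_idPr hj) in e1 e2 bs e4 e5.
    have E : eval body s3 = s3 by rewrite /body evalIfI [evi _ _]/= [evi vLEN _]/= e1 e2 subnn mul1n ltnn.
    by rewrite E; split.
  rewrite /P (minn_idPl hj); case: IH => e1 e2 bs e4 e5.
  rewrite (minn_idPl (ltnW hj)) in e1 e2 bs e4 e5.
  set b := (2 ^ i)%N in e1 e2 bs e4 e5; set nb := (4 ^ (h - i.+1))%N.
  have q4 : (4 ^ (h - i) = nb * 4)%N by rewrite /nb -expnSr -subSn.
  rewrite q4 in e2 bs e5.
  have b0 : (0 < b)%N by rewrite expn_gt0.
  have nb0 : (0 < nb)%N by rewrite expn_gt0.
  have E : eval body s3 = eval level s3.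
    rewrite /body evalIfI [evi _ _]/= [evi vLEN _]/= e1 e2 (_ : b < _)%N //; nia.
  rewrite E; have [f1 f2 f3 [f4 f5] f6] := level_spec erefl b0 e1 e2 bs.
  set s4 := eval level s3 in f1 f2 f3 f4 f5 f6 *; seal s4.
  rewrite expnS -/b; split=> //.
    by split; ev; rewrite ?f4 ?f5; lia.
  move=> p dp; rewrite [ra _ _]/(ra s4 fW).
  have := f6 p dp; have [] := e5 p dp; have := pow i (ltnW hj); rewrite -/b q4.
  set c := cnt p (ra s3 fW) _ _; set c' := cnt p (ra s4 _) _ _; set c0 := cnt p C 0 N.
  by move=> NE h1 h2 /andP[h3 h4]; apply: level_arith NE h1 h2 h3 h4.
case; rewrite (minn_idPr _); last by apply: ltnW; apply: ltn_expl.
rewrite subnn mul1n; set b := (2 ^ h)%N => e1 e2 bs [_ e4] e5.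
have NE : N = (b * b)%N by rewrite /N -expnMn.
have b0 : (0 < b)%N by rewrite expn_gt0.
have -> : rv s' rT = ra s2 fW (iv s2 vB4) by rewrite ds.
set t := ra s2 fW _.
have srt i j : (i <= j)%N -> (j < b)%N -> ra s2 fW i <= ra s2 fW j.
  by move=> ij jb; have := bs 0%N i j isT ij jb.
have lt4 : (iv s2 vB4 < b)%N by lia.
have low : (iv s2 vB4 < cnt [pred x | (x <= t)%R] (ra s2 fW) 0 b)%N.
  rewrite -(subnKC lt4) cntD.
  have -> : cnt [pred x | (x <= t)%R] (ra s2 fW) 0 (iv s2 vB4).+1 = (iv s2 vB4).+1.
    apply/eqP; rewrite -[X in _ == X](size_iota 0) -all_count; apply/allP => i.
    by rewrite mem_iota /= add0n ltnS => il; apply: srt.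
  exact: leq_addr.
have high : (cnt [pred x | (x < t)%R] (ra s2 fW) 0 b <= iv s2 vB4)%N.
  rewrite -(subnKC (ltnW lt4)) cntD -[X in (_ <= X)%N]addn0; apply: leq_add; first exact: cnt_le_size.
  rewrite leqn0 /cnt -leqn0 leqNgt -has_count; apply/hasPn => i; rewrite mem_iota add0n => /andP[h1 h2].
  by rewrite /= -leNgt; apply: srt => //; lia.
split.
  have dp : down [pred x | x <= t] by move=> x y xy /=; apply: le_trans.
  have [h1 _] := e5 _ dp; rewrite -/t in h1.
  have h2 := leq_mul (leqnn b) low; have h3 := leq_mul (leqnn b) (andP e4).2.
  rewrite NE in h1 *; lia.
have dp : down [pred x | x < t] by move=> x y xy /=; apply: le_lt_trans.
have [_] := e5 _ dp.
have : (cnt [pred x | (x < t)%R] C 0 N + cnt [pred x | (t <= x)%R] C 0 N = N)%N.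
  rewrite /cnt -[RHS](size_iota 0) -(count_predC (fun i => [pred x | x < t] (C i))).
  by congr (_ + _)%N; apply: eq_count => i /=; rewrite -leNgt.
rewrite NE; set c1 := cnt _ C _ _; set c2 := cnt _ C _ _; set c3 := cnt _ _ _ _ in high *.
move=> sum; have -> : c2 = (b * b - c1)%N by lia.
move=> H; have := splitter_arith b0 (andP e4).1 high H; lia.
Qed.
End Halve.

(** * Pairing and pruning *)

Section Counting.
Variable R : realType.
Implicit Types (I : inst R) (ps : seq (nat * nat)).

Definition num_children I k := count (fun j => par I j == k) (iota 1 (sz I).-1).

Lemma mem_children I j : (j \in iota 1 (sz I).-1) = (0 < j < sz I)%N.
Proof. by rewrite mem_iota; case: (sz I) => [|m] /=; rewrite ?add1n //; lia. Qed.

Lemma leafP I k : leaf I k <-> num_children I k = 0%N.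
Proof.
split=> [lf|/eqP].
  apply/eqP; rewrite /num_children -leqn0 leqNgt -has_count; apply/hasPn => j; rewrite mem_children => hj.
  by apply/eqP; apply: lf.
rewrite /num_children -leqn0 leqNgt -has_count => /hasPn H j; rewrite -mem_children => /H /eqP.
exact.
Qed.

Lemma nch_two I j k : (0 < j < sz I)%N -> (0 < k < sz I)%N -> par I j = par I k -> j <> k ->
  (1 < num_children I (par I k))%N.
Proof.
move=> hj hk e /eqP ne; rewrite /num_children -size_filter.
apply: (@uniq_leq_size _ [:: j; k]); first by rewrite /= inE ne.
by move=> x; rewrite !inE mem_filter => /orP[] /eqP ->; rewrite mem_children ?e eqxx.
Qed.

Lemma nch_pos I k : (0 < k < sz I)%N -> (0 < num_children I (par I k))%N.
Proof. by move=> hk; rewrite /num_children -has_count; apply/hasP; exists k; rewrite ?mem_children. Qed.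

Definition flat ps := unzip1 ps ++ unzip2 ps.

Lemma perm_flat_rcons ps u v : perm_eq (flat (rcons ps (u, v))) [:: u, v & flat ps].
Proof.
by apply/permP => a; rewrite /flat /unzip1 /unzip2 !map_rcons -!cats1 /= !count_cat /=; lia.
Qed.

Lemma size_flat ps : size (flat ps) = (size ps + size ps)%N.
Proof. by rewrite size_cat !size_map. Qed.

(* Unmatched nonroot vertices have a parent with at least two children, and there are
   fewer than twice as many such vertices as there are leaves, which are all matched. *)
Lemma many_pairs I ps : inst_wf I -> (1 < sz I)%N -> uniq (flat ps) ->
  (forall x, x \in flat ps -> (x < sz I)%N) ->
  (forall c, (0 < c < sz I)%N -> num_children I c = 0%N \/ num_children I (par I c) = 1%N -> c \in flat ps) ->
  (sz I <= 6 * size ps)%N.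
Proof.
move=> w m1 un lt cov; set m := sz I in lt cov *; set F := flat ps in un lt cov.
have [_ pl _] := w.
pose L := count (fun k => num_children I k == 0%N) (iota 0 m).
have LF : (L <= size F)%N.
  rewrite /L -size_filter; apply: uniq_leq_size; first by rewrite filter_uniq ?iota_uniq.
  move=> k; rewrite mem_filter mem_iota add0n => /andP[/eqP nk /andP[_ km]].
  apply: cov; last by left.
  rewrite km andbT lt0n; apply/eqP => k0.
  have h1 : (0 < 1 < sz I)%N by [].
  by have := nch_pos h1; have := pl 1%N h1; case: (par I 1) => //; rewrite -k0 nk.
(* Double counting of the edges. *)
have sum_par (g : nat -> nat) :
    (\sum_(j <- iota 1 m.-1) g (par I j) = \sum_(k <- iota 0 m) g k * num_children I k)%N.
  transitivity (\sum_(j <- iota 1 m.-1) \sum_(k <- iota 0 m) (g k * (par I j == k)))%N.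
    apply: eq_big_seq => j; rewrite mem_children => hj.
    rewrite (bigD1_seq (par I j)) ?iota_uniq //=; last first.
      by rewrite mem_iota add0n; apply: par_lt.
    rewrite eqxx muln1 big1 ?addn0 // => k; rewrite eq_sym => /negbTE ->; exact: muln0.
  rewrite exchange_big; apply: eq_bigr => k _; rewrite -big_distrr /=.
  by rewrite /num_children -sum1_count [in RHS]big_mkcond; congr (_ * _)%N; apply: eq_bigr => j _; case: eqP.
have tot : (\sum_(k <- iota 0 m) num_children I k = m.-1)%N.
  rewrite (eq_bigr (fun k => 1 * num_children I k)%N) => [|k _]; last by rewrite mul1n.
  by rewrite -(sum_par (fun=> 1%N)) big_const_seq count_predT size_iota iter_addn_0 mul1n.
have unm : (count (fun j => j \notin F) (iota 1 m.-1) <= \sum_(k <- iota 0 m) (1 < num_children I k)%N * num_children I k)%N.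
  rewrite -sum_par -sum1_count big_mkcond [leqLHS]big_seq [leqRHS]big_seq; apply: leq_sum => j.
  rewrite mem_children => hj; case: ifP => // nj; rewrite lt0b ltnNge; apply/negP => le1.
  have h := nch_pos hj; case/negP: nj; apply: cov => //; right; lia.
have mat : (count (fun j => j \in F) (iota 1 m.-1) <= size F)%N.
  rewrite -size_filter; apply: uniq_leq_size; first by rewrite filter_uniq ?iota_uniq.
  by move=> k; rewrite mem_filter => /andP[].
have Lsum : (\sum_(k <- iota 0 m) (num_children I k == 0%N) = L)%N.
  by rewrite /L -sum1_count [in RHS]big_mkcond; apply: eq_bigr => k _; case: eqP.
(* Summed over all vertices, this bounds the unmatched nonroot vertices by [2 * L - 2], and hence
   [m] by three times the number of matched ones. *)
have pw : (\sum_(k <- iota 0 m) ((1 < num_children I k) * num_children I k + 2) <=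
    \sum_(k <- iota 0 m) (2 * num_children I k + 2 * (num_children I k == 0)))%N.
  by apply: leq_sum => k _; case: (num_children I k) => [|[|n]] //=; lia.
have e1 : (\sum_(k <- iota 0 m) (2 * num_children I k + 2 * (num_children I k == 0)) = 2 * m.-1 + 2 * L)%N.
  by rewrite -tot -Lsum !big_distrr -big_split.
have e2 : (\sum_(k <- iota 0 m) ((1 < num_children I k) * num_children I k + 2) =
    \sum_(k <- iota 0 m) (1 < num_children I k) * num_children I k + 2 * m)%N.
  by rewrite big_split /= big_const_seq count_predT size_iota iter_addn_0.
move: pw; rewrite e1 e2.
have := count_predC (fun j => j \in F) (iota 1 m.-1); rewrite size_iota.
move: unm mat LF; rewrite size_flat (eq_count (_ : predC _ =1 (fun j => j \notin F))) //.
lia.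
Qed.
End Counting.

(** * The greedy matching *)

Section Matching.
Variable R : realType.
Implicit Types s : state R.

Lemma prepare_spec s s' (I := inst_of s) (I' := inst_of s') : s' = eval prepare s -> inst_wf I ->
  [/\ inst_wf I', leaf_up I', forall e x, feas I e x <-> feas I' e x,
      sz I' = sz I & (1 < sz I)%N -> forall k, (k < sz I)%N ->
      [/\ ia s' aCH k = num_children I' k, ia s' aPEND k = 0%N & ia s' aDEL k = 0%N]].
Proof.
rewrite /I /I' {I I'} /prepare !evalS; set I := inst_of s; set s1 := eval (vU <~ _) s.
set s2 := eval (For _ _ _) s1; set s3 := eval (For _ _ _) s2.
set body4 := (X in eval (For _ _ X) s3); set s4 := eval (For _ _ _) s3 => -> w.
have [m0 pl sl] := w; set m := sz I in m0 pl sl *.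
have H2 k : (k < m)%N -> [/\ ia s2 aCH k = 0%N, ia s2 aPEND k = 0%N & ia s2 aDEL k = 0%N].
  pose P i (s' : state R) := forall k, (k < i)%N ->
    [/\ ia s' aCH k = 0%N, ia s' aPEND k = 0%N & ia s' aDEL k = 0%N].
  suff : P (iv s1 vM) s2 by apply.
  apply: For_ind => // i t hi ek sm IH j; rewrite ltnS => ji.
  ev; rewrite ek; have [//|ne] := eqVneq j i.
  by apply: IH; rewrite ltn_neqAle ne.
have F2 : same (vU <~ Isub vM (Ic 1);; For vK vM (ISt aCH vK (Ic 0);; ISt aPEND vK (Ic 0);; ISt aDEL vK (Ic 0))) s s2.
  exact: eval_same.
have LU : iv s2 vU = (m - 1)%N by rewrite frame_iv // /s1; ev.
have H3 k : (k < m)%N -> ia s3 aCH k = num_children I k.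
  pose P i (s' : state R) := forall k, (k < m)%N -> ia s' aCH k = count (fun j => par I j == k) (iota 1 i).
  rewrite /num_children -/m -subn1 -LU; move: k; apply: (For_ind (P := P)) => [k km|i t hi ek sm IH k km].
    by have [] := H2 k km.
  have par_i : ia t aPAR (iv t vK + 1)%N = par I i.+1 by rewrite ek; fr sm; fr F2; rewrite addn1.
  have hi' : (0 < i.+1 < m)%N by rewrite LU in hi; lia.
  rewrite -[i.+1]addn1 iotaD count_cat /= addn0 -IH // add1n; ev; rewrite par_i.
  rewrite [par I i.+1 == k]eq_sym; case: eqP => [->|_]; last by rewrite addn0.
  by rewrite IH //; apply: (par_lt w).
have F3 : same (For vK vU (vP <~ Ild aPAR (Iadd vK (Ic 1));; ISt aCH vP (Iadd (Ild aCH vP) (Ic 1)))) s2 s3.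
  exact: eval_same.
have LU3 : iv s3 vU = (m - 1)%N by fr F3.
pose leafk i k := [&& (0 < k <= i)%N, (k < m)%N & num_children I k == 0%N].
have H4 : forall k, (k < m)%N -> ra s4 fB k = (if leafk m k then na I (par I k) else na I k) /\
    ra s4 fT k = (if leafk m k then ns I (par I k) else ns I k).
  suff : forall k, (k < m)%N -> ra s4 fB k = (if leafk (m - 1)%N k then na I (par I k) else na I k) /\
    ra s4 fT k = (if leafk (m - 1)%N k then ns I (par I k) else ns I k).
    move=> H k km; have [-> ->] := H k km; rewrite /leafk km.
    by rewrite (_ : (0 < k <= m - 1)%N = (0 < k <= m)%N) //; apply/idP/idP; lia.
  pose P i (s' : state R) := forall k, (k < m)%N ->
    ra s' fB k = (if leafk i k then na I (par I k) else na I k) /\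
    ra s' fT k = (if leafk i k then ns I (par I k) else ns I k).
  rewrite -LU3; apply: (For_ind (P := P)) => [k km|i t hi ek sm IH k km].
    by rewrite /leafk leqn0 lt0n andNb /=; fr F3; fr F2.
  have hi' : (0 < i.+1 < m)%N by rewrite LU3 in hi; lia.
  have split_leaf : leafk i.+1 k = leafk i k || (k == i.+1) && (num_children I i.+1 == 0%N).
    rewrite /leafk; have [->|ne] := eqVneq k i.+1; first by rewrite ltnn andbF /= leqnn; case/andP: hi' => _ ->.
    by rewrite orbF [(k <= i.+1)%N]leq_eqVlt (negbTE ne) ltnS.
  have [IH1 IH2] := IH k km; have pm := par_lt w hi'.
  have [IH3 IH4] := IH _ pm.
  (* A parent is no leaf, so the line that is copied from it is still the original one. *)
  have nleaf : leafk i (par I i.+1) = false.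
    by rewrite /leafk; have := nch_pos hi'; case: (num_children I _) => // n _; rewrite !andbF.
  rewrite nleaf in IH3 IH4.
  have CHE : ia t aCH i.+1 = num_children I i.+1 by fr sm; rewrite H3 //; case/andP: hi'.
  have PE : ia t aPAR i.+1 = par I i.+1 by fr sm; fr F3; fr F2.
  rewrite /body4 evalS evalIfI; set t1 := eval (vV <~ _) t.
  have v1 : iv t1 vV = i.+1 by rewrite /t1; ev; rewrite ek addn1.
  have Ft : same (vV <~ Iadd vK (Ic 1)) t t1 by exact: eval_same.
  clearbody t1; rewrite [evi _ _]/= v1 [evi (Ic 1) _]/= split_leaf; fr Ft; rewrite CHE ltnS leqn0.
  case: ifP => h; rewrite ?andbF ?andbT ?orbF; last by ev; fr Ft.
  ev; rewrite v1; fr Ft; rewrite PE IH3 IH4.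
  have [->|ne] := eqVneq k i.+1; first by rewrite orbT.
  by rewrite orbF; fr Ft.
have F4 : same (For vK vU body4) s3 s4 by exact: eval_same.
have szE : sz (inst_of s4) = m by rewrite /=; fr F4; fr F3; fr F2.
have parE : par (inst_of s4) = par I by rewrite /=; fr F4; fr F3; fr F2.
have laE : la (inst_of s4) = la I by rewrite /=; fr F4; fr F3; fr F2.
have lsE : ls (inst_of s4) = ls I by rewrite /=; fr F4; fr F3; fr F2.
have naE k : (k < m)%N -> na (inst_of s4) k = if leafk m k then na I (par I k) else na I k.
  by move=> km; have [] := H4 k km.
have nsE k : (k < m)%N -> ns (inst_of s4) k = if leafk m k then ns I (par I k) else ns I k.
  by move=> km; have [] := H4 k km.
have nchE k : num_children (inst_of s4) k = num_children I k by rewrite /num_children szE parE.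
have leafkE k : (0 < k < m)%N -> leafk m k = (num_children I k == 0%N).
  by rewrite /leafk => /andP[-> km]; rewrite km ltnW.
have leafkP k : (0 < k < m)%N -> leafk m (par I k) = false.
  by move=> hk; rewrite /leafk; have := nch_pos hk; case: (num_children I _) => // n _; rewrite !andbF.
split=> //.
- split; rewrite ?szE ?parE ?lsE // => k km; rewrite nsE //.
  have [h1 h2] := sl k km; split=> //; case: ifP => // /and3P[/andP[k0 _] _ _].
  by have [] := sl (par I k) (par_lt w (introT andP (conj k0 km))).
- move=> k; rewrite szE => hk /leafP; rewrite nchE parE => lk x.
  have km : (k < m)%N by case/andP: hk.
  have pm := par_lt w hk.
  by rewrite /up_line naE // nsE // leafkE // lk eqxx naE // nsE // leafkP.
- move=> e x.
  have -> : inst_of s4 = Inst m (par I) (la I) (ls I) (na (inst_of s4)) (ns (inst_of s4)).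
    by rewrite -laE -lsE -parE -szE.
  apply: feas_leaf => //.
  move=> k km; rewrite naE // nsE //; case: ifP => [/and3P[_ _ /eqP h]|_]; last by left.
  by right; apply/leafP.
- move=> m1 k km; have [_ hP hD] := H2 k km.
  by rewrite nchE; split; fr F4; rewrite ?H3 //; fr F3.
Qed.

Definition pairs s := mkseq (fun i => (ia s aU i, ia s aV i)) (iv s vNP).

Lemma eval_emit s u v : evi u s = v -> let s' := eval (emit u) s in
  [/\ pairs s' = rcons (pairs s) (v, iv s vV), ia s' aPEND = ia s aPEND, iv s' vV = iv s vV
   & iv s' vP = iv s vP].
Proof.
move=> e s'; have E : iv s' vNP = (iv s vNP).+1 by rewrite /s'; ev; rewrite addn1.
split=> //; rewrite /pairs E mkseqS /s'; congr rcons; last by ev; rewrite eqxx e.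
by apply/eq_in_map => i; rewrite mem_iota add0n => /andP[_ lt]; ev; rewrite ltn_eqF.
Qed.

Section Greedy.
Variable I : inst R.
Hypothesis w : inst_wf I.

(* The greedy pass has handled the vertices [>= K]; [pend p = c.+1] records a child [c] of
   [p] that waits for a partner, which is either a sibling leaf or [p] itself. *)
Definition greedy K ps (pend : nat -> nat) :=
  [/\ forall p, p \in ps -> mergeable I p.1 p.2 /\ (K <= p.2)%N, uniq (flat ps),
    forall p c, (p < K)%N -> pend p = c.+1 -> [/\ (K <= c)%N, (0 < c < sz I)%N, par I c = p,
      c \notin flat ps & num_children I c = 0%N \/ num_children I p = 1%N] &
    forall c, (0 < c < sz I)%N -> (K <= c)%N -> num_children I c = 0%N \/ num_children I (par I c) = 1%N ->
      c \in flat ps \/ (par I c < K)%N /\ pend (par I c) = c.+1].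

Lemma greedy_ge K ps pend x : greedy K ps pend -> x \in flat ps -> (K <= x < sz I)%N.
Proof.
case=> H _ _ _; rewrite mem_cat => /orP[] /mapP[[u v] /H [[/= vu um _] Kv] ->] /=.
  by rewrite um (leq_trans Kv) // ltnW.
by rewrite Kv (ltn_trans vu).
Qed.

Lemma nch_one p c k : (0 < k < sz I)%N -> par I k = p -> num_children I p = 1%N ->
  (0 < c < sz I)%N -> par I c = p -> c = k.
Proof.
move=> hk ek n1 hc ec; apply/eqP/negPn/negP => /eqP ne.
by have := nch_two hc hk; rewrite ec ek n1 => /(_ erefl ne).
Qed.

Lemma mem_flat_rcons ps u v x : (x \in flat (rcons ps (u, v))) = [|| x == u, x == v | x \in flat ps].
Proof. by rewrite (perm_mem (perm_flat_rcons ps u v)) !inE. Qed.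

Variables (k : nat) (ps : seq (nat * nat)) (pend : nat -> nat).
Hypotheses (km : (k < sz I)%N) (Q : greedy k.+1 ps pend).

Lemma greedy_fresh : k \notin flat ps.
Proof. by apply/negP => /(greedy_ge Q); rewrite ltnn. Qed.

(** Common to both cases in which [k] gets a partner; [pend'] may differ from [pend] below [k] only
    by forgetting [u]. *)
Lemma greedy_add u pend' : mergeable I u k -> u \notin flat ps -> u != k ->
  (forall p c, (p < k)%N -> pend' p = c.+1 -> pend p = c.+1 /\ c <> u) ->
  (forall c, (0 < c < sz I)%N -> (k < c)%N -> num_children I c = 0%N \/ num_children I (par I c) = 1%N ->
     (par I c <= k)%N -> pend (par I c) = c.+1 -> c <> u ->
     (par I c < k)%N /\ pend' (par I c) = c.+1) ->
  greedy k (rcons ps (u, k)) pend'.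
Proof.
have [q1 q2 q3 q4] := Q => mg nu uk h1 h2; split.
- move=> p; rewrite mem_rcons inE => /orP[/eqP -> //|/q1[h3 h4]]; split=> //; exact: ltnW.
- by rewrite (perm_uniq (perm_flat_rcons _ _ _)) /= inE negb_or uk nu greedy_fresh q2.
- move=> p c pk /(h1 _ _ pk) [/(q3 _ _ (ltnW pk)) [c1 c2 c3 c4 c5] cu]; split=> //; first exact: ltnW.
  rewrite mem_flat_rcons !negb_or c4 andbT; apply/andP; split; apply/eqP => // ck.
  by rewrite ck ltnn in c1.
- move=> c hc; rewrite leq_eqVlt => /orP[/eqP <-|kc] hyp.
    by left; rewrite mem_flat_rcons eqxx orbT.
  have [->|/eqP cu] := eqVneq c u; first by left; rewrite mem_flat_rcons eqxx.
  case: (q4 c hc kc hyp) => [h|[le h]]; first by left; rewrite mem_flat_rcons h !orbT.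
  by right; apply: h2.
Qed.

Lemma greedy_child c : pend k = c.+1 -> greedy k (rcons ps (c, k)) pend.
Proof.
have [q1 q2 q3 q4] := Q => pk; have [c1 c2 c3 c4 c5] := q3 k c (leqnn _) pk.
apply: greedy_add => //.
- split=> //; first by case/andP: c2.
  left; split=> //; case: c5 => [/leafP h|n1]; [by left|right=> j hj ej].
  exact: (nch_one c2 c3 n1).
- by rewrite gtn_eqF.
- move=> p c' pk' e; split=> // cc; have [_ _ e' _ _] := q3 p c' (ltnW pk') e.
  by move: pk'; rewrite -e' cc c3 ltnn.
- move=> c' hc' kc' hyp le e ne; split=> //; rewrite ltn_neqAle le andbT.
  by apply/eqP => pe; rewrite pe pk in e; case: e => e; apply: ne.
Qed.

(** The waiting vertex [c] is a leaf or an only child; as [k] is another child of the same parent,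
    it is a leaf. *)
Lemma greedy_sibling c : (0 < k)%N -> pend k = 0%N -> num_children I k = 0%N -> pend (par I k) = c.+1 ->
  greedy k (rcons ps (c, k)) (upd pend (par I k) 0%N).
Proof.
have [q1 q2 q3 q4] := Q; have [_ pl _] := w => k0 pk nk pp.
have hk : (0 < k < sz I)%N by rewrite k0.
have pkk := pl k hk; have [c1 c2 c3 c4 c5] := q3 _ c (ltnW pkk) pp.
have ck : c <> k by move=> e; rewrite e ltnn in c1.
apply: greedy_add => //.
- split=> //; first by case/andP: c2.
  right; split=> //; apply/leafP => //; case: c5 => // n1.
  by case: ck; apply: (nch_one hk erefl n1).
- exact/eqP.
- move=> p c' pk'; rewrite updE; case: eqP => // ne e; split=> // cc.
  by have [_ _ e' _ _] := q3 p c' (ltnW pk') e; case: ne; rewrite -e' cc c3.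
- move=> c' hc' kc' hyp le e ne; rewrite updE; case: eqP => [pe|_].
    by rewrite pe pp in e; case: e => e; case: ne.
  by split=> //; rewrite ltn_neqAle le andbT; apply/eqP => pe; rewrite pe pk in e.
Qed.

Lemma greedy_wait : (0 < k)%N -> pend k = 0%N -> num_children I k = 0%N \/ num_children I (par I k) = 1%N ->
  pend (par I k) = 0%N \/ num_children I (par I k) = 1%N -> greedy k ps (upd pend (par I k) k.+1).
Proof.
have [q1 q2 q3 q4] := Q; have [_ pl _] := w => k0 pk hyp free.
have hk : (0 < k < sz I)%N by rewrite k0.
have other c : (0 < c < sz I)%N -> (k < c)%N -> pend (par I c) = c.+1 -> par I c <> par I k.
  move=> hc kc e pe; case: free => [h|n1]; first by rewrite pe h in e.
  by have e' := nch_one hk erefl n1 hc pe; rewrite e' ltnn in kc.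
split=> //.
- by move=> p /q1[h1 h2]; split=> //; exact: ltnW.
- move=> p c pk'; rewrite updE; case: eqP => [-> [<-]|_ e].
    by split=> //; exact: greedy_fresh.
  by have [h1 h2 h3 h4 h5] := q3 p c (ltnW pk') e; split=> //; exact: ltnW.
- move=> c hc; rewrite leq_eqVlt => /orP[/eqP <- _|kc hyp'].
    by right; rewrite updE eqxx; split=> //; exact: pl.
  case: (q4 c hc kc hyp') => [|[le e]]; [by left|right].
  rewrite updE; case: eqP => [/other|_]; first by move=> /(_ hc kc e).
  by split=> //; rewrite ltn_neqAle -ltnS le andbT; apply/eqP => pe; rewrite pe pk in e.
Qed.

Lemma greedy_skip : pend k = 0%N ->
  ((0 < k)%N -> num_children I k <> 0%N /\ num_children I (par I k) <> 1%N) -> greedy k ps pend.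
Proof.
have [q1 q2 q3 q4] := Q => pk no; split=> //.
- by move=> p /q1[h1 h2]; split=> //; exact: ltnW.
- move=> p c pk' e.
  by have [h1 h2 h3 h4 h5] := q3 p c (ltnW pk') e; split=> //; exact: ltnW.
- move=> c hc; rewrite leq_eqVlt => /orP[/eqP e|kc hyp'].
    by move: hc; rewrite -e => /andP[/no[h1 h2] _] [].
  case: (q4 c hc kc hyp') => [|[le e]]; [by left|right].
  by split=> //; rewrite ltn_neqAle -ltnS le andbT; apply/eqP => pe; rewrite pe pk in e.
Qed.

End Greedy.

Lemma matching_spec s s' (I := inst_of s) : s' = eval matching s -> inst_wf I -> (1 < sz I)%N ->
  (forall k, (k < sz I)%N -> ia s aCH k = num_children I k /\ ia s aPEND k = 0%N) ->
  [/\ forall p, p \in pairs s' -> mergeable I p.1 p.2, uniq (flat (pairs s')) &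
      (sz I <= 6 * iv s' vNP)%N].
Proof.
rewrite /matching evalS; set s1 := eval (vNP <~ _) s; set body := (X in eval (For _ _ X) s1).
move=> -> w m1 H0; set s2 := eval _ s1; pose m := sz I; have [_ pl _] := w.
pose P i (t : state R) := greedy I (m - i) (pairs t) (ia t aPEND).
have P0 : P 0%N (seti vK 0 s1).
  have e : pairs (seti vK 0 s1) = [::] by [].
  rewrite /P subn0 e; split=> // [p c /H0[_ h]|c /andP[_ h]]; last by rewrite leqNgt h.
  by rewrite [ia _ _ _](_ : _ = ia s aPEND p) // h.
have : P m s2.
  rewrite {1}(_ : m = iv s1 vM); last by rewrite /s1; ev.
  apply: For_ind P0 _ => i t hi ek sm; have {}hi : (i < m)%N by move: hi; rewrite /s1; ev.
  have ech k : (k < m)%N -> ia t aCH k = num_children I k by fr sm; move=> /H0[].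
  have epar : ia t aPAR = par I by fr sm.
  have em : iv t vM = m by fr sm; rewrite /s1; ev.
  clear sm; rewrite /P /body evalS; set t1 := eval (vV <~ _) t.
  pose k := (m - i.+1)%N; have -> : (m - i = k.+1)%N by rewrite /k; lia.
  rewrite -/k => Q; have km : (k < m)%N by rewrite /k; lia.
  have v1 : iv t1 vV = k by rewrite /t1; ev; rewrite ek em /k; lia.
  have pend1 : ia t1 aPEND = ia t aPEND by [].
  have ch1 : ia t1 aCH = ia t aCH by [].
  have par1 : ia t1 aPAR = par I by [].
  have : pairs t1 = pairs t by [].
  clearbody t1 => ps1; rewrite -ps1 -pend1 in Q.
  have seqK c j : pairs (seti vK j (eval c t1)) = pairs (eval c t1) by [].
  have seqP c j : ia (seti vK j (eval c t1)) aPEND = ia (eval c t1) aPEND by [].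
  rewrite seqK seqP.
  rewrite evalIfI [evi _ _]/= [evi (Ild _ _) _]/= v1.
  case E: (ia t1 aPEND k) => [|c]; last first.
    have ev : evi (Isub (Ild aPEND vV) (Ic 1)) t1 = c by rewrite /= v1 E subn1.
    have [e1 e2 _ _] := eval_emit ev.
    by rewrite ltn0Sn e1 e2 v1; apply: greedy_child.
  rewrite ltnn evalIfI [evi _ _]/= [evi vV _]/= v1.
  case: ifP => k0; last by apply: greedy_skip => //; rewrite k0.
  rewrite evalS; set t2 := eval (vP <~ _) t1.
  have v2 : iv t2 vV = k by [].
  have p2 : iv t2 vP = par I k by rewrite /t2; ev; rewrite v1 par1.
  have pend2 : ia t2 aPEND = ia t1 aPEND by [].
  have ch2 : ia t2 aCH = ia t aCH by rewrite -ch1.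
  have : pairs t2 = pairs t1 by [].
  clearbody t2 => ps2; rewrite -ps2 -pend2 in Q; rewrite -pend2 in E.
  have hk : (0 < k < sz I)%N by rewrite k0.
  have wait : eval (ISt aPEND vP (Iadd vV (Ic 1))) t2 = setia aPEND (par I k) k.+1 t2.
    by rewrite /= p2 v2 addn1.
  rewrite evalIfI [evi _ _]/= [evi (Ic 1) _]/= v2 ch2 ech // ltnS leqn0.
  case: eqP => nk; last first.
    rewrite evalIfI [evi _ _]/= [evi (Ic 2) _]/= p2 ch2 ech; last exact: par_lt.
    case: ifP => nch2; last by apply: greedy_skip => // _; split=> //; lia.
    have n1 : num_children I (par I k) = 1%N by have := nch_pos hk; lia.
    rewrite wait [pairs _]/(pairs t2) [ia _ aPEND]/=.
    by apply: greedy_wait => //; right.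
  rewrite evalIfI [evi _ _]/= [evi (Ild _ _) _]/= p2.
  case E2: (ia t2 aPEND (par I k)) => [|c].
    rewrite ltnn wait [pairs _]/(pairs t2) [ia _ aPEND]/=.
    by apply: greedy_wait => //; left.
  rewrite ltn0Sn evalS.
  have ev : evi (Isub (Ild aPEND vP) (Ic 1)) t2 = c by rewrite /= p2 E2 subn1.
  have [] := eval_emit ev; set t3 := eval (emit _) t2 => e1 e2 _ e4.
  have -> : pairs (eval (ISt aPEND vP (Ic 0)) t3) = rcons (pairs t2) (c, k) by rewrite -v2 -e1.
  have -> : ia (eval (ISt aPEND vP (Ic 0)) t3) aPEND = upd (ia t2 aPEND) (par I k) 0%N.
    by rewrite -p2 -e4 -e2.
  exact: greedy_sibling.
rewrite /P subnn => -[q1 q2 _ q4].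
split=> // [p /q1[]//|].
rewrite -[iv s2 vNP](size_mkseq (fun i => (ia s2 aU i, ia s2 aV i))) -/(pairs s2).
apply: many_pairs => //.
- move=> x; rewrite mem_cat => /orP[] /mapP[[u v] /q1 [[/= vu um _] _] ->] //=.
  exact: ltn_trans um.
- by move=> c hc hyp; case: (q4 c hc (leq0n _) hyp) => // -[].
Qed.

End Matching.

(** * Raising the lower bound and pruning the pairs *)

Section Split.
Variable R : realType.
Implicit Types s : state R.

Lemma pairsP s p : reflect (exists2 i, (i < iv s vNP)%N & p = (ia s aU i, ia s aV i)) (p \in pairs s).
Proof.
apply: (iffP mapP) => -[i]; first by rewrite mem_iota => /andP[_ h] ->; exists i.
by move=> h ->; exists i; rewrite ?mem_iota.
Qed.

Lemma raise_spec s s' (I := inst_of s) : s' = eval raise s -> rv s rE <= rv s' rE /\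
  (forall p, p \in pairs s -> cross I p.1 p.2 <= rv s' rE) /\
  (forall y, rv s rE <= y -> (forall p, p \in pairs s -> cross I p.1 p.2 <= y) -> rv s' rE <= y).
Proof.
rewrite /raise; set body := (X in For _ _ X) => ->; set s2 := eval _ s.
pose cr i := cross I (ia s aU i) (ia s aV i).
pose P n (t : state R) := [/\ rv s rE <= rv t rE, forall i, (i < n)%N -> cr i <= rv t rE &
  forall y, rv s rE <= y -> (forall i, (i < n)%N -> cr i <= y) -> rv t rE <= y].
have : P (iv s vNP) s2.
  apply: (For_ind (P := P)) => [|i t hi ek sm [p1 p2 p3]]; first by split.
  rewrite /body !evalS; set t1 := eval (vV <~ _) _; set t2 := eval (rC <~r _) t1.
  have c2 : rv t2 rC = cr i by rewrite /t2 /t1; ev; rewrite ek; fr sm.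
  have F2 : same (vU <~ Ild aU vK;; vV <~ Ild aV vK;;
    rC <~r Rdiv (Radd (Rld fA vU) (Rld fB vV)) (Radd (Rld fS vU) (Rld fT vV))) t t2 by exact: eval_same.
  clearbody t2; rewrite /P evalIfR [evr _ _]/= [evr rC _]/= c2; fr F2.
  have E : rv (seti vK i.+1 (if rv t rE < cr i then eval (rE <~r rC) t2 else eval Skip t2)) rE = Num.max (rv t rE) (cr i).
    by case: ltP => h; ev; fr F2.
  rewrite E; split=> [|j|y y1 y2].
  - by rewrite le_max p1.
  - by rewrite ltnS leq_eqVlt le_max => /orP[/eqP->|/p2->//]; rewrite lexx orbT.
  - by rewrite ge_max y2 // andbT p3 // => j /ltnW; apply: y2.
case=> p1 p2 p3; split=> //; split=> [p /pairsP[i hi ->]|y y1 y2]; first exact: p2.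
by apply: p3 => // i hi; apply: (y2 (_, _)); apply/pairsP; exists i.
Qed.

Lemma truncate_spec s s' : s' = eval truncate s -> (0 < iv s vNP)%N ->
  exists h, [/\ iv s' vNN = (4 ^ h)%N, (4 ^ h <= iv s vNP)%N & (iv s vNP < 4 * 4 ^ h)%N].
Proof.
rewrite /truncate evalS; set s1 := eval (vNN <~ _) s; set body := (X in eval (For _ _ X)) => -> n0.
set s2 := eval _ s1; set n := iv s vNP in n0 *.
pose P i (t : state R) := exists h, [/\ iv t vNN = (4 ^ h)%N, (4 ^ h <= n)%N & (n < 4 * 4 ^ h)%N || (i < 4 ^ h)%N].
have : P (iv s1 vNP) s2.
  apply: For_ind => [|i t hi ek sm [h [h1 h2 h3]]]; first by exists 0%N; rewrite expn0; split=> //; rewrite orbT.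
  have en : iv t vNP = n by fr sm.
  have c4 : (iv t vNN + iv t vNN + (iv t vNN + iv t vNN) = 4 * 4 ^ h)%N by rewrite h1; lia.
  rewrite /body !evalS; set q := eval (vC <~ Iadd vC vC) _.
  have cq : iv q vC = (4 * 4 ^ h)%N by rewrite /q; ev.
  have nq : iv q vNP = n by rewrite /q; ev.
  have Nq : iv q vNN = (4 ^ h)%N by rewrite /q; ev.
  clearbody q; rewrite /P evalIfI [evi _ _]/= [evi vC _]/= nq cq; case: ifP => lt.
    by exists h; rewrite lt; split=> //; ev.
  exists h.+1; rewrite expnS; split; [by ev|by rewrite leqNgt lt|].
  by move: h3; rewrite lt /= => h3; apply/orP; right; lia.
have -> : iv s1 vNP = n by [].
case=> h [h1 h2 /orP[h3|h3]]; exists h => //.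
by move: h2; rewrite leqNgt h3.
Qed.

Definition crossing (a b : nat -> R) u v := (a u - a v) / (b u - b v).

Lemma crossings_spec s s' fa fs : s' = eval (crossings fa fs) s ->
  [&& fa != fC, fs != fC, fa != fW & fs != fW] ->
  forall i, (i < iv s vNN)%N -> let c := crossing (ra s fa) (ra s fs) (ia s aU i) (ia s aV i) in
  ra s' fC i = c /\ ra s' fW i = c.
Proof.
rewrite /crossings; set body := (X in For _ _ X) => -> /and4P[n1 n2 n3 n4].
set s2 := eval _ s; pose cr i := crossing (ra s fa) (ra s fs) (ia s aU i) (ia s aV i).
pose P n (t : state R) := forall i, (i < n)%N -> ra t fC i = cr i /\ ra t fW i = cr i.
suff : P (iv s vNN) s2 by [].
apply: For_ind => // i t hi ek sm IH j; rewrite ltnS => ji.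
have ea : ra t fa = ra s fa by apply: (same_ra sm); rewrite /= !inE negb_or n1.
have es : ra t fs = ra s fs by apply: (same_ra sm); rewrite /= !inE negb_or n2.
rewrite /body; ev; rewrite ek ea es; fr sm.
have [->|ne] := eqVneq j i; first by [].
by apply: IH; rewrite ltn_neqAle ne.
Qed.

Lemma resolve_spec s s' fa fs (C := ra s fC) (sg := rv s rSG) (t := rv s rT)
   (res := fun i => sg * (C i - t) <= 0) (n := iv s vNN) (u := ia s aU) (v := ia s aV)
   (a := ra s fa) (b := ra s fs) :
  s' = eval (resolve fa fs) s -> [&& fa != fs, fa != fC & fs != fC] ->
  uniq (flat [seq (u i, v i) | i <- iota 0 n]) ->
  [/\ pairs s' = [seq (u i, v i) | i <- iota 0 n & res i],
    forall i, (i < n)%N -> res i -> let z := C i + sg in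
      let: w := if a (v i) - b (v i) * z < a (u i) - b (u i) * z then u i else v i in
      ra s' fa (v i) = a w /\ ra s' fs (v i) = b w &
    forall k, (forall i, (i < n)%N -> res i -> k <> v i) -> ra s' fa k = a k /\ ra s' fs k = b k].
Proof.
rewrite /resolve !evalS; set s1 := eval (vQ <~ _) s; set body := (X in eval (For _ _ X) _).
set s2 := eval _ s1 => -> /and3P[n1 n2 n3] un.
pose wn i := if a (v i) - b (v i) * (C i + sg) < a (u i) - b (u i) * (C i + sg) then u i else v i.
have vinj i j : (i < n)%N -> (j < n)%N -> v i = v j -> i = j.
  move: un; rewrite cat_uniq => /and3P[_ _]; rewrite /unzip2 -map_comp => /(uniqP 0%N) H hi hj e.
  have := H i j; rewrite !inE size_map size_iota => /(_ hi hj); apply.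
  by rewrite !(nth_map 0%N) ?size_iota //= !nth_iota.
(* A removed vertex is never a target, so its lines are still the original ones when they are
   read. *)
have uv i j : (i < n)%N -> (j < n)%N -> u i <> v j.
  move: un; rewrite cat_uniq => /and3P[_ /hasPn H _] hi hj e.
  have /H : v j \in unzip2 [seq (u i, v i) | i <- iota 0 n].
    by rewrite /unzip2 -map_comp; apply: map_f; rewrite mem_iota.
  by rewrite -e /unzip1 -map_comp => /negP; apply; apply: (map_f u); rewrite mem_iota.
pose P i (q : state R) := [/\ (iv q vQ <= i)%N,
  mkseq (fun i => (ia q aU i, ia q aV i)) (iv q vQ) = [seq (u x, v x) | x <- iota 0 i & res x],
  forall x, (i <= x)%N -> ia q aU x = u x /\ ia q aV x = v x,
  forall x, (x < i)%N -> res x -> ra q fa (v x) = a (wn x) /\ ra q fs (v x) = b (wn x) &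
  forall k, (forall x, (x < i)%N -> res x -> k <> v x) -> ra q fa k = a k /\ ra q fs k = b k].
have : P n s2.
  apply: (For_ind (P := P)) => [|i q hi ek sm [p1 p2 p3 p4 p5]]; first by split.
  have {}hi : (i < n)%N by [].
  rewrite /body !evalS; set q1 := eval (vV <~ _) _; set q2 := eval (rC <~r _) q1.
  have [eu ev'] := p3 i (leqnn _).
  have u2 : iv q2 vU = u i by rewrite /q2 /q1; ev; rewrite ek eu.
  have v2 : iv q2 vV = v i by rewrite /q2 /q1; ev; rewrite ek ev'.
  have c2 : rv q2 rC = C i.
    rewrite /q2 /q1; ev; rewrite ek (same_ra sm) //= !inE.
    by rewrite [fC == fa]eq_sym [fC == fs]eq_sym (negbTE n2) (negbTE n3).
  have F2 : same (vU <~ Ild aU vK;; vV <~ Ild aV vK;; rC <~r Rld fC vK) q q2 by exact: eval_same.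
  have ra2 x : ra q2 x = ra q x by [].
  have ia2 x : ia q2 x = ia q x by [].
  have ia2' : ia q2 = ia q by [].
  clearbody q2; rewrite evalIfR [evr _ _]/= [evr (Rmul _ _) _]/= c2 mulr0z.
  have -> : rv q2 rSG = sg by fr F2; fr sm.
  have -> : rv q2 rT = t by fr F2; fr sm.
  have ri : (0 < sg * (C i - t)) = ~~ res i by rewrite /res ltNge.
  rewrite ri; case: ifP => [nres|/negbFE resi].
    have nr : res i = false by apply: negbTE.
    have E x : ra (seti vK i.+1 (eval Skip q2)) x = ra q x by exact: ra2.
    have E' : iv (seti vK i.+1 (eval Skip q2)) vQ = iv q vQ by ev; fr F2.
    rewrite /P !E E'; split.
    - exact: leqW.
    - rewrite -[i.+1]addn1 iotaD filter_cat /= nr cats0 -p2.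
      by rewrite /mkseq; apply: eq_map => x; rewrite /= !ia2.
    - by move=> x /ltnW; rewrite /= !ia2; apply: p3.
    - by move=> x; rewrite ltnS leq_eqVlt => /orP[/eqP->|]; [rewrite nr|apply: p4].
    - by move=> k hk; apply: p5 => x xi; apply: hk; apply: leqW.
  rewrite evalS; set q3 := eval (rZ <~r _) q2.
  have [ua ub] : ra q fa (u i) = a (u i) /\ ra q fs (u i) = b (u i).
    by apply: p5 => x xi _; apply: uv => //; apply: ltn_trans hi.
  have [va vb] : ra q fa (v i) = a (v i) /\ ra q fs (v i) = b (v i).
    by apply: p5 => x xi _ /(vinj i x hi (ltn_trans xi hi)) e; rewrite e ltnn in xi.
  have z3 : rv q3 rZ = C i + sg by rewrite /q3; ev; rewrite c2; congr (_ + _); fr F2; fr sm.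
  have F3 : same (rZ <~r Radd rC rSG) q2 q3 by exact: eval_same.
  have u3 : iv q3 vU = u i by [].
  have v3 : iv q3 vV = v i by [].
  have ra3 x : ra q3 x = ra q x by exact: ra2.
  have ia3 : ia q3 = ia q by exact: ia2'.
  have iv3 : iv q3 = iv q2 by [].
  clearbody q3; rewrite evalS; set q4 := eval (IfR _ _ _ _) q3.
  have n1' : (fs == fa) = false by rewrite eq_sym (negbTE n1).
  have l4 k : ra q4 fa k = (if k == v i then a (wn i) else ra q fa k) /\
              ra q4 fs k = (if k == v i then b (wn i) else ra q fs k).
    have E : q4 = if a (v i) - b (v i) * (C i + sg) < a (u i) - b (u i) * (C i + sg) then
        eval (RSt fa vV (Rld fa vU);; RSt fs vV (Rld fs vU)) q3 else q3.
      by rewrite /q4 evalIfR /= z3 u3 v3 !ra3 ua ub va vb.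
    rewrite E /wn; case: ifP => _.
      ev; rewrite !eqxx ?n1' ?(negbTE n1) ?u3 ?v3 ?ra3 ?ua ?ub.
      by split.
    rewrite !ra3.
    by have [->|_] := eqVneq k (v i); rewrite ?va ?vb.
  have [i4 v4] : ia q4 = ia q /\ iv q4 = iv q2.
    by rewrite /q4 evalIfR; case: ifP => _; split=> //=; rewrite ?ia3 ?iv3.
  have k4 : iv q4 vK = i by rewrite v4; fr F2.
  have Q4 : iv q4 vQ = iv q vQ by rewrite v4; fr F2.
  clearbody q4; set q5 := eval _ q4.
  have E5 x : ra (seti vK i.+1 q5) x = ra q4 x by [].
  have eQ : iv (seti vK i.+1 q5) vQ = (iv q vQ).+1 by rewrite /q5; ev; rewrite Q4 addn1.
  have eU x : ia (seti vK i.+1 q5) aU x = if x == iv q vQ then u i else ia q aU x.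
    by rewrite /q5; ev; rewrite Q4 i4 v4 u2.
  have eV x : ia (seti vK i.+1 q5) aV x = if x == iv q vQ then v i else ia q aV x.
    by rewrite /q5; ev; rewrite Q4 i4 v4 v2.
  have eU' x : ia q5 aU x = if x == iv q vQ then u i else ia q aU x by exact: eU.
  have eV' x : ia q5 aV x = if x == iv q vQ then v i else ia q aV x by exact: eV.
  clearbody q5; rewrite /P eQ !E5; split.
  - by rewrite ltnS.
  - rewrite -[i.+1]addn1 iotaD filter_cat /= resi map_cat [map _ [:: _]]/= -p2 mkseqS cats1.
    congr rcons; last by rewrite /= eU' eV' eqxx.
    apply/eq_in_map => x; rewrite mem_iota add0n => /andP[_ lt].
    by rewrite /= eU' eV' ltn_eqF.
  - move=> x ix; rewrite eU eV gtn_eqF ?(leq_ltn_trans p1) //; apply: p3; exact: ltnW.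
  - move=> x; rewrite ltnS leq_eqVlt => /orP[/eqP-> _|xi rx].
      by have [-> ->] := l4 (v i); rewrite eqxx.
    have [-> ->] := l4 (v x); case: eqP => [e|_]; last exact: p4.
    by have e' := vinj x i (ltn_trans xi hi) hi e; rewrite e' ltnn in xi.
  - move=> k hk; have [-> ->] := l4 k; case: eqP => [e|_]; first by case: (hk i).
    by apply: p5 => x xi; apply: hk; apply: leqW.
by case=> _ p2 _ p4 p5; split.
Qed.

Lemma flat_subseq ps ps' : subseq ps ps' -> subseq (flat ps) (flat ps').
Proof. by move=> h; apply: cat_subseq; apply: map_subseq. Qed.

(** Truncation keeps more than a quarter of the pairs and a quarter of these is resolved, hence the
    16. From [d] up to the optimum the line chosen for a resolved pair is the larger one. *)
Lemma prune_spec s s' fa fs eps : s' = eval (prune fa fs) s ->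
  (fa, fs) = (fA, fS) \/ (fa, fs) = (fB, fT) ->
  inst_wf (inst_of s) -> opt (inst_of s) (rv s rE) eps -> (0 < iv s vNP)%N -> uniq (flat (pairs s)) ->
  exists2 d, d < eps & [/\ subseq (pairs s') (pairs s), (iv s vNP < 16 * iv s' vNP)%N,
    forall u v, (u, v) \in pairs s' -> (forall x, d <= x <= eps ->
        ra s fa u - ra s fs u * x <= ra s' fa v - ra s' fs v * x /\
        ra s fa v - ra s fs v * x <= ra s' fa v - ra s' fs v * x) /\
      exists2 w, w = u \/ w = v & ra s' fa v = ra s fa w /\ ra s' fs v = ra s fs w &
    forall k, k \notin unzip2 (pairs s') -> ra s' fa k = ra s fa k /\ ra s' fs k = ra s fs k].
Proof.
rewrite /prune (evalS truncate) (evalS (crossings _ _)) (evalS splitter) (evalS test).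
set s1 := eval truncate s; set s2 := eval (crossings fa fs) s1; set s3 := eval splitter s2.
set s4 := eval test s3 => ds Hf w op n0 un.
have [h [h1 h2 h3]] := truncate_spec (erefl s1) n0; set N := (4 ^ h)%N in h1 h2 h3.
have Nn1 : [&& fa != fC, fs != fC, fa != fW & fs != fW] by case: Hf => -[-> ->].
have Nn2 : [&& fa != fs, fa != fC & fs != fC] by case: Hf => -[-> ->].
have H2 := crossings_spec (erefl s2) Nn1; rewrite h1 in H2.
have F1 : same truncate s s1 by exact: eval_same.
have F2 : same (crossings fa fs) s1 s2 by exact: eval_same.
have F3 : same splitter s2 s3 by exact: eval_same.
have F4 : same test s3 s4 by exact: eval_same.
have N2 : iv s2 vNN = N by fr F2.
have H3 := splitter_spec (erefl s3) N2.
have I3 : inst_of s3 = inst_of s by rewrite /inst_of; fr F3; fr F2; fr F1.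
have E3 : rv s3 rE = rv s rE by fr F3; fr F2; fr F1.
have w3 : inst_wf (inst_of s3) by rewrite I3.
have [_ _ _ H4] := test_spec w3 (erefl s4).
have sd : side (rv s4 rSG) (rv s4 rT) eps.
  have -> : rv s4 rT = rv s3 rT by fr F4.
  move: H4; rewrite I3 E3 => -[[-> [f _]]|[-> nf]]; [left|right]; split=> //.
    exact/(opt_le _ w op).
  by rewrite ltNge; apply/negP => /(opt_le _ w op).
have Ea4 : ra s4 fa = ra s fa by case: Hf => -[-> _]; fr F4; fr F3; fr F2; fr F1.
have Es4 : ra s4 fs = ra s fs by case: Hf => -[_ ->]; fr F4; fr F3; fr F2; fr F1.
have Ea1 : ra s1 fa = ra s fa by case: Hf => -[-> _]; fr F1.
have Es1 : ra s1 fs = ra s fs by case: Hf => -[_ ->]; fr F1.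
have U4 : ia s4 aU = ia s aU by fr F4; fr F3; fr F2; fr F1.
have V4 : ia s4 aV = ia s aV by fr F4; fr F3; fr F2; fr F1.
have N4 : iv s4 vNN = N by fr F4; fr F3.
have C4 : ra s4 fC = ra s2 fC by fr F4; fr F3.
have T4 : rv s4 rT = rv s3 rT by fr F4.
pose pr i := (ia s aU i, ia s aV i).
have sub0 : subseq [seq pr i | i <- iota 0 N] (pairs s).
  by rewrite /pairs /mkseq -(subnKC h2) iotaD map_cat; apply: prefix_subseq.
have un4 : uniq (flat [seq (ia s4 aU i, ia s4 aV i) | i <- iota 0 (iv s4 vNN)]).
  by rewrite U4 V4 N4; apply: subseq_uniq un; apply: flat_subseq.
have := resolve_spec ds Nn2 un4; rewrite U4 V4 N4 Ea4 Es4.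
set res := (fun i => rv s4 rSG * (ra s4 fC i - rv s4 rT) <= 0) => -[r1 r2 r3].
have [d de near] := side_near sd.
exists d => //; have vin i : (i < N)%N -> res i -> ia s aV i \in unzip2 (pairs s').
  move=> hi ri; rewrite r1 /unzip2 -map_comp; apply: (map_f (fun i => ia s aV i)).
  by rewrite mem_filter ri mem_iota.
split.
- rewrite r1; apply: subseq_trans sub0; apply: map_subseq; exact: filter_subseq.
- have -> : iv s' vNP = count res (iota 0 N).
    by rewrite -size_filter -(size_map pr) -r1 size_mkseq.
  suff : (N <= 4 * count res (iota 0 N))%N by lia.
  have cW p : cnt p (ra s2 fW) 0 N = count (fun i => p (ra s4 fC i)) (iota 0 N).
    apply: eq_in_count => i; rewrite mem_iota add0n => /andP[_ hi].
    by have [] := H2 i hi; rewrite C4 => -> ->.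
  (* If the optimum is at most [t], the crossings from [t] on are resolved, otherwise those up to
     [t]; the splitting value leaves a quarter on either side. *)
  move: H3; rewrite !cW -T4 => -[ha hb]; case: sd => -[sgE _].
    apply: leq_trans hb _; rewrite leq_mul2l /=; apply: sub_count => i /=.
    by rewrite /res sgE mulN1r oppr_le0 subr_ge0.
  apply: leq_trans ha _; rewrite leq_mul2l /=; apply: sub_count => i /=.
  by rewrite /res sgE mul1r subr_le0.
- move=> u v; rewrite r1 => /mapP[i]; rewrite mem_filter mem_iota => /andP[ri /andP[_ hi]] [-> ->].
  have [] := r2 i hi ri; set z := ra s4 fC i + _; set wn := if _ then _ else _ => -> ->.
  split; last by exists wn => //; rewrite /wn; case: ifP; [left|right].
  move=> x hx; have [cE _] := H2 i hi; rewrite Ea1 Es1 in cE.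
  have sgx : 0 <= rv s4 rSG * (x - ra s4 fC i).
    have := near x hx; rewrite /res in ri; lra.
  have sg2 : rv s4 rSG * rv s4 rSG = 1 by case: sd => -[-> _]; rewrite ?mulrNN mulr1.
  have cE' : ra s4 fC i = crossing (ra s fa) (ra s fs) (ia s aU i) (ia s aV i).
    rewrite C4 cE; congr crossing; [by fr F1|by fr F1].
  rewrite /wn; case: ltP => le; split=> //.
    apply: (larger_line (sg := rv s4 rSG)) => //; first by apply: ltW; rewrite -[_ / _]cE'.
    by rewrite -[_ / _]cE'.
  (* The crossing does not depend on the order of the two lines. *)
  have cS : ra s4 fC i = (ra s fa (ia s aV i) - ra s fa (ia s aU i)) / (ra s fs (ia s aV i) - ra s fs (ia s aU i)).
    by rewrite cE' /crossing -[X in X / _]opprB -[X in _ / X]opprB invrN mulrNN.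
  by apply: (larger_line (sg := rv s4 rSG)) => //; rewrite -cS.
- move=> k hk; apply: r3 => i hi ri e; case/negP: hk; rewrite e; exact: vin.
Qed.

End Split.

(** * One round of prune and search *)

Section Round.
Variable R : realType.
Implicit Types s : state R.

(** Equality up to entries that no constraint reads: those beyond [sz] and the parent of the
    root. *)
Definition agree (I I' : inst R) := sz I = sz I' /\
  (forall k, (0 < k < sz I)%N -> par I k = par I' k) /\
  (forall k, (k < sz I)%N -> [/\ la I k = la I' k, ls I k = ls I' k, na I k = na I' k & ns I k = ns I' k]).

Lemma agree_iwf I I' : agree I I' -> inst_wf I -> inst_wf I'.
Proof.
move=> [e [hp hl]] [w1 w2 w3]; split=> [|k|k]; rewrite -e //.
  by move=> hk; rewrite -hp // w2.
by move=> hk; have [_ <- _ <-] := hl k hk; apply: w3.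
Qed.

Lemma agree_feas I I' e x : inst_wf I -> agree I I' -> feas I e x -> feas I' e x.
Proof.
move=> w [es [hp hl]] [ex [g [g1 g2]]]; split=> //; exists g; split=> k; rewrite -es => hk.
  by have [ea eb _ _] := hl k hk; have := g1 k hk; rewrite /lo_line ea eb.
have [_ _ ea eb] := hl (par I k) (par_lt w hk).
by have := g2 k hk; rewrite /up_line -hp // ea eb.
Qed.

Lemma agree_sym I I' : agree I I' -> agree I' I.
Proof.
move=> [e [hp hl]]; split=> //; rewrite -e; split=> [k hk|k hk]; first by rewrite hp.
by have [-> -> -> ->] := hl k hk.
Qed.

Lemma agree_opt I I' e eps : inst_wf I -> agree I I' -> opt I e eps -> opt I' e eps.
Proof.
move=> w ag [h1 h2]; split; first exact: agree_feas ag h1.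
by move=> x /h2 nf f; apply: nf; apply: agree_feas f; [exact: agree_iwf ag w|exact: agree_sym].
Qed.

Lemma mark_spec s s' m : s' = eval mark s -> uniq (flat (pairs s)) ->
  (forall k, (k < m)%N -> ia s aDEL k = 0%N) ->
  forall k, (k < m)%N -> ia s' aDEL k = if assoc (pairs s) k is Some v then v.+1 else 0%N.
Proof.
rewrite /mark => -> un d0; set s2 := eval _ s; set np := iv s vNP.
have un1 : uniq (unzip1 (pairs s)) by move: un; rewrite cat_uniq => /andP[].
pose P i (t : state R) := forall k, (k < m)%N ->
  [/\ forall j, (j < i)%N -> k = ia s aU j -> ia t aDEL k = (ia s aV j).+1 &
      (forall j, (j < i)%N -> k <> ia s aU j) -> ia t aDEL k = 0%N].
have uinj i j : (i < np)%N -> (j < np)%N -> ia s aU i = ia s aU j -> i = j.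
  move: un1; rewrite /unzip1 /pairs /mkseq -map_comp => /(uniqP 0%N) H hi hj e.
  have := H i j; rewrite !inE size_map size_iota => /(_ hi hj); apply.
  by rewrite !(nth_map 0%N) ?size_iota //= !nth_iota.
have : P np s2.
  apply: (For_ind (P := P)) => [k km|i t hi ek sm IH k km]; first by split=> // _; apply: d0.
  have [h1 h2] := IH k km; ev; rewrite ek addn1; fr sm.
  have [kE|kE] := eqVneq k (ia s aU i); split.
  - move=> j; rewrite ltnS leq_eqVlt => /orP[/eqP->//|ji] e.
    have e' := uinj j i (ltn_trans ji hi) hi (etrans (esym e) kE).
    by rewrite e' ltnn in ji.
  - by move=> H; case: (H i).
  - move=> j; rewrite ltnS leq_eqVlt => /orP[/eqP->|]; last exact: h1.
    by move=> e; rewrite e eqxx in kE.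
  - by move=> H; apply: h2 => j ji; apply: H; apply: leqW.
move=> H k km; have [h1 h2] := H k km.
case E: (assoc (pairs s) k) => [v|].
  by move/(assocP _ _ un1)/pairsP: E => [j hj [kE ->]]; apply: (h1 j).
apply: h2 => j hj kE.
have : (k, ia s aV j) \in pairs s by apply/pairsP; exists j; rewrite // kE.
by move/(assocP _ _ un1); rewrite E.
Qed.

Lemma compact_spec s s' (I := inst_of s) (tg : nat -> option nat) : s' = eval compact s -> inst_wf I ->
  (forall k, (k < sz I)%N -> ia s aDEL k = if tg k is Some v then v.+1 else 0%N) ->
  (forall k v, tg k = Some v -> (v < k)%N /\ tg v = None) ->
  agree (contract (sz I) tg I (na I) (ns I)) (inst_of s').
Proof.
rewrite /compact !evalS; set s1 := eval (vQ <~ _) s; set body := (X in eval (For _ _ X) s1).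
set s2 := eval _ s1 => ds w dE tgP; pose m := sz I; have [m0 pl _] := w.
have tv k v : tg k = Some v -> target tg k = v by rewrite /target => ->.
have tN k : tg k = None -> target tg k = k by rewrite /target => ->.
have tle k : (target tg k <= k)%N.
  by rewrite /target; case E: (tg k) => [v|] //=; have [/ltnW] := tgP _ _ E.
pose kap := nth 0%N (survivors m tg).
have rankS i : rank tg i.+1 = (rank tg i + alive tg i)%N.
  by rewrite /rank -addn1 iotaD count_cat /= addn0.
have rank_le i : (rank tg i <= i)%N.
  by rewrite -[leqRHS](size_iota 0); apply: count_size.
(* The last clause says that nothing from position [i] on has been overwritten; it persists because
   [rank tg i <= i]. *)
pose P i (t : state R) := [/\ iv t vQ = rank tg i,
  forall k, (k < i)%N -> ia t aNU k = rank tg (target tg k),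
  forall x, (x < rank tg i)%N -> [/\ (0 < kap x)%N -> ia t aPAR x = rank tg (target tg (par I (kap x))),
     ra t fA x = la I (kap x), ra t fS x = ls I (kap x), ra t fB x = na I (kap x) & ra t fT x = ns I (kap x)] &
  forall x, (i <= x)%N -> [/\ ia t aPAR x = par I x,
     ra t fA x = la I x, ra t fS x = ls I x, ra t fB x = na I x & ra t fT x = ns I x]].
have : P m s2.
  have LL : iv s1 vM = m by [].
  rewrite -[X in P X]LL; apply: (For_ind (P := P)) => [|i t hi ek sm [p1 p2 p3 p4]]; first by split.
  have {}hi : (i < m)%N by [].
  have dt : ia t aDEL = ia s aDEL by fr sm.
  clear sm; rewrite /body evalIfI [evi _ _]/= [evi (Ild _ _) _]/= ek dt dE //.
  case E: (tg i) => [v|].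
    have [vi tv0] := tgP _ _ E; rewrite ltn0Sn.
    have nal : alive tg i = false by rewrite /alive E.
    rewrite /P rankS nal addn0; split.
    - by ev.
    - move=> k; rewrite ltnS leq_eqVlt; ev; rewrite ek dt dE // E subn1 /=.
      by have [->|ne] := eqVneq k i; [rewrite p2 // (tv _ _ E) (tN v)|apply: p2].
    - exact: p3.
    - by move=> x /ltnW; apply: p4.
  have al : alive tg i by rewrite /alive E.
  have [rl kr] := nth_survivors hi al.
  rewrite ltnn; set t' := eval _ t.
  have q1 : iv t' vQ = (rank tg i).+1 by rewrite /t'; ev; rewrite p1 addn1.
  have ri := rank_le i.
  have [l1 l2 l3 l4 l5] := p4 i (leqnn _).
  have q2 k : ia t' aNU k = if k == i then rank tg i else ia t aNU k by rewrite /t'; ev; rewrite ek p1.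
  have q3 x : (0 < i)%N -> ia t' aPAR x = if x == rank tg i then rank tg (target tg (par I i)) else ia t aPAR x.
    move=> i0; have pi : (par I i < i)%N by apply: pl; rewrite i0.
    rewrite /t'; ev; rewrite ek p1 l1; case: eqP => // _.
    by rewrite (ltn_eqF pi) p2.
  have q3' x : x != rank tg i -> ia t' aPAR x = ia t aPAR x.
    by rewrite /t'; ev; rewrite p1 => /negbTE ->.
  have q4 x : ra t' fA x = if x == rank tg i then la I i else ra t fA x by rewrite /t'; ev; rewrite p1 ek l2.
  have q5 x : ra t' fS x = if x == rank tg i then ls I i else ra t fS x by rewrite /t'; ev; rewrite p1 ek l3.
  have q6 x : ra t' fB x = if x == rank tg i then na I i else ra t fB x by rewrite /t'; ev; rewrite p1 ek l4.
  have q7 x : ra t' fT x = if x == rank tg i then ns I i else ra t fT x by rewrite /t'; ev; rewrite p1 ek l5.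
  seal t'; rewrite /P rankS al addn1; split.
  - by ev.
  - move=> k; rewrite ltnS leq_eqVlt [ia _ _ _](q2 k).
    by have [->|ne] := eqVneq k i; [rewrite tN|apply: p2].
  - move=> x; rewrite ltnS leq_eqVlt [ra _ fA _](q4 x) [ra _ fS _](q5 x) [ra _ fB _](q6 x) [ra _ fT _](q7 x).
    have [->|ne] := eqVneq x (rank tg i).
      rewrite /kap kr; split=> // i0.
      by rewrite [ia _ _ _](q3 _ i0) eqxx.
    by move=> xl; have [a1 a2 a3 a4 a5] := p3 x xl; split=> // k0; rewrite [ia _ _ _]q3' // a1.
  - move=> x ix; rewrite [ra _ fA _](q4 x) [ra _ fS _](q5 x) [ra _ fB _](q6 x) [ra _ fT _](q7 x).
    have ne : x != rank tg i by rewrite gtn_eqF // (leq_ltn_trans ri).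
    by rewrite [ia _ _ _]q3' // (negbTE ne); apply: p4; apply: ltnW.
have szE : size (survivors m tg) = rank tg m by rewrite size_filter.
have F : iv s' vM = iv s2 vQ by rewrite ds.
have Fa x : ra s' x = ra s2 x by rewrite ds.
have Fi x : ia s' x = ia s2 x by rewrite ds.
clear ds; seal s2; case: H => p1 p2 p3 _.
split; first by rewrite /= szE F p1.
split=> /= k; rewrite szE => hk; last first.
  by rewrite !Fa; have [_ -> -> -> ->] := p3 k hk.
rewrite Fi; have /andP[k0 kl] := hk; have [-> //] := p3 k kl.
rewrite -szE in kl; have [_ _ rk] := survivors_rank kl.
by rewrite lt0n; apply: contraL k0 => /eqP e; rewrite -rk -/(kap k) e.
Qed.

Lemma src_none ps v : uniq (unzip2 ps) -> src ps v = None -> v \notin unzip2 ps.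
Proof.
move=> un e; apply/negP => /mapP[[u v'] h /= ve]; subst v'.
by move/(srcP _ _ un): h; rewrite e.
Qed.

Lemma uniq_flatE ps : uniq (flat ps) -> uniq (unzip1 ps) /\ uniq (unzip2 ps).
Proof. by rewrite cat_uniq => /and3P[-> _ ->]. Qed.

Lemma size_survivors m ps : uniq (unzip1 ps) -> (forall p, p \in ps -> (p.1 < m)%N) ->
  (size (survivors m (assoc ps)) + size ps = m)%N.
Proof.
move=> un lt; rewrite -[RHS](size_iota 0) -[RHS](count_predC (alive (assoc ps))) /survivors size_filter; congr (_ + _)%N.
rewrite -(size_map fst) -/(unzip1 ps) -size_filter; apply: perm_size; apply: uniq_perm => //.
  by rewrite filter_uniq ?iota_uniq.
move=> k; rewrite mem_filter mem_iota add0n /= /alive /assoc; case: ifP => kin /=; last by [].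
by have /mapP[p /lt pm ->] := kin; rewrite pm.
Qed.

Lemma same_inst c s s' : same c s s' ->
  (vM \notin mod_iv c) && (aPAR \notin mod_ia c) && (fA \notin mod_ra c) && (fS \notin mod_ra c)
    && (fB \notin mod_ra c) && (fT \notin mod_ra c) -> inst_of s' = inst_of s.
Proof.
move=> F /andP[/andP[/andP[/andP[/andP[h1 h2] h3] h4] h5] h6].
by rewrite /inst_of (same_iv F) // (same_ia F) // !(same_ra F).
Qed.

Lemma same_eval c s s' : s' = eval c s -> same c s s'.
Proof. by move=> ->; exact: eval_same. Qed.

Lemma same_pairs c s s' : same c s s' ->
  (vNP \notin mod_iv c) && (aU \notin mod_ia c) && (aV \notin mod_ia c) -> pairs s' = pairs s.
Proof.
by move=> F /andP[/andP[h1 h2] h3]; rewrite /pairs (same_iv F) // !(same_ia F).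
Qed.

(** The intermediate states are variables tied by equations, which keeps them opaque. *)
Lemma round_steps s s1 s2 s3 s4 s5 s6 s' eps :
  s1 = eval prepare s -> s2 = eval matching s1 -> s3 = eval raise s2 ->
  s4 = eval (prune fA fS) s3 -> s5 = eval (prune fB fT) s4 -> s6 = eval mark s5 ->
  s' = eval compact s6 ->
  inst_wf (inst_of s) -> (1 < iv s vM)%N -> opt (inst_of s) (rv s rE) eps ->
  [/\ inst_wf (inst_of s'), opt (inst_of s') (rv s' rE) eps, (iv s' vM <= iv s vM)%N &
      (iv s vM <= 1536 * (iv s vM - iv s' vM))%N].
Proof.
move=> D1 D2 D3 D4 D5 D6 D7 w m1 op; set m := iv s vM in m1 *.
have F1 := same_eval D1; have F2 := same_eval D2; have F3 := same_eval D3.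
have F4 := same_eval D4; have F5 := same_eval D5; have F6 := same_eval D6; have F7 := same_eval D7.
have [w1 lu1 f1 sz1 pr1] := prepare_spec D1 w.
set I1 := inst_of s1 in w1 lu1 f1 sz1 pr1.
have {}sz1 : sz I1 = m by exact: sz1.
have M1 : iv s1 vM = m by exact: sz1.
have E1 : rv s1 rE = rv s rE by fr F1.
have op1 : opt I1 (rv s1 rE) eps.
  by rewrite E1; case: op => [a b]; split; [exact/f1|move=> x /b nf /f1].
have m1' : (1 < sz I1)%N by rewrite sz1.
have pr1' k : (k < sz I1)%N -> ia s1 aCH k = num_children I1 k /\ ia s1 aPEND k = 0%N.
  by rewrite sz1 => km; have [] := pr1 m1 k km.
have [mg un2 np2] := matching_spec D2 w1 m1' pr1'.
have I2 : inst_of s2 = I1 by exact: same_inst F2 isT.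
have [e23 [cr3 min3]] := raise_spec D3; rewrite I2 in cr3 min3.
have I3 : inst_of s3 = I1 by rewrite (same_inst F3 isT).
have P3 : pairs s3 = pairs s2 by exact: same_pairs F3 isT.
have E2 : rv s2 rE = rv s1 rE by fr F2.
rewrite E2 in e23 min3.
have op3 : opt I1 (rv s3 rE) eps.
  have fE x := feas_raise x w1 lu1 mg e23 min3.
  by case: op1 => [a b]; split; [exact/fE|move=> x /b nf /fE].
have np3 : (0 < iv s3 vNP)%N.
  have -> : iv s3 vNP = iv s2 vNP by fr F3.
  by move: np2; rewrite -/(sz I1) sz1 -/m; lia.
have un3 : uniq (flat (pairs s3)) by rewrite P3.
have w3 : inst_wf (inst_of s3) by rewrite I3.
have op3' : opt (inst_of s3) (rv s3 rE) eps by rewrite I3.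
have [d4 d4e [sub4 np4 win4 same4]] := prune_spec D4 (or_introl erefl) w3 op3' np3 un3.
have Epar4 : par (inst_of s4) = par I1 by rewrite -I3 /=; fr F4.
have Esz4 : sz (inst_of s4) = m by rewrite -M1 -[iv s1 vM]/(sz I1) -I3 /=; fr F4.
have Ena4 : na (inst_of s4) = na I1 by rewrite -I3 /=; fr F4.
have Ens4 : ns (inst_of s4) = ns I1 by rewrite -I3 /=; fr F4.
have Ela3 : ra s3 fA = la I1 by rewrite -I3.
have Els3 : ra s3 fS = ls I1 by rewrite -I3.
rewrite Ela3 Els3 in win4 same4.
set I4 := inst_of s4 in Epar4 Esz4 Ena4 Ens4.
have I4E : I4 = Inst (sz I1) (par I1) (la I4) (ls I4) (na I1) (ns I1).
  by rewrite sz1 -/m -Esz4 -Epar4 -Ena4 -Ens4.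
set ps4 := pairs s4 in sub4 win4 same4.
have un4 : uniq (flat ps4) by apply: subseq_uniq un3; apply: flat_subseq.
have [un41 un42] := uniq_flatE un4.
have mg4 u v : (u, v) \in ps4 -> mergeable I1 u v.
  by move=> h; have := mem_subseq sub4 h; rewrite P3 => /mg.
have sl4 k : (k < m)%N -> 0 < ra s4 fS k.
  move=> km; have [_ _ sl] := w1; rewrite sz1 in sl.
  have [kin|knin] := boolP (k \in unzip2 ps4); last first.
    by have [_ ->] := same4 k knin; have [] := sl k km.
  case/mapP: kin => -[u v] h /= kv; subst v.
  have [_ [z zE [_ ->]]] := win4 _ _ h; have [vu um _] := mg4 _ _ h.
  rewrite sz1 in um; case: zE => ->; [by have [] := sl u um|by have [] := sl k km].
have w4 : inst_wf I4.
  have [a1 a2 a3] := w1; rewrite I4E; split=> //= k km; split; first by apply: sl4; rewrite -sz1.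
  by have [] := a3 k km.
have E4 : rv s4 rE = rv s3 rE by fr F4.
have op4 : opt I4 (rv s4 rE) eps.
  rewrite E4; apply: (opt_near w1 w4 d4e _ op3) => x hx.
  rewrite I4E; apply: (feas_lower _ w1 (pairing_of un4)).
  - by move=> u v /(assocP _ _ un41) /mg4.
  - by move=> v /(src_none un42); apply: same4.
  - move=> u v /(assocP _ _ un41) h; have [h1 [z zE [h2 h3]]] := win4 _ _ h.
    by have [h4 h5] := h1 x hx; split=> //; case: zE h2 h3 => -> h2 h3; [left|right].
have np40 : (0 < iv s4 vNP)%N by lia.
(* A pair resolved only for the lower lines stays unmerged; by [feas_lower], the changed lower line
   of its target does no harm. *)
have [d5 d5e [sub5 np5 win5 same5]] := prune_spec D5 (or_intror erefl) w4 op4 np40 un4.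
set ps5 := pairs s5 in sub5 win5 same5.
have un5 : uniq (flat ps5) by apply: subseq_uniq un4; apply: flat_subseq.
have [un51 un52] := uniq_flatE un5.
have mg5 u v : (u, v) \in ps5 -> mergeable I4 u v.
  by move=> h; have := mg4 _ _ (mem_subseq sub5 h); rewrite I4E.
have I5E : inst_of s5 = Inst m (par I4) (la I4) (ls I4) (ra s5 fB) (ra s5 fT).
  by rewrite /inst_of; fr F5; rewrite -Esz4.
have I6 : inst_of s6 = inst_of s5 by exact: same_inst F6 isT.
have D5z k : (k < m)%N -> ia s5 aDEL k = 0%N.
  by move=> km; fr F5; fr F4; fr F3; fr F2; have [] := pr1 m1 k km.
have D6E := mark_spec D6 un5 D5z.
pose tg := assoc ps5.
have tgP u v : tg u = Some v -> mergeable I4 u v by move/(assocP _ _ un51)/mg5.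
have pr5 := pairing_of un5.
have sl5 k : (k < m)%N -> 0 < ra s5 fT k.
  move=> km; have [_ _ sl] := w4; rewrite Esz4 in sl.
  have [kin|knin] := boolP (k \in unzip2 ps5); last first.
    by have [_ ->] := same5 k knin; have [] := sl k km.
  case/mapP: kin => -[u v] h /= kv; subst v.
  have [_ [z zE [_ ->]]] := win5 _ _ h; have [vu um _] := mg5 _ _ h.
  rewrite Esz4 in um; case: zE => ->; [by have [] := sl u um|by have [] := sl k km].
have w6 : inst_wf (inst_of s6).
  rewrite I6 I5E; have [a1 a2 a3] := w4; rewrite Esz4 in a1 a2 a3.
  split=> //= k km; split; last exact: sl5.
  by have [] := a3 k km.
have ag : agree (contract m tg (inst_of s6) (na (inst_of s6)) (ns (inst_of s6))) (inst_of s').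
  have -> : m = sz (inst_of s6) by rewrite I6 I5E.
  apply: (compact_spec D7 w6) => [k|k v].
    by rewrite I6 I5E /= => km; apply: D6E.
  by move=> h; have [vu _ _] := tgP _ _ h; split=> //; have [_ /(_ _ _ h)[]] := pr5.
have cE : contract m tg (inst_of s6) (na (inst_of s6)) (ns (inst_of s6)) =
    contract m tg I4 (ra s5 fB) (ra s5 fT).
  by rewrite I6 I5E.
rewrite cE in ag.
have wc : inst_wf (contract m tg I4 (ra s5 fB) (ra s5 fT)).
  by rewrite -Esz4; apply: (contract_wf _ w4 pr5 tgP) => k km _; apply: sl5; rewrite -Esz4.
have E7 : rv s' rE = rv s4 rE by fr F7; fr F6; fr F5.
have near : exists2 d, d < eps & forall x, d <= x <= eps ->
    (forall u v, (u, v) \in ps4 -> lo_line I1 u x <= lo_line I4 v x) /\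
    forall u v, (u, v) \in ps5 -> up_line I4 u x <= ra s5 fB v - ra s5 fT v * x /\
       up_line I4 v x <= ra s5 fB v - ra s5 fT v * x.
  exists (Num.max d4 d5); first by rewrite gt_max d4e d5e.
  move=> x; rewrite ge_max => /andP[/andP[h4 h5] hx]; split=> u v h.
    by have [/(_ x)] := win4 _ _ h; rewrite h4 hx => /(_ isT)[].
  by have [/(_ x)] := win5 _ _ h; rewrite h5 hx => /(_ isT).
have [d de nr] := near.
have ops : opt (contract m tg I4 (ra s5 fB) (ra s5 fT)) (rv s4 rE) eps.
  apply: (opt_near w4 wc de _ op4) => x hx; have [n1 n2] := nr x hx; rewrite -Esz4.
  have lfE k : leaf I4 k <-> leaf I1 k by rewrite /leaf Esz4 Epar4 sz1.
  have upE k : up_line I4 k x = up_line I1 k x by rewrite /up_line Ena4 Ens4.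
  (* Pruning changes the lower lines of targets only, and [u] is none. *)
  have src_same u v : (u, v) \in ps4 -> lo_line I4 u x = lo_line I1 u x.
    move=> h; have un : u \notin unzip2 ps4.
      move: un4; rewrite cat_uniq => /and3P[_ /hasPn H _]; apply/negP => /H /negP; apply.
      exact: (map_f fst h).
    by have [ea eb] := same4 u un; rewrite /lo_line; congr (_ - _ * _).
  apply: (feas_contract w4 pr5 tgP).
  - move=> k; rewrite Esz4 => hk /lfE lk y.
    have := lu1 k; rewrite sz1 => /(_ hk lk y).
    by rewrite /up_line Ena4 Ens4 Epar4.
  - by move=> v /(src_none un52); apply: same5.
  - move=> u v /(assocP _ _ un51) h; have [_ [z zE [h2 h3]]] := win5 _ _ h.
    by have [h4 h5] := n2 _ _ h; split=> //; case: zE h2 h3 => -> h2 h3; [left|right].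
  - move=> u v /(assocP _ _ un51) /(mem_subseq sub5) h.
    by rewrite (src_same _ _ h); apply: n1.
  - move=> u v /(assocP _ _ un51) /(mem_subseq sub5) h ex.
    have hmg := mg4 _ _ h; have [vu um _] := hmg.
    rewrite (src_same _ _ h) upE -cross_le //; last exact: ltn_trans um.
    apply: le_trans ex; rewrite E4.
    by apply: (cr3 (u, v)); rewrite -P3; apply: mem_subseq sub4 _ h.
have M' : iv s' vM = size (survivors m tg) by case: ag => h _; exact: (esym h).
have Ms : (size (survivors m tg) + size ps5 = m)%N.
  by apply: size_survivors un51 _ => -[u v] /mg5[_]; rewrite Esz4.
have sp5 : size ps5 = iv s5 vNP by rewrite size_mkseq.
have sp4 : iv s3 vNP = iv s2 vNP by fr F3.
rewrite sz1 in np2.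
have ops' : opt (inst_of s') (rv s' rE) eps by rewrite E7; apply: agree_opt ops.
split=> //; [exact: agree_iwf ag wc|by rewrite M' -[X in (_ <= X)%N]Ms leq_addr|].
rewrite -/m M' -{2}Ms addKn.
have : (iv s5 vNP * 1536 >= m)%N.
  by move: np5 np4 np2; rewrite sp4; clear; lia.
by rewrite sp5 mulnC.
Qed.

(* [1536 = 6 * 16 * 16]: at least [m / 6] pairs are found, of which truncation to a power of 4
   and the quarter that is resolved leave at least one in 16, for both kinds of lines. *)
Lemma round_spec s s' eps : s' = eval round s ->
  inst_wf (inst_of s) -> (1 < iv s vM)%N -> opt (inst_of s) (rv s rE) eps ->
  [/\ inst_wf (inst_of s'), opt (inst_of s') (rv s' rE) eps, (iv s' vM <= iv s vM)%N &
      (iv s vM <= 1536 * (iv s vM - iv s' vM))%N].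
Proof.
rewrite /round (evalS prepare) (evalS matching) (evalS raise) (evalS (prune _ _)).
rewrite (evalS (prune _ _)) (evalS mark) => D.
exact: (round_steps erefl erefl erefl erefl erefl erefl D).
Qed.

End Round.

(** * Existence of a least feasible error *)

Section Exists.
Variable R : realType.

(* Lower bounds are given by several lines per vertex, so that the last vertex, which is a
   leaf, can be eliminated by moving its lines to its parent. *)
Lemma finite_constraints (I : inst R) m (L : nat -> seq (R * R)) :
  (forall k, (0 < k < m)%N -> (par I k < k)%N) ->
  (forall k, (k < m)%N -> 0 < ns I k) -> (forall k, all (fun l => 0 < l.2) (L k)) ->
  exists cs : seq R, forall x, (exists g : nat -> R,
     (forall k l, (k < m)%N -> l \in L k -> l.1 - l.2 * x <= g k) /\
     (forall k, (0 < k < m)%N -> g k <= g (par I k) /\ g k + up_line I (par I k) x <= 0)) <->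
   forall c, c \in cs -> c <= x.
Proof.
elim: m L => [|m IH] L pl np lp.
  by exists [::] => x; split=> // _; exists (fun=> 0); split=> // k; rewrite ltn0 ?andbF.
have [m0|m0] := posnP m.
  exists [::] => x; split=> // _; rewrite m0.
  (* With the root alone there are only lower bounds, and any common upper bound of them serves; the
     default 0 does not hurt. *)
  exists (fun k => \big[Num.max/0]_(l <- L k) (l.1 - l.2 * x)); split=> [k l _ lL|k]; last by lia.
  exact: (le_bigmax_seq 0 l xpredT (fun l => l.1 - l.2 * x)).
pose p := par I m; have pm : (p < m)%N by apply: pl; rewrite m0 /=.
pose L' k := if k == p then L p ++ L m else L k.
have lp' k : all (fun l => 0 < l.2) (L' k).
  by rewrite /L'; case: eqP => _; rewrite ?all_cat ?lp.
have [cs H] := IH L' (fun k hk => pl k (introT andP (conj (andP hk).1 (leqW (andP hk).2))))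
   (fun k hk => np k (leqW hk)) lp'.
exists (cs ++ [seq (l.1 + na I p) / (l.2 + ns I p) | l <- L m]) => x.
have cE l : l \in L m -> ((l.1 + na I p) / (l.2 + ns I p) <= x) = (l.1 - l.2 * x + up_line I p x <= 0).
  move=> lL; have h1 := allP (lp m) _ lL; have h2 := np p (leqW pm).
  by rewrite ler_pdivrMr ?addr_gt0 // /up_line; apply/idP/idP; lra.
split.
  case=> g [g1 g2] c; rewrite mem_cat => /orP[|/mapP[l lL ->]].
    move: c; apply/H; exists g; split=> [k l km|k /andP[k0 km]]; last by apply: g2; rewrite k0 leqW.
    rewrite /L'; case: eqP => [->|_]; last by apply: g1; rewrite leqW.
    rewrite mem_cat => /orP[lL|lL]; first by apply: g1; rewrite // leqW.
    apply: le_trans (g1 m l (leqnn _) lL) _.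
    by have [] := g2 m; rewrite ?m0 ?ltnSn.
  have [] := g2 m; rewrite ?m0 ?ltnSn // => _ h; rewrite cE //.
  by have := g1 m l (leqnn _) lL; rewrite -/p in h; lra.
move=> hc; have /H[g [g1 g2]] : forall c, c \in cs -> c <= x.
  by move=> c h; apply: hc; rewrite mem_cat h.
(* The eliminated leaf gets the largest value its parent allows. *)
pose g' k := if k == m then Num.min (g p) (- up_line I p x) else g k.
have gE k : (k < m)%N -> g' k = g k by rewrite /g' => /ltn_eqF ->.
exists g'; split=> [k l|k /andP[k0]]; rewrite ltnS leq_eqVlt => /orP[/eqP->|km].
- move=> lL; rewrite /g' eqxx le_min; apply/andP; split.
    by apply: g1 => //; rewrite /L' eqxx mem_cat lL orbT.
  have : (l.1 + na I p) / (l.2 + ns I p) <= x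
    by apply: hc; rewrite mem_cat (map_f (fun l => (l.1 + na I p) / (l.2 + ns I p)) lL) orbT.
  by rewrite cE //; lra.
- by move=> lL; rewrite gE //; apply: g1 => //; rewrite /L'; case: eqP lL => // -> lL; rewrite mem_cat lL.
- rewrite -/p (gE p pm) /g' eqxx; split; first by rewrite ge_min lexx.
  have : Num.min (g p) (- up_line I p x) <= - up_line I p x by rewrite ge_min lexx orbT.
  by lra.
- have pk : (par I k < m)%N by exact: ltn_trans (pl k (introT andP (conj k0 (leqW km)))) km.
  by rewrite (gE k km) (gE _ pk); apply: g2; rewrite k0.
Qed.

(** Feasibility amounts to finitely many conditions of the form [c <= x], so the least feasible
    value is a maximum. *)
Lemma opt_exists (I : inst R) e : inst_wf I -> exists eps, opt I e eps.
Proof.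
move=> w; have [m0 pl sl] := w.
have h2 k : (k < sz I)%N -> 0 < ns I k by move=> /sl[].
(* The filter discards lines beyond [sz I], whose slopes need not be positive. *)
have h3 k : all (fun l => 0 < l.2) [seq l <- [:: (la I k, ls I k)] | 0 < l.2].
  by rewrite filter_all.
have [cs H] := finite_constraints pl h2 h3.
have fE x : feas I e x <-> e <= x /\ forall c, c \in cs -> c <= x.
  rewrite -H; split=> -[ex [g [g1 g2]]]; split=> //; exists g; split=> // k.
    by move=> l km; rewrite mem_filter inE => /andP[_ /eqP->]; apply: g1.
  move=> km; apply: (g1 k (la I k, ls I k) km).
  by rewrite mem_filter inE eqxx andbT; have [] := sl k km.
exists (\big[Num.max/e]_(c <- cs) c); split.
  apply/fE; split; first exact: bigmax_ge_id.
  by move=> c cin; apply: (le_bigmax_seq e c xpredT id).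
move=> x; apply: contraPnot => /fE[h1 h4]; apply/negP; rewrite -leNgt.
by rewrite big_seq_cond; apply: bigmax_le => // c /andP[cin _]; apply: h4.
Qed.

End Exists.

(** * Correctness *)

Section Topo.
Variable R : realType.
Implicit Types s t : state R.

Lemma count_sum (T : Type) (a : pred T) r : count a r = (\sum_(u <- r) a u)%N.
Proof. by elim: r => [|x r IH]; rewrite ?big_nil ?big_cons //= IH. Qed.

Lemma iotaS i : iota 0 i.+1 = iota 0 i ++ [:: i].
Proof. by rewrite -addn1 iotaD. Qed.

(** The queue grows downwards from cell [n - 1], which turns the order of removal, children first,
    into one with parents first. *)
Definition queue n q t := [/\ iv t vF = (n - size q)%N, (size q <= n)%N, uniq q,
  forall v, v \in q -> (v < n)%N &
  forall i, (i < size q)%N -> ia t aQ (n - 1 - i)%N = nth 0%N q i /\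
    ia t aPOS (nth 0%N q i) = (n - 1 - i)%N].

Definition enqueue x := vF <~ Isub vF (Ic 1);; ISt aQ vF (Iv x);; ISt aPOS (Iv x) vF.

Lemma enqueue_spec n q t x v : queue n q t -> (v < n)%N -> v \notin q -> iv t x = v -> x != vF ->
  queue n (rcons q v) (eval (enqueue x) t).
Proof.
case=> h1 h2 h3 h4 h5 vn vq ex xF.
have un : uniq (rcons q v) by rewrite rcons_uniq vq.
have mem w : w \in rcons q v -> (w < n)%N by rewrite mem_rcons inE => /orP[/eqP->//|/h4].
have sz : (size (rcons q v) <= n)%N.
  rewrite -[leqRHS](size_iota 0); apply: uniq_leq_size => // w /mem wn.
  by rewrite mem_iota.
rewrite size_rcons in sz; split; rewrite ?size_rcons //.
  by rewrite /enqueue; ev; rewrite h1 subn1 subnS.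
move=> i; rewrite ltnS leq_eqVlt nth_rcons /enqueue => iq; ev; rewrite (negbTE xF) h1 ex.
case/orP: iq => [/eqP->|iq].
  have -> : (n - size q - 1 = n - 1 - size q)%N by lia.
  by rewrite ltnn !eqxx.
rewrite iq; have [-> ->] := h5 i iq.
have -> : (n - 1 - i == n - size q - 1)%N = false by apply/negbTE/eqP; lia.
have -> : (nth 0%N q i == v) = false.
  by apply/negbTE/eqP => e; move: vq; rewrite -e mem_nth.
by [].
Qed.

(** The function [dep] witnesses that the parent pointers are acyclic. *)
Lemma topo_spec s s' n (dep : nat -> nat) (raw := iraw s) : s' = eval topo s ->
  iv s vN = n -> bnd s = (n + n)%N -> (forall k, (k < n)%N -> ia s aCH k = 0%N) ->
  (forall v p, (v < n)%N -> raw v = p.+1 -> (p < n)%N /\ (dep p < dep v)%N) ->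
  [/\ forall k, (k < n)%N -> (ia s' aQ k < n)%N /\ ia s' aPOS (ia s' aQ k) = k,
      forall v, (v < n)%N -> (ia s' aPOS v < n)%N /\ ia s' aQ (ia s' aPOS v) = v &
      forall v p, (v < n)%N -> raw v = p.+1 -> (ia s' aPOS p < ia s' aPOS v)%N].
Proof.
rewrite /topo !evalS; set body1 := (X in eval (For _ _ X) s); set s1 := eval (For _ _ body1) s.
set s2 := eval (vF <~ _) s1; set body3 := (X in eval (For _ _ X) s2); set s3 := eval (For _ _ body3) s2.
set body4 := (X in eval (For _ _ X) s3); set s4 := eval (For _ _ body4) s3 => -> nE bE ch0 val.
have rawE t x : iraw t = raw -> bnd t = (n + n)%N -> (iv t x < n)%N -> evi (Iraw (Iv x)) t = raw (iv t x).
  by move=> e1 e2 e3 /=; rewrite e1 e2 (leq_trans e3) // leq_addr.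
pose nc v := count (fun u => raw u == v.+1) (iota 0 n).
have H1 v : (v < n)%N -> ia s1 aCH v = nc v.
  pose P i t := forall v, (v < n)%N -> ia t aCH v = count (fun u => raw u == v.+1) (iota 0 i).
  suff : P n s1 by apply.
  rewrite -nE; apply: (For_ind (P := P)) => [|i t hi ek sm IH w wn]; first exact: ch0.
  rewrite nE in hi; rewrite iotaS count_cat [count _ [:: i]]/= addn0 -IH //.
  have re : evi (Iraw vK) t = raw i by rewrite rawE ?ek ?(same_iraw sm) ?(same_bnd sm).
  rewrite /body1 evalS; set t1 := eval (vP <~ _) t.
  have p1 : iv t1 vP = raw i by rewrite /t1 -re; ev.
  have F1 : same (vP <~ Iraw vK) t t1 by exact: eval_same.
  seal t1; rewrite evalIfI [evi _ _]/= [evi vP _]/= p1.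
  case E: (raw i) => [|p]; first by rewrite ltnn addn0; ev; fr F1.
  by rewrite ltn0Sn; ev; rewrite p1 E subn1 /= eqSS [p == w]eq_sym; fr F1; case: eqP => [->|_]; rewrite ?addn0.
have F1 : same (For vK vN body1) s s1 by exact: eval_same.
have F2 : same (For vK vN body1;; vF <~ vN) s s2 by exact: eval_same.
have H2 v : (v < n)%N -> ia s2 aCH v = nc v by move=> vn; rewrite -H1.
have f2 : iv s2 vF = n by rewrite /s2; ev; fr F1.
have n2 : iv s2 vN = n by fr F2.
seal s2; have [q0 [Q0 q0E]] : exists q, queue n q s3 /\ q = [seq v <- iota 0 n | nc v == 0%N].
  pose P i t := queue n [seq v <- iota 0 i | nc v == 0%N] t.
  exists [seq v <- iota 0 n | nc v == 0%N]; split=> //.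
  suff : P n s3 by [].
  rewrite -n2; apply: (For_ind (P := P)) => [|i t hi ek sm IH].
    by split=> //=; ev; rewrite f2 subn0.
  rewrite n2 in hi; rewrite /P iotaS filter_cat.
  rewrite /body3 evalIfI [evi _ _]/= [evi (Ic 1) _]/= ek; fr sm; rewrite H2 // ltnS leqn0 [seq.filter _ [:: i]]/=.
  case: ifP => nci; last by rewrite cats0; case: IH.
  rewrite cats1; have := @enqueue_spec n _ t vK i IH hi _ ek isT.
  rewrite mem_filter mem_iota add0n ltnn !andbF => /(_ isT); case=> *; split=> //.
have F3 : same (For vK vN body3) s2 s3 by exact: eval_same.
have H3 v : (v < n)%N -> ia s3 aCH v = nc v by move=> vn; fr F3; apply: H2.
have n3 : iv s3 vN = n by fr F3.
have r3 : iraw s3 = raw by rewrite (same_iraw F3) (same_iraw F2).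
have b3 : bnd s3 = (n + n)%N by rewrite (same_bnd F3) (same_bnd F2).
seal s3.
(* The number of children of [v] that are not among the first [r] removed vertices; [v] is in the
   queue once it is 0. *)
pose rem r q v := count (fun u => (raw u == v.+1) && (u \notin take r q)) (iota 0 n).
pose P r t := exists q, [/\ queue n q t, (r <= size q)%N,
  forall v, (v < n)%N -> ia t aCH v = rem r q v,
  forall v, (v < n)%N -> (v \in q) = (rem r q v == 0%N) &
  forall u p, (u < n)%N -> raw u = p.+1 -> p \in q -> u \in q /\ (index u q < index p q)%N].
have remS r q v w : uniq q -> (r < size q)%N -> (forall u, u \in q -> (u < n)%N) -> v = nth 0%N q r ->
    rem r q w = (rem r.+1 q w + (raw v == w.+1))%N.
  move=> un rq lt vE; have vn : v \in iota 0 n by rewrite mem_iota vE lt // mem_nth.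
  have tk : take r.+1 q = rcons (take r q) v by rewrite vE (take_nth 0%N).
  have nv : v \notin take r q.
    by have := take_uniq r.+1 un; rewrite tk rcons_uniq => /andP[].
  have one : (\sum_(u <- iota 0 n) (u == v) = 1)%N.
    by rewrite (bigD1_seq v) ?iota_uniq //= eqxx big1 ?addn0 // => u /negbTE ->.
  rewrite /rem tk !count_sum -[X in (_ + X)%N]mul1n -one big_distrl -big_split.
  apply: eq_bigr => u _; rewrite mem_rcons inE; have [->|ne] := eqVneq u v.
    by rewrite nv /= andbT andbF add0n mul1n.
  by rewrite /= ?mul0n ?addn0.
have rem_rcons r q x w : (r <= size q)%N -> rem r (rcons q x) w = rem r q w.
  by move=> rq; rewrite /rem -cats1 takel_cat.
(* The queue does not run dry: otherwise every vertex outside it has a child outside it, and there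
   would be vertices of arbitrarily large [dep]. *)
have live r q t : queue n q t -> (r <= size q)%N -> (r < n)%N ->
    (forall v, (v < n)%N -> (v \in q) = (rem r q v == 0%N)) -> (r < size q)%N.
  case=> _ _ un lt _ rq rn memq; rewrite ltn_neqAle rq andbT; apply/eqP => e.
  have deep k : exists w, [/\ (w < n)%N, w \notin q & (k <= dep w)%N].
    elim: k => [|k [w [wn wq dw]]].
      have /allPn[w] : ~~ all (mem q) (iota 0 n).
        apply/negP => /allP sub; have := uniq_leq_size (iota_uniq 0 n) sub.
        by rewrite size_iota -e leqNgt rn.
      by rewrite mem_iota => /andP[_ wn] wq; exists w.
    move: wq; rewrite memq // -lt0n /rem -has_count => /hasP[u].
    rewrite mem_iota => /andP[_ un'] /andP[/eqP ru]; rewrite e take_size => uq.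
    by exists u; split=> //; apply: leq_ltn_trans dw _; have [] := val u w un' ru.
  have [w [wn _]] := deep (\max_(i < n) dep i).+1.
  by rewrite ltnNge (leq_bigmax (Ordinal wn)).
have : P n s4.
  rewrite -n3; apply: (For_ind (P := P)) => [|r t hr ek sm [q [qu rq ch memq ord]]].
    exists q0; have rem0 v : rem 0%N q0 v = nc v.
      by apply: eq_count => u; rewrite take0 andbT.
    split=> // [v vn|v vn|u p un ru].
    - by rewrite rem0; apply: H3.
    - by rewrite rem0 q0E mem_filter mem_iota vn !andbT.
    - rewrite q0E mem_filter mem_iota => /andP[/eqP nc0 _].
      suff : (0 < nc p)%N by rewrite nc0.
      by rewrite -has_count; apply/hasP; exists u; rewrite ?mem_iota ?ru.
  rewrite n3 in hr; have rs := live r q t qu rq hr memq; have [fE sq un lt nthE] := qu.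
  pose v := nth 0%N q r; have vq : v \in q by apply: mem_nth.
  have vn := lt v vq.
  rewrite /body4 evalS; set t1 := eval (vV <~ _) t; rewrite evalS; set t2 := eval (vP <~ _) t1.
  have v1 : iv t1 vV = v.
    by rewrite /t1; ev; rewrite ek; fr sm; rewrite n3; have [->] := nthE r rs.
  have p2 : iv t2 vP = raw v.
    have re : evi (Iraw vV) t1 = raw v.
      by rewrite rawE ?v1 // /t1 /= ?(same_iraw sm) ?(same_bnd sm).
    by rewrite /t2 -re; ev.
  have Ft : same (vV <~ Ild aQ (Isub (Isub vN (Ic 1)) vK);; vP <~ Iraw vV) t t2 by exact: eval_same.
  have qu2 : queue n q t2 by split; fr Ft.
  have ch2 : ia t2 aCH = ia t aCH by fr Ft.
  seal t2; rewrite evalIfI [evi _ _]/= [evi vP _]/= p2.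
  have remE w : rem r q w = (rem r.+1 q w + (raw v == w.+1))%N by apply: remS.
  case E: (raw v) => [|p].
    rewrite ltnn; exists q.
    have re w : rem r.+1 q w = rem r q w by rewrite remE E addn0.
    split=> // [w wn|w wn].
      by rewrite re -ch // -ch2.
    by rewrite re memq.
  have [pn _] := val v p vn E.
  have pq : p \notin q by rewrite memq // remE E eqxx addn1.
  have re w : w != p -> rem r.+1 q w = rem r q w.
    by move=> wp; rewrite remE E eqSS [p == w]eq_sym (negbTE wp) addn0.
  have rep : rem r q p = (rem r.+1 q p).+1 by rewrite remE E eqxx addn1.
  rewrite ltn0Sn evalS evalS.
  set t3 := eval (ISt aCH vP _) _.
  have Ft3 : same (vP <~ Isub vP (Ic 1);; ISt aCH vP (Isub (Ild aCH vP) (Ic 1))) t2 t3 by exact: eval_same.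
  have p3 : iv t3 vP = p by rewrite /t3; ev; rewrite p2 E subn1.
  have ch3 w : (w < n)%N -> ia t3 aCH w = rem r.+1 q w.
    move=> wn; rewrite /t3; ev; rewrite p2 E subn1 /=.
    have [->|ne] := eqVneq w p; first by rewrite ch2 ch // rep subn1.
    by rewrite ch2 ch // re.
  have qu3 : queue n q t3 by case: qu2 => *; split=> //; fr Ft3.
  seal t3; rewrite evalIfI [evi _ _]/= [evi (Ic 1) _]/= p3 ch3 // ltnS leqn0.
  case: eqP => r0; last first.
    exists q; split=> // w wn.
    have [->|ne] := eqVneq w p; last by rewrite re // memq.
    by rewrite (negbTE pq); apply/esym/eqP.
  have := @enqueue_spec n q t3 vP p qu3 pn pq p3 isT.
  have chq : ia (eval (enqueue vP) t3) aCH = ia t3 aCH by [].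
  rewrite /enqueue in chq *; move: chq; set t4 := eval _ t3 => chq qu4.
  exists (rcons q p).
  have rem4 w : rem r.+1 (rcons q p) w = rem r.+1 q w by rewrite rem_rcons.
  split=> // [||w wn|u p' un' ru].
  - by rewrite size_rcons leqW.
  - by move=> w wn; rewrite rem4 -ch3 // -chq.
  - rewrite rem4 mem_rcons inE; have [->|ne] := eqVneq w p; first by rewrite r0.
    by rewrite re // memq.
  - rewrite mem_rcons inE -cats1 !index_cat mem_cat => /orP[/eqP e|p'q].
      have uq : u \in q.
        apply/negPn/negP => nu; suff : (0 < rem r.+1 q p)%N by rewrite r0.
        rewrite -has_count; apply/hasP; exists u; rewrite ?mem_iota // ru e eqxx /=.
        by apply: contra nu; apply: mem_take.
      by rewrite e uq (negbTE pq) /= eqxx addn0 index_mem.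
    by have [uq ui] := ord u p' un' ru p'q; rewrite uq p'q.
case=> q [[f4 sq un lt nthE] nq _ _ ord].
have sz : size q = n by apply/eqP; rewrite eqn_leq sq.
have [_ qi] : (size q = size (iota 0 n)) * (q =i iota 0 n).
  by apply: uniq_min_size => // [v /lt vn|]; rewrite ?mem_iota // size_iota.
have inq v : (v < n)%N -> v \in q by move=> vn; rewrite qi mem_iota.
have posE v : (v < n)%N -> ia s4 aPOS v = (n - 1 - index v q)%N /\ (index v q < n)%N.
  move=> vn; have iq : (index v q < size q)%N by rewrite index_mem inq.
  by have [_] := nthE _ iq; rewrite nth_index ?inq // -sz.
split.
- move=> k kn; have iq : (n - 1 - k < size q)%N by rewrite sz; lia.
  have [] := nthE _ iq; have -> : (n - 1 - (n - 1 - k) = k)%N by lia.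
  by move=> -> ->; split=> //; apply: lt; apply: mem_nth.
- move=> v vn; have [-> iv'] := posE v vn; split; first by lia.
  have iq : (index v q < size q)%N by rewrite sz.
  by have [-> _] := nthE _ iq; rewrite nth_index ?inq.
- move=> v p vn rv'; have [pn _] := val v p vn rv'.
  have [-> i1] := posE v vn; have [-> i2] := posE p pn.
  by have [_ ii] := ord v p vn rv' (inq p pn); lia.
Qed.
End Topo.

(** * From the data to the lines and back *)

Section Main.
Variable R : realType.
Implicit Types s t : state R.

Lemma bound_spec s s' n : s' = eval bound s -> iv s vN = n -> bnd s = (n + n)%N ->
  0 <= rv s' rBD /\ forall v, (v < n)%N -> - rv s' rBD <= rraw s v <= rv s' rBD.
Proof.
rewrite /bound evalS; set s1 := eval (rBD <~r _) s; set body := (X in eval (For _ _ X) s1).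
move=> -> nE bE; set s2 := eval _ s1.
pose P i t := 0 <= rv t rBD /\ forall v, (v < i)%N -> - rv t rBD <= rraw s v <= rv t rBD.
have : P n s2; last by [].
rewrite -nE -[iv s vN]/(iv s1 vN); apply: (For_ind (P := P)) => [|i t hi ek sm [p1 p2]].
  by split=> //; ev; rewrite mulr0z.
have {}hi : (i < n)%N by rewrite -nE.
have re : evr (Rraw vK) t = rraw s i.
  by rewrite /= (same_bnd sm) bE ek (leq_trans hi) ?leq_addr // (same_rraw sm).
set y := rraw s i in re.
have rE' : rv (seti vK i.+1 (eval body t)) rBD = rv t rBD + (y * y + 1).
  by rewrite /body -re; ev; rewrite mulr1z.
rewrite /P rE'; have y2 : 0 <= y * y by rewrite -expr2 sqr_ge0.
split=> [|v]; first by lra.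
rewrite ltnS leq_eqVlt => /orP[/eqP->|/p2 /andP[h1 h2]]; last by lra.
have h : - (y * y + 1) <= y <= y * y + 1.
  have := sqr_ge0 (y - 1); have := sqr_ge0 (y + 1); rewrite !expr2; lra.
rewrite -/y; lra.
Qed.

Section Load.
Variables (n : nat) (Q pos raw : nat -> nat) (y w : nat -> R) (BD : R).

(** An error of at most [x] means [y - x / w <= g <= y + x / w]. For weight 0 the lower line is
    [- BD - x] and the upper one [BD + x]. *)
Definition start_inst := Inst n (fun k => pos (raw (Q k) - 1)%N)
  (fun k => if 0 < w (Q k) then y (Q k) else - BD) (fun k => if 0 < w (Q k) then 1 / w (Q k) else 1)
  (fun k => if 0 < w (Q k) then - y (Q k) else - BD) (fun k => if 0 < w (Q k) then 1 / w (Q k) else 1).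

Lemma load_spec s s' : s' = eval load s -> iv s vN = n -> bnd s = (n + n)%N -> ia s aQ = Q ->
  ia s aPOS = pos -> iraw s = raw -> (forall v, (v < n)%N -> rraw s v = y v /\ rraw s (n + v)%N = w v) ->
  rv s rBD = BD -> (forall k, (k < n)%N -> (Q k < n)%N) -> agree start_inst (inst_of s').
Proof.
rewrite /load evalS; set body := (X in For _ _ X); set s2 := eval (For _ _ body) s.
move=> -> nE bE qE pE rE yw bd Qn.
pose J := start_inst.
pose P i t := forall k, (k < i)%N -> [/\ ia t aPAR k = par J k, ra t fA k = la J k, ra t fS k = ls J k,
  ra t fB k = na J k & ra t fT k = ns J k].
have : P n s2.
  rewrite -nE; apply: (For_ind (P := P)) => // i t hi ek sm IH.
  have {}hi : (i < n)%N by rewrite -nE.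
  have Qi := Qn i hi; have [yi wi] := yw _ Qi.
  have b1 : (Q i < bnd t)%N by rewrite (same_bnd sm) bE (leq_trans Qi) ?leq_addr.
  have b2 : (n + Q i < bnd t)%N by rewrite (same_bnd sm) bE ltn_add2l.
  have qt : ia t aQ = Q by fr sm.
  have pt : ia t aPOS = pos by fr sm.
  have nt : iv t vN = n by fr sm.
  have bt : rv t rBD = BD by fr sm.
  have rt : iraw t = raw by rewrite (same_iraw sm).
  have yt : rraw t (Q i) = y (Q i) by rewrite (same_rraw sm).
  have wt : rraw t (n + Q i)%N = w (Q i) by rewrite (same_rraw sm).
  rewrite /body (evalS (vV <~ _)) (evalS (ISt _ _ _)) (evalS (rW <~r _)).
  set t1 := eval (vV <~ _) t.
  have v1 : iv t1 vV = Q i by rewrite /t1; ev; rewrite ek qt.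
  have [B1 I1 A1 S1 RA1] : [/\ bnd t1 = bnd t, iraw t1 = raw, ia t1 = ia t, rraw t1 = rraw t & ra t1 = ra t].
    by split; rewrite -?rt.
  have [N1 K1 D1] : [/\ iv t1 vN = n, iv t1 vK = i & rv t1 rBD = BD].
    by split; [rewrite -nt|rewrite -ek|rewrite -bt].
  seal t1; set t2 := eval (ISt _ _ _) t1.
  have re : evi (Ild aPOS (Isub (Iraw vV) (Ic 1))) t1 = par J i.
    by rewrite [LHS]/= v1 B1 b1 I1 A1 pt.
  have a2 k : ia t2 aPAR k = if k == i then par J i else ia t aPAR k.
    by rewrite /t2 -re; ev; rewrite K1 A1.
  have [B2 S2 RA2] : [/\ bnd t2 = bnd t, rraw t2 = rraw t & ra t2 = ra t].
    by split; rewrite -?B1 -?S1 -?RA1.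
  have [N2 K2 D2 V2] : [/\ iv t2 vN = n, iv t2 vK = i, rv t2 rBD = BD & iv t2 vV = Q i].
    by split; [rewrite -N1|rewrite -K1|rewrite -D1|rewrite -v1].
  seal t2; set t3 := eval (rW <~r _) t2.
  have w3 : rv t3 rW = w (Q i).
    have re' : evr (Rraw (Iadd vN vV)) t2 = w (Q i) by rewrite [LHS]/= N2 V2 B2 b2 S2.
    by rewrite /t3 -re'; ev.
  have [B3 S3 RA3 a3] : [/\ bnd t3 = bnd t, rraw t3 = rraw t, ra t3 = ra t &
      forall k, ia t3 aPAR k = if k == i then par J i else ia t aPAR k].
    by split; rewrite -?B2 -?S2 -?RA2 //; move=> k; rewrite -a2.
  have [k3 bd3 V3] : [/\ iv t3 vK = i, rv t3 rBD = BD & iv t3 vV = Q i].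
    by split; [rewrite -K2|rewrite -D2|rewrite -V2].
  seal t3; have y3 : evr (Rraw vV) t3 = y (Q i) by rewrite [LHS]/= V3 B3 b1 S3.
  have r3 x : ra t3 x = ra t x by rewrite RA3.
  rewrite /P evalIfR [evr _ _]/= [evr rW _]/= w3 mulr0z.
  have main t' : ia t' aPAR = ia t3 aPAR ->
    (forall k, ra t' fA k = if k == i then la J i else ra t3 fA k) ->
    (forall k, ra t' fS k = if k == i then ls J i else ra t3 fS k) ->
    (forall k, ra t' fB k = if k == i then na J i else ra t3 fB k) ->
    (forall k, ra t' fT k = if k == i then ns J i else ra t3 fT k) -> P i.+1 (seti vK i.+1 t').
    move=> e1 e2 e3 e4 e5 k; rewrite ltnS leq_eqVlt => ki.
    rewrite [ia _ _ _](_ : _ = ia t3 aPAR k); last by rewrite -e1.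
    rewrite a3 [ra _ fA _]e2 [ra _ fS _]e3 [ra _ fB _]e4 [ra _ fT _]e5 !r3.
    by case: (eqVneq k i) ki => [->|_ /= ki]; last exact: IH.
  case: ifP => wp; apply: main => //; move=> k.
  - rewrite [LHS](_ : _ = ra (eval (RSt fA vK (Rraw vV)) t3) fA k) //.
    rewrite [eval _ _](_ : _ = setra fA i (y (Q i)) t3); last by rewrite [LHS]/= -y3 k3.
    by ev; rewrite /J /= wp.
  - by ev; rewrite k3 w3 mulr1z /J /= wp.
  - by ev; rewrite k3 [X in 0 - X](_ : _ = y (Q i)) ?mulr0z ?sub0r /J /= ?wp.
  - by ev; rewrite k3 w3 mulr1z /J /= wp.
  - by ev; rewrite k3 bd3 mulr0z sub0r /J /= wp.
  - by ev; rewrite k3 mulr1z /J /= wp.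
  - by ev; rewrite k3 bd3 mulr0z sub0r /J /= wp.
  - by ev; rewrite k3 mulr1z /J /= wp.
have F2 : same (For vK vN body) s s2 by exact: eval_same.
have n2 : iv s2 vN = n by fr F2.
move=> H; seal s2; split=> [|]; first by rewrite /=; ev.
by split=> k /= => [/andP[_ kn]|kn]; have [] := H k kn.
Qed.

Hypotheses (n0 : (0 < n)%N) (Qpos : forall k, (k < n)%N -> (Q k < n)%N /\ pos (Q k) = k)
  (posQ : forall v, (v < n)%N -> (pos v < n)%N /\ Q (pos v) = v)
  (pos_lt : forall v p, (v < n)%N -> raw v = p.+1 -> (pos p < pos v)%N)
  (raw_lt : forall v p, (v < n)%N -> raw v = p.+1 -> (p < n)%N)
  (root_uniq : forall u v, (u < n)%N -> (v < n)%N -> raw u = 0%N -> raw v = 0%N -> u = v)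
  (BDy : forall v, (v < n)%N -> - BD <= y v <= BD) (BD0 : 0 <= BD).

(** Position 0 holds the root, as a parent would have to precede it; since the root is unique, all
    other positions have a parent. *)
Lemma raw_parent k : (0 < k < n)%N -> raw (Q k) = (Q (par start_inst k)).+1 /\ (par start_inst k < n)%N.
Proof.
case/andP=> k0 kn; have [qk pk] := Qpos kn; have [q0 p0] := Qpos n0 => /=.
case E : (raw (Q k)) => [|p]; last by rewrite subn1; have [-> ->] := posQ (raw_lt qk E).
case E0 : (raw (Q 0%N)) => [|p]; last by have := pos_lt q0 E0; rewrite p0.
by move: k0; rewrite -pk (root_uniq qk q0 E E0) p0.
Qed.

Lemma start_iwf : inst_wf start_inst.
Proof.
split=> // k /= hk; last by case: ifP => // h; rewrite divr_gt0.
have /andP[_ kn] := hk; have [qk pk] := Qpos kn.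
have [e pn] := raw_parent hk; have := pos_lt qk e; rewrite (Qpos pn).2 pk; exact.
Qed.

Lemma clampP (g E : R) : 0 <= E -> let h := Num.max (- (BD + E)) (Num.min (BD + E) g) in
  [/\ - (BD + E) <= h, h <= BD + E, forall a, a <= BD + E -> a <= g -> a <= h &
    forall a, - (BD + E) <= a -> g <= a -> h <= a].
Proof.
move=> E0; have b := BD0; have b0 : - (BD + E) <= BD + E by lra.
move=> h.
by split=> [||a h1 h2|a h1 h2]; rewrite /h ?le_max ?ge_max ?le_min ?ge_min ?lexx ?b0 ?h1 ?h2 ?orbT.
Qed.

(** A competitor of error at most [E] shows that [E] is feasible. At weight 0 it may violate the
    artificial lines, so it is clamped to absolute value [BD + E]; this preserves monotonicity and,
    as [|y| <= BD], also the genuine bounds. *)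
Lemma start_opt_le eps g E : opt start_inst 0 eps -> 0 <= E ->
  (forall v p, (v < n)%N -> raw v = p.+1 -> g v <= g p) ->
  (forall v, (v < n)%N -> w v * `|y v - g v| <= E) -> eps <= E.
Proof.
move=> o E0 mono err; apply/(opt_le E start_iwf o); split=> //.
pose c x := Num.max (- (BD + E)) (Num.min (BD + E) x).
have errw v : (v < n)%N -> 0 < w v -> y v - 1 / w v * E <= g v <= y v + 1 / w v * E.
  move=> vn wv; have := err v vn; rewrite mulrC -ler_pdivlMr // ler_norml => /andP[h1 h2].
  by rewrite (mulrC (1 / _)) mulrA mulr1; apply/andP; split; lra.
have lowb k : (k < n)%N -> lo_line start_inst k E <= c (g (Q k)).
  move=> kn; have [qk _] := Qpos kn; have [c1 c2 c3 c4] := clampP (g (Q k)) E0.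
  rewrite /lo_line /= /c; case: ifP => wk; last by rewrite mul1r; lra.
  have /andP[h _] := errw _ qk wk; apply: c3 => //; have /andP[_ yb] := BDy qk.
  have : 0 <= 1 / w (Q k) * E by rewrite mulr_ge0 // divr_ge0 // ltW.
  lra.
have upb k : (k < n)%N -> c (g (Q k)) + up_line start_inst k E <= 0.
  move=> kn; have [qk _] := Qpos kn; have [c1 c2 c3 c4] := clampP (g (Q k)) E0.
  rewrite /up_line /= /c; case: ifP => wk; last by rewrite mul1r; lra.
  have /andP[_ h] := errw _ qk wk; have /andP[yb _] := BDy qk.
  have e0 : 0 <= 1 / w (Q k) * E by rewrite mulr_ge0 // divr_ge0 // ltW.
  have : Num.max (- (BD + E)) (Num.min (BD + E) (g (Q k))) <= y (Q k) + 1 / w (Q k) * E by apply: c4 => //; lra.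
  lra.
exists (fun k => c (g (Q k))); split=> // k hk; have pn := par_lt start_iwf hk.
have h : c (g (Q k)) <= c (g (Q (par start_inst k))).
  have /andP[_ kn] := hk; have [qk _] := Qpos kn.
  have gg := mono _ _ qk (raw_parent hk).1.
  have [a1 a2 _ a4] := clampP (g (Q k)) E0.
  have [b1 b2 b3 b4] := clampP (g (Q (par start_inst k))) E0.
  have [le|lt] := leP (g (Q k)) (BD + E); last first.
    by apply: b3; [exact: a2|apply: le_trans gg; apply: le_trans (ltW lt)].
  have [le'|lt'] := leP (- (BD + E)) (g (Q k)).
    by apply: b3; [exact: a2|apply: le_trans gg; apply: a4].
  by apply: le_trans b1; apply: a4 => //; exact: ltW.
split=> //; have := upb _ pn; lra.
Qed.

(** The minimum of [X] with the upper lines is again monotone and above the lower lines. By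
    minimality [X] is below it, which yields the upper bound of each vertex at the vertex itself. *)
Lemma start_output eps X : opt start_inst 0 eps ->
  (forall k, (k < n)%N -> lo_line start_inst k eps <= X k) ->
  (forall k, (0 < k < n)%N -> X k <= X (par start_inst k)) ->
  (forall g, (forall k, (k < n)%N -> lo_line start_inst k eps <= g k) ->
     (forall k, (0 < k < n)%N -> g k <= g (par start_inst k)) -> forall k, (k < n)%N -> X k <= g k) ->
  (forall k, (0 < k < n)%N -> X k + up_line start_inst (par start_inst k) eps <= 0) ->
  (forall v p, (v < n)%N -> raw v = p.+1 -> X (pos v) <= X (pos p)) /\
  (forall v, (v < n)%N -> 0 <= w v -> w v * `|y v - X (pos v)| <= eps).
Proof.
move=> o lX mX minX uX; have e0 : 0 <= eps by case: o => -[].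
split=> [v p vn e|v vn].
  have [pv qv] := posQ vn; have := mX (pos v).
  by rewrite /= qv e subn1 /=; apply; rewrite pv (leq_ltn_trans _ (pos_lt vn e)).
rewrite le_eqVlt => /predU1P[<-|wv]; first by rewrite mul0r.
pose U k := - up_line start_inst k eps.
have iw k : 0 < w (Q k) -> 0 <= 1 / w (Q k) * eps by move=> h; rewrite mulr_ge0 // divr_ge0 // ltW.
have XU : X (pos v) <= U (pos v).
  have h k : (k < n)%N -> X k <= Num.min (X k) (U k).
    apply: (minX (fun k => Num.min (X k) (U k))) => {}k hk.
      have b := BD0; rewrite le_min lX //= /U /lo_line /up_line /=; case: ifP => [/iw|_]; lra.
    rewrite ge_min le_min mX //=; apply/orP; left; have := uX k hk; rewrite /U; lra.
  by have := h _ (posQ vn).1; rewrite le_min => /andP[].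
have [pv qv] := posQ vn.
have := lX _ pv; move: XU; rewrite /U /lo_line /up_line /= qv wv.
rewrite mul1r (mulrC _ eps) => h1 h2; rewrite mulrC -ler_pdivlMr // ler_norml.
by apply/andP; split; lra.
Qed.

End Load.

Definition main_loop := For vIt vN (IfI (Ic 1) vM round Skip).

(** A round removes at least one vertex while there are two, so [n] rounds leave the root alone,
    with no constraint but [e <= x]. *)
Lemma main_loop_spec s s' n eps : s' = eval main_loop s -> iv s vN = n -> iv s vM = n ->
  inst_wf (inst_of s) -> opt (inst_of s) (rv s rE) eps -> rv s' rE = eps.
Proof.
move=> -> nE mE w o; set s2 := eval _ s.
pose P i t := [/\ inst_wf (inst_of t), opt (inst_of t) (rv t rE) eps & (iv t vM <= maxn 1 (n - i))%N].
have : P n s2.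
  rewrite -nE; apply: (For_ind (P := P)) => [|i t hi ek sm [w1 o1 h1]].
    by split=> //; rewrite subn0 leq_max; apply/orP; right; rewrite -mE.
  rewrite evalIfI [evi _ _]/= [evi vM _]/=; case: ifP => [m1|/negbT]; last first.
    rewrite -leqNgt => m1; split=> //; rewrite leq_max; apply/orP; left; exact: m1.
  set t' := eval round t; have [w2 o2 h2 h3] := round_spec (erefl t') w1 m1 o1.
  seal t'; split=> //; rewrite [iv _ _](_ : _ = iv t' vM) //.
  clear -h1 h2 h3 m1; lia.
move=> PH; seal s2; have [w2 [[e2 f2] o2] h2] := PH.
have m1 : iv s2 vM = 1%N by case: w2 => m0 _ _; rewrite subnn in h2; apply/eqP; rewrite eqn_leq h2 m0.
have fe : feas (inst_of s2) (rv s2 rE) (rv s2 rE).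
  split=> //; exists (fun k => lo_line (inst_of s2) k (rv s2 rE)); split=> // k /=.
  by rewrite m1; case: k.
by apply/eqP; rewrite eq_le e2 /= leNgt; apply/negP => /o2.
Qed.

End Main.

(** * Running time *)

Section Cost.
Variable R : realType.
Implicit Types s t : state R.

Fixpoint loopfree c := match c with
  | For _ _ _ => false | Seq c d | IfI _ _ c d | IfR _ _ c d => loopfree c && loopfree d
  | _ => true end.

Fixpoint cost_bound c := match c with
  | Skip => 0 | ISet x e => ilen e + 2 | RSet x e => rlen e + 2
  | ISt i e f => ilen e + ilen f + 8 | RSt i e f => ilen e + rlen f + 8
  | RawSt e f => ilen e + rlen f + 2 | Seq c d => cost_bound c + cost_bound d
  | IfI e f c d => ilen e + ilen f + (cost_bound c + cost_bound d + 2)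
  | IfR e f c d => rlen e + rlen f + (cost_bound c + cost_bound d + 2)
  | For _ _ c => cost_bound c + 7 end%N.

Lemma loopfree_cost c s : loopfree c -> (cost c s <= cost_bound c)%N.
Proof.
elim: c s => //= [c1 IH1 c2 IH2|e f c1 IH1 c2 IH2|e f c1 IH1 c2 IH2] s /andP[h1 h2];
  have := IH1 s h1; have := IH2 s h2; have := IH2 (eval c1 s) h2; try case: ifP => _; lia.
Qed.

Lemma For_cost k l c s B : (forall t, (cost c t <= B)%N) ->
  (cost (For k l c) s <= (B + 4) * iv s l + 3)%N.
Proof.
move=> h; rewrite /= leq_add2r -[X in (_ <= _ * X)%N](card_ord (iv s l)) mulnC -sum_nat_const.
by apply: leq_sum => i _; rewrite leq_add2r.
Qed.

(** Amortised analysis: a pass may cost more than [a] if the potential [K * phi] drops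
    accordingly. *)
Lemma For_amort k l c s (Inv : state R -> Prop) (phi : state R -> nat) K a :
  Inv (seti k 0 s) -> phi (seti k 0 s) = phi s ->
  (forall i t, Inv t -> Inv (seti k i (eval c t)) /\
    (cost c t + K * phi (seti k i (eval c t)) <= a + K * phi t)%N) ->
  (cost (For k l c) s <= (a + 4) * iv s l + K * phi s + 3)%N.
Proof.
move=> i0 p0 H; rewrite [cost _ _]/= leq_add2r.
set n := iv s l; clearbody n.
suff [] : Inv (loop k (eval c) n s) /\ (\sum_(i < n) (cost c (loop k (eval c) i s) + 4) +
  K * phi (loop k (eval c) n s) <= (a + 4) * n + K * phi s)%N.
  by move=> _; apply: leq_trans; exact: leq_addr.
elim: n => [|n [IH1 IH2]]; first by rewrite big_ord0 /= p0 muln0.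
have [h1 h2] := H n.+1 _ IH1; split; first exact: h1.
rewrite big_ord_recr [loop _ _ n.+1 _]/=; move: IH2 h2; set A := (\sum_(i < n) _)%N.
rewrite [nat_of_ord _]/=; set t := loop k (eval c) n s; set B := phi t; set D := phi (seti _ _ _).
move: (cost c t) A B D => p A B D h3 h4; rewrite mulnSr [X in (X <= _)%N](_ : _ = A + (p + 4) + K * D)%N //.
lia.
Qed.

Definition bounded_by (L : seq nat) e :=
  match e with Iv y | Isub (Iv y) _ => y \in L | _ => false end.

(* The list [L] records integer variables known to be bounded by the size parameter [m]. *)
Fixpoint bounded_vars (L : seq nat) c : option (seq nat) := match c with
  | ISet x e =>
      Some (if bounded_by L e then x :: L else seq.filter (predC1 x) L)
  | Seq c d => obind (bounded_vars^~ d) (bounded_vars L c)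
  | IfI _ _ _ _ | IfR _ _ _ _ =>
      if loopfree c then Some (seq.filter [pred x | x \notin mod_iv c] L) else None
  | For k l d => if (l \in L) && loopfree d then Some (seq.filter [pred x | x \notin mod_iv c] L) else None
  | _ => Some L end.

Lemma bounded_cost L L' c s m : bounded_vars L c = Some L' -> (forall x, x \in L -> (iv s x <= m)%N) ->
  (cost c s <= cost_bound c * m.+1)%N /\ forall x, x \in L' -> (iv (eval c s) x <= m)%N.
Proof.
elim: c L L' s => [|x e|x e|i e f|i e f|e f|c IHc d IHd|e f c _ d _|e f c _ d _|k l c _] L L' s.
- by move=> [<-].
- move=> [<-] h; split=> [/=|y]; first by nia.
  rewrite [iv _ _]/= updE; case: ifP => okE.
    rewrite inE; case: eqP => [_ _|_ /=]; last exact: h.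
    by case: e okE => [z|k|e f|[z|k|e e0|e e0|k e|e] f|k e|e] //= /h; lia.
  by rewrite mem_filter /= => /andP[/negbTE-> /h].
- by move=> [<-] h; split; [rewrite /=; nia|exact: h].
- by move=> [<-] h; split; [rewrite /=; nia|exact: h].
- by move=> [<-] h; split; [rewrite /=; nia|exact: h].
- by move=> [<-] h; split=> [/=|y]; [nia|rewrite frame_iv //; apply: h].
- rewrite [bounded_vars _ _]/=; case E : (bounded_vars L c) => [L1|] //= E2 h.
  have [h1 h2] := IHc _ _ _ E h; have [h3 h4] := IHd _ _ _ E2 h2.
  by split=> //; rewrite mulnDl leq_add.
- rewrite [bounded_vars _ _]/=; case: ifP => // lf [<-] h; split.
    apply: leq_trans (loopfree_cost (c := IfI e f c d) s lf) _; exact: leq_pmulr.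
  by move=> x; rewrite mem_filter => /andP[hx /h]; rewrite frame_iv.
- rewrite [bounded_vars _ _]/=; case: ifP => // lf [<-] h; split.
    apply: leq_trans (loopfree_cost (c := IfR e f c d) s lf) _; exact: leq_pmulr.
  by move=> x; rewrite mem_filter => /andP[hx /h]; rewrite frame_iv.
- rewrite [bounded_vars _ _]/=; case: ifP => // /andP[lL lf] [<-] h; split; last first.
    by move=> x; rewrite mem_filter => /andP[hx /h]; rewrite frame_iv.
  apply: leq_trans (For_cost k l s (B := cost_bound c) _) _; first by move=> t; exact: loopfree_cost.
  rewrite [cost_bound (For _ _ _)]/= (leq_trans (leq_add (leq_mul (leqnn (cost_bound c + 4)) (h _ lL)) (leqnn 3))) //; clear; nia.
Qed.

(** Reduces a linear bound for a block without nested loops to a computation. *)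
Lemma block_cost l c s m : bounded_vars [:: l] c -> (iv s l <= m)%N ->
  (cost c s <= cost_bound c * m.+1)%N.
Proof.
case E : bounded_vars => // _ h; apply: (bounded_cost E _).1 => // x.
by rewrite inE => /eqP->.
Qed.

Lemma cost_Seq c d s : cost (c;; d) s = (cost c s + cost d (eval c s))%N. Proof. by []. Qed.

Lemma cost_IfI e f c d s : cost (IfI e f c d) s =
  (ilen e + ilen f + (if (evi e s < evi f s)%N then cost c s + 1 else cost d s + 2))%N.
Proof. by []. Qed.

Lemma halve_length s : (iv (eval halve s) vLEN).*2 = (iv s vLEN - odd (iv s vLEN))%N.
Proof.
rewrite /halve !evalS; set s1 := eval (vOdd <~ _) _; set body := (X in For _ _ X).
have l1 : iv s1 vLEN = iv s vLEN by [].
have c1 : iv s1 vC = 0%N /\ iv s1 vOdd = 0%N by [].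
seal s1; set s2 := eval _ s1.
pose P i t := iv t vC = i./2 /\ iv t vOdd = odd i.
have : P (iv s1 vLEN) s2.
  apply: (For_ind (P := P)) => // i t hi ek sm [h1 h2]; rewrite /body evalIfI [evi _ _]/= [evi vOdd _]/=.
  by rewrite h2 lt0b; case: ifP => o; split; ev; rewrite ?h1 ?o //; lia.
move=> PH; seal s2; have [h _] := PH; rewrite [iv _ _](_ : _ = iv s2 vC) // h l1; lia.
Qed.

Lemma level_length s : (iv (eval level s) vLEN).*2 = (iv s vLEN - odd (iv s vLEN))%N /\
  iv (eval level s) vB = (iv s vB + iv s vB)%N.
Proof.
rewrite /level (evalS (merge_pass _ _ _)) (evalS (vBB <~ _)) (evalS (merge_pass fW2 _ _)) (evalS halve).
set s1 := eval (merge_pass fW _ _) s; have F1 : same (merge_pass fW fW2 vB) s s1 by exact: eval_same.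
seal s1; set s2 := eval (vBB <~ _) s1.
have b2 : iv s2 vBB = (iv s vB + iv s vB)%N by rewrite /s2; ev; fr F1.
have F2 : same (vBB <~ Iadd vB vB) s1 s2 by exact: eval_same.
seal s2; set s3 := eval (merge_pass fW2 _ _) s2.
have F3 : same (merge_pass fW2 fW vBB) s2 s3 by exact: eval_same.
seal s3; have h := halve_length s3; set s4 := eval halve s3 in h *.
have F4 : same halve s3 s4 by exact: eval_same.
seal s4; rewrite [iv _ vLEN](_ : _ = iv s4 vLEN) // h; split; first by fr F3; fr F2; fr F1.
by rewrite [iv _ vB](_ : _ = iv s4 vBB) //; fr F4; fr F3.
Qed.

Definition splitter_const := (3 * cost_bound level + 40)%N.

(** A level is run on [p >= 2] values and leaves [q <= p / 2] of them. Its cost is proportional to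
    [p + 1 <= 3 * (p - q)] and is paid for by the decrease of the length. *)
Lemma splitter_cost s : (cost splitter s <= splitter_const * (iv s vNN).+1)%N.
Proof.
rewrite /splitter !cost_Seq.
rewrite [cost (vB <~ _) _]/= [cost (vB2 <~ _) _]/= [cost (vB4 <~ _) _]/= [cost (vLEN <~ _) _]/=.
rewrite [cost (rT <~r _) _]/=.
set s4 := eval (vLEN <~ _) _.
have [n4 l4 b4] : [/\ iv s4 vNN = iv s vNN, iv s4 vLEN = iv s vNN & iv s4 vB = 1%N] by [].
seal s4; set N := iv s vNN in n4 l4 *.
have := @For_amort vL vNN (IfI vB vLEN level Skip) s4 (fun t => (0 < iv t vB)%N)
  (fun t => iv t vLEN) (3 * cost_bound level) 7 _ erefl.
rewrite n4 l4 => H; suff : (cost (For vL vNN (IfI vB vLEN level Skip)) s4 <=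
  (7 + 4) * N + 3 * cost_bound level * N + 3)%N.
  rewrite /splitter_const; clear; move: (cost _ _) (cost_bound level) => p q; nia.
apply: H => [|i t Bt]; first by rewrite [iv _ _](_ : _ = iv s4 vB) ?b4.
rewrite evalIfI cost_IfI [evi vB _]/= [evi vLEN _]/= [ilen vB]/= [ilen vLEN]/=.
case: ifP => lt; last by split=> //; clear; lia.
have [h1 h2] := level_length t; have h3 : (cost level t <= cost_bound level * (iv t vLEN).+1)%N.
  have ok : bounded_vars [:: vLEN] level by vm_compute.
  exact: block_cost ok (leqnn _).
set t' := eval level t in h1 h2 *; seal t'.
rewrite [iv _ vB](_ : _ = iv t' vB) // [iv (seti _ _ _) vLEN](_ : _ = iv t' vLEN) // h2; split.
  by clear -Bt; lia.
move: h1 h3 lt; move: (iv t vLEN) (iv t' vLEN) (cost_bound level) (cost level t) => p q r u h1 h3 lt.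
have : (p.+1 + 3 * q <= 3 * p)%N.
  by move: (leq_b1 (odd p)) (leq_ltn_trans Bt lt) h1; clear; move: (nat_of_bool _); lia.
move=> /(leq_mul (leqnn r)); move: h3; clear; nia.
Qed.

Lemma matching_pairs s : (iv (eval matching s) vNP <= iv s vM)%N.
Proof.
rewrite /matching evalS; set s1 := eval (vNP <~ _) s; set body := (X in For _ _ X).
have m1 : iv s1 vM = iv s vM by [].
have c1 : iv s1 vNP = 0%N by [].
seal s1; set s2 := eval _ s1; pose P i t := (iv t vNP <= i)%N.
have : P (iv s1 vM) s2.
  apply: (For_ind (P := P)) => [|i t hi ek sm]; first by rewrite /P [iv _ _](_ : _ = iv s1 vNP) ?c1.
  rewrite /P /body evalS => h; set t1 := eval (vV <~ _) t.
  have h1 : iv t1 vNP = iv t vNP by [].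
  seal t1; rewrite [iv (seti _ _ _) _](_ : _ = iv (eval (IfI (Ic 0) (Ild aPEND vV)
    (emit (Isub (Ild aPEND vV) (Ic 1))) (IfI (Ic 0) vV
         (vP <~ Ild aPAR vV;;
          IfI (Ild aCH vV) (Ic 1)
            (IfI (Ic 0) (Ild aPEND vP)
               (emit (Isub (Ild aPEND vP) (Ic 1));; ISt aPEND vP (Ic 0))
               (ISt aPEND vP (Iadd vV (Ic 1))))
            (IfI (Ild aCH vP) (Ic 2) (ISt aPEND vP (Iadd vV (Ic 1))) Skip))
         Skip)) t1) vNP) //.
  by rewrite [eval _ _]/=; do ! case: ifP => _; ev; rewrite ?h1; clear -h; lia.
by rewrite m1.
Qed.

Lemma truncate_pairs s : (iv (eval truncate s) vNN <= maxn 1 (iv s vNP))%N.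
Proof.
rewrite /truncate evalS; set s1 := eval (vNN <~ _) s; set body := (X in For _ _ X).
have m1 : iv s1 vNP = iv s vNP by [].
have c1 : iv s1 vNN = 1%N by [].
seal s1; set s2 := eval _ s1; pose P (i : nat) t := (iv t vNN <= maxn 1 (iv s vNP))%N.
have : P (iv s1 vNP) s2; last by [].
apply: (For_ind (P := P)) => [|i t hi ek sm h].
  by rewrite /P [iv _ _](_ : _ = iv s1 vNN) // c1 leq_max.
have np : iv t vNP = iv s vNP by fr sm.
rewrite /P /body !evalS; set t1 := eval (vC <~ _) t; set t2 := eval (vC <~ _) t1.
have [h1 h2] : iv t2 vNN = iv t vNN /\ iv t2 vNP = iv s vNP by rewrite -np.
seal t2; rewrite [iv (seti _ _ _) _](_ : _ = iv (eval (IfI vNP vC Skip (vNN <~ vC)) t2) vNN) //.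
rewrite evalIfI [evi vNP _]/= [evi vC _]/= h2; case: ifP => [_|/negbT]; first by rewrite [eval _ _]/= h1.
by rewrite -leqNgt => le; rewrite [iv _ _](_ : _ = iv t2 vC) // leq_max le orbT.
Qed.

Lemma resolve_pairs fa fs s : (iv (eval (resolve fa fs) s) vNP <= iv s vNN)%N.
Proof.
rewrite /resolve evalS (evalS (For _ _ _)); set s1 := eval (vQ <~ _) s; set body := (X in For _ _ X).
have m1 : iv s1 vNN = iv s vNN by [].
have c1 : iv s1 vQ = 0%N by [].
seal s1; set s2 := eval (For _ _ _) s1; pose P i t := (iv t vQ <= i)%N.
have : P (iv s1 vNN) s2; last first.
  by rewrite /P => h; rewrite [iv _ _](_ : _ = iv s2 vQ) // -m1.
apply: (For_ind (P := P)) => [|i t hi ek sm]; first by rewrite /P [iv _ _](_ : _ = iv s1 vQ) ?c1.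
rewrite /P /body (evalS (vU <~ _)) (evalS (vV <~ _)) (evalS (rC <~r _)) => h.
set t1 := eval (vU <~ _) t; set t2 := eval (vV <~ _) t1; set t3 := eval (rC <~r _) t2.
have h1 : iv t3 vQ = iv t vQ by [].
seal t3; rewrite evalIfR; case: ifP => _; first by rewrite [iv _ _](_ : _ = iv t3 vQ) // h1 ltnW.
rewrite (evalS (rZ <~r _)) (evalS (IfR _ _ _ _)).
set t4 := eval (rZ <~r _) t3; have h2 : iv t4 vQ = iv t vQ by rewrite -h1.
seal t4; set t5 := eval (IfR _ _ _ _) t4.
have h3 : iv t5 vQ = iv t vQ by rewrite -h2 /t5; apply: frame_iv.
by seal t5; ev; rewrite h3 addn1 ltnS.
Qed.

Lemma leq_addM (a b x y m : nat) : (x <= a * m)%N -> (y <= b * m)%N -> (x + y <= (a + b) * m)%N.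
Proof. by move=> h1 h2; rewrite mulnDl leq_add. Qed.

Definition prune_const fa fs := (cost_bound truncate + (cost_bound (crossings fa fs) + (splitter_const +
  (cost_bound test + cost_bound (resolve fa fs)))))%N.

Lemma prune_cost fa fs s m : (0 < m)%N -> (iv s vNP <= m)%N -> (iv s vM <= m)%N ->
  (cost (prune fa fs) s <= prune_const fa fs * m.+1)%N /\ (iv (eval (prune fa fs) s) vNP <= m)%N.
Proof.
move=> m0 np mm; rewrite /prune (cost_Seq truncate) (cost_Seq (crossings _ _)) (cost_Seq splitter) (cost_Seq test).
rewrite (evalS truncate) (evalS (crossings _ _)) (evalS splitter) (evalS test).
have ok1 : bounded_vars [:: vNP] truncate by vm_compute.
have c1 := block_cost ok1 np; have h1 := truncate_pairs s.
set s1 := eval truncate s in h1 *; have F1 : same truncate s s1 by exact: eval_same.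
seal s1; have n1 : (iv s1 vNN <= m)%N by apply: leq_trans h1 _; rewrite geq_max m0.
have ok2 : bounded_vars [:: vNN] (crossings fa fs) by vm_compute.
have c2 := block_cost ok2 n1; set s2 := eval _ s1.
have F2 : same (crossings fa fs) s1 s2 by exact: eval_same.
seal s2; have n2 : (iv s2 vNN <= m)%N by fr F2.
have c3 := splitter_cost s2; set s3 := eval splitter s2.
have F3 : same splitter s2 s3 by exact: eval_same.
seal s3; have m3 : (iv s3 vM <= m)%N by fr F3; fr F2; fr F1.
have ok4 : bounded_vars [:: vM] test by vm_compute.
have c4 := block_cost ok4 m3; set s4 := eval test s3.
have F4 : same test s3 s4 by exact: eval_same.
seal s4; have n4 : (iv s4 vNN <= m)%N by fr F4; fr F3.
have ok5 : bounded_vars [:: vNN] (resolve fa fs) by vm_compute.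
have c5 := block_cost ok5 n4; split; last exact: leq_trans (resolve_pairs fa fs s4) n4.
have {}c3 : (cost splitter s2 <= splitter_const * m.+1)%N.
  by apply: leq_trans c3 _; rewrite leq_mul2l ltnS n2 orbT.
exact: (leq_addM c1 (leq_addM c2 (leq_addM c3 (leq_addM c4 c5)))).
Qed.

Definition round_const := (cost_bound prepare + (cost_bound matching + (cost_bound raise + (prune_const fA fS +
  (prune_const fB fT + (cost_bound mark + cost_bound compact))))))%N.

Lemma round_cost s m : iv s vM = m -> (0 < m)%N -> (cost round s <= round_const * m.+1)%N.
Proof.
move=> mE m0; rewrite /round (cost_Seq prepare) (cost_Seq matching) (cost_Seq raise).
rewrite (cost_Seq (prune fA fS)) (cost_Seq (prune fB fT)) (cost_Seq mark).
have m1 : (iv s vM <= m)%N by rewrite mE.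
have ok1 : bounded_vars [:: vM] prepare by vm_compute.
have c1 := block_cost ok1 m1; set s1 := eval prepare s.
have F1 : same prepare s s1 by exact: eval_same.
seal s1; have {}m1 : (iv s1 vM <= m)%N by fr F1.
have ok2 : bounded_vars [:: vM] matching by vm_compute.
have c2 := block_cost ok2 m1; have h2 := leq_trans (matching_pairs s1) m1.
set s2 := eval matching s1 in h2 *; have F2 : same matching s1 s2 by exact: eval_same.
seal s2; have ok3 : bounded_vars [:: vNP] raise by vm_compute.
have c3 := block_cost ok3 h2; set s3 := eval raise s2.
have F3 : same raise s2 s3 by exact: eval_same.
seal s3; have n3 : (iv s3 vNP <= m)%N by fr F3.
have m3 : (iv s3 vM <= m)%N by fr F3; fr F2.
have [c4 n4] := prune_cost fA fS m0 n3 m3; set s4 := eval (prune _ _) s3 in n4 *.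
have F4 : same (prune fA fS) s3 s4 by exact: eval_same.
seal s4; have m4 : (iv s4 vM <= m)%N by fr F4.
have [c5 n5] := prune_cost fB fT m0 n4 m4; set s5 := eval (prune _ _) s4 in n5 *.
have F5 : same (prune fB fT) s4 s5 by exact: eval_same.
seal s5; have ok6 : bounded_vars [:: vNP] mark by vm_compute.
have c6 := block_cost ok6 n5; set s6 := eval mark s5.
have F6 : same mark s5 s6 by exact: eval_same.
seal s6; have m6 : (iv s6 vM <= m)%N by fr F6; fr F5.
have ok7 : bounded_vars [:: vM] compact by vm_compute.
have c7 := block_cost ok7 m6.
exact: (leq_addM c1 (leq_addM c2 (leq_addM c3 (leq_addM c4 (leq_addM c5 (leq_addM c6 c7)))))).
Qed.

Definition loop_const := (round_const * 2 * 1536 + 14)%N.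

(** The potential is the number [m] of vertices: a round costs at most [round_const * (m + 1)] and
    removes at least [m / 1536] vertices, and the factor 2 absorbs [m + 1 <= 2 * m]. The invariant
    contains [opt], on which the guaranteed decrease rests. *)
Lemma main_loop_cost s n eps : iv s vN = n -> iv s vM = n -> inst_wf (inst_of s) ->
  opt (inst_of s) (rv s rE) eps -> (cost main_loop s <= loop_const * n.+1)%N.
Proof.
move=> nE mE w o.
have := @For_amort vIt vN (IfI (Ic 1) vM round Skip) s
  (fun t => inst_wf (inst_of t) /\ opt (inst_of t) (rv t rE) eps)
  (fun t => iv t vM) (round_const * 2 * 1536) 10 _ erefl.
rewrite nE mE => H; suff : (cost main_loop s <= (10 + 4) * n + round_const * 2 * 1536 * n + 3)%N.
  rewrite /loop_const; clear; move: (cost _ _) (round_const * 2 * 1536)%N => p q; nia.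
apply: H => [//|i t [w1 o1]].
rewrite evalIfI cost_IfI [evi (Ic 1) _]/= [evi vM _]/= [ilen (Ic 1)]/= [ilen vM]/=.
case: ifP => m1; last by split=> //; rewrite [iv (seti _ _ _) _](_ : _ = iv t vM) // leq_add2r.
have c := round_cost erefl (ltnW m1); set t' := eval round t.
have [w2 o2 h2 h3] := round_spec (erefl t') w1 m1 o1.
seal t'; rewrite [iv (seti _ _ _) vM](_ : _ = iv t' vM) //; split; first by [].
move: c m1 h2 h3; clear.
move: (iv t vM) (iv t' vM) round_const (cost round t) => p q r u c p1 h2 h3.
have h : (p.+1 <= 2 * 1536 * (p - q))%N.
  rewrite -mulnA; apply: leq_trans (leq_mul (leqnn 2) h3); rewrite mul2n -addnn -addn1 leq_add2l; exact: ltnW.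
have := leq_mul (leqnn r) h; have : (r * (2 * 1536 * (p - q)) + r * 2 * 1536 * q = r * 2 * 1536 * p)%N.
  by rewrite !mulnA -mulnDr subnK.
by move: c; clear; move: (r * 2 * 1536 * q)%N (r * 2 * 1536 * p)%N (r * _)%N (r * _)%N; lia.
Qed.
End Cost.

(** * The whole program *)

Section MainSpec.
Variable R : realType.
Implicit Types s : state R.

Definition main_const := (cost_bound topo + (cost_bound bound + (cost_bound load + (cost_bound (rE <~r Rc 0) +
  (loop_const + (cost_bound load + (cost_bound (rT <~r rE) + (cost_bound test +
   cost_bound (For vK vN (RawSt (Ild aQ vK) (Rld fX vK)))))))))))%N.

Lemma main_spec s (n : nat) (y w : nat -> R) (dep : nat -> nat) (raw := iraw s)
    (f := rraw (eval main s)) :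
  iv s vN = n -> (0 < n)%N -> bnd s = (n + n)%N ->
  (forall v, (v < n)%N -> rraw s v = y v /\ rraw s (n + v)%N = w v) ->
  (forall v, (v < n)%N -> ia s aCH v = 0%N) ->
  (forall v p, (v < n)%N -> raw v = p.+1 -> (p < n)%N /\ (dep p < dep v)%N) ->
  (forall u v, (u < n)%N -> (v < n)%N -> raw u = 0%N -> raw v = 0%N -> u = v) ->
  (forall v, (v < n)%N -> 0 <= w v) ->
  [/\ (cost main s <= main_const * n.+1)%N,
    forall v p, (v < n)%N -> raw v = p.+1 -> f v <= f p &
  exists eps, [/\ 0 <= eps, forall v, (v < n)%N -> w v * `|y v - f v| <= eps &
    forall g E, 0 <= E -> (forall v p, (v < n)%N -> raw v = p.+1 -> g v <= g p) ->
      (forall v, (v < n)%N -> w v * `|y v - g v| <= E) -> eps <= E]].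
Proof.
move=> nE n0 bE yw chE rawE uniqR w0.
rewrite /f {f} /main (evalS topo) (evalS bound) (evalS load) (evalS (rE <~r _)).
rewrite (evalS (For vIt _ _)) (evalS load) (evalS (rT <~r _)) (evalS test).
rewrite (cost_Seq topo) (cost_Seq bound) (cost_Seq load) (cost_Seq (rE <~r _)).
rewrite (cost_Seq (For vIt _ _)) (cost_Seq load) (cost_Seq (rT <~r _)) (cost_Seq test).
have blk c (t : state R) : bounded_vars [:: vN] c -> iv t vN = n -> (cost c t <= cost_bound c * n.+1)%N.
  by move=> ok e; apply: block_cost ok _; rewrite e.
have ok1 : bounded_vars [:: vN] topo by vm_compute.
have c1 := blk _ _ ok1 nE; set s1 := eval topo s.
have [T1 T2 T3] := topo_spec (erefl s1) nE bE chE rawE.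
have F1 : same topo s s1 by exact: eval_same.
seal s1; set s2 := eval bound s1.
have n1 : iv s1 vN = n by fr F1.
have ok2 : bounded_vars [:: vN] bound by vm_compute.
have c2 := blk _ _ ok2 n1.
have b1 : bnd s1 = (n + n)%N by rewrite (same_bnd F1).
have [B0 B1] := bound_spec (erefl s2) n1 b1.
have F2 : same bound s1 s2 by exact: eval_same.
seal s2; set Q := ia s1 aQ; set pos := ia s1 aPOS; set BD := rv s2 rBD.
have raw_lt v p : (v < n)%N -> raw v = p.+1 -> (p < n)%N by move=> vn /(rawE _ _ vn)[].
have BDy v : (v < n)%N -> - BD <= y v <= BD.
  by move=> vn; have := B1 v vn; rewrite (same_rraw F1) // (yw v vn).1.
have loadE t t' : t' = eval load t -> iv t vN = n -> bnd t = (n + n)%N -> ia t aQ = Q ->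
    ia t aPOS = pos -> iraw t = raw -> rraw t = rraw s -> rv t rBD = BD ->
    agree (start_inst n Q pos raw y w BD) (inst_of t').
  move=> D e1 e2 e3 e4 e5 e6 e7; apply: (load_spec D e1 e2 e3 e4 e5 _ e7) => [v vn|k kn].
    by rewrite e6; exact: yw.
  by have [] := T1 k kn.
set J := start_inst n Q pos raw y w BD.
have wJ : inst_wf J by apply: start_iwf => //.
have [eps oJ] := opt_exists 0 wJ.
have n2 : iv s2 vN = n by fr F2; fr F1.
have okl : bounded_vars [:: vN] load by vm_compute.
have c3 := blk _ _ okl n2; set s3 := eval load s2.
have A3 : agree J (inst_of s3).
  apply: loadE (erefl s3) _ _ _ _ _ _ _ => //.
  - by rewrite (same_bnd F2).
  - by fr F2.
  - by fr F2.
  - by rewrite (same_iraw F2) (same_iraw F1).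
  - by rewrite (same_rraw F2) // (same_rraw F1).
have F3 : same load s2 s3 by exact: eval_same.
seal s3.
have n3 : iv s3 vN = n by fr F3.
have ok4 : bounded_vars [:: vN] (rE <~r Rc 0) by vm_compute.
have c4 := blk _ _ ok4 n3; set s4 := eval (rE <~r _) s3.
have A4 : agree J (inst_of s4) by [].
have E4 : rv s4 rE = 0 by rewrite /s4; ev; rewrite mulr0z.
have F4 : same (rE <~r Rc 0) s3 s4 by exact: eval_same.
seal s4; rewrite -/main_loop; set s5 := eval main_loop s4.
have n4 : iv s4 vN = n by fr F4; fr F3; fr F2; fr F1.
have m4 : iv s4 vM = n by case: A4 => /= <-.
have o4 : opt (inst_of s4) (rv s4 rE) eps by rewrite E4; apply: agree_opt oJ.
have c5 := main_loop_cost n4 m4 (agree_iwf A4 wJ) o4.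
have e5 := main_loop_spec (erefl s5) n4 m4 (agree_iwf A4 wJ) o4.
have F5 : same main_loop s4 s5 by exact: eval_same.
seal s5; have n5 : iv s5 vN = n by fr F5.
have c6 := blk _ _ okl n5; set s6 := eval load s5.
have A6 : agree J (inst_of s6).
  apply: loadE (erefl s6) _ _ _ _ _ _ _ => //.
  - by rewrite (same_bnd F5) (same_bnd F4) (same_bnd F3) (same_bnd F2).
  - by fr F5; fr F4; fr F3; fr F2.
  - by fr F5; fr F4; fr F3; fr F2.
  - by rewrite (same_iraw F5) (same_iraw F4) (same_iraw F3) (same_iraw F2) (same_iraw F1).
  - by rewrite (same_rraw F5) // (same_rraw F4) // (same_rraw F3) // (same_rraw F2) // (same_rraw F1).
  - by fr F5; fr F4; fr F3.
have F6 : same load s5 s6 by exact: eval_same.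
seal s6; have n6 : iv s6 vN = n by fr F6.
have ok7 : bounded_vars [:: vN] (rT <~r rE) by vm_compute.
have c7 := blk _ _ ok7 n6; set s7 := eval (rT <~r _) s6.
have A7 : agree J (inst_of s7) by [].
have e6 : rv s6 rE = eps by fr F6.
have [E7 T7] : rv s7 rE = eps /\ rv s7 rT = eps by split; rewrite /s7; ev.
have F7 : same (rT <~r rE) s6 s7 by exact: eval_same.
seal s7; have m7 : (iv s7 vM <= n)%N by case: A7 => /= <-.
have ok8 : bounded_vars [:: vM] test by vm_compute.
have c8 := block_cost ok8 m7; set s8 := eval test s7; set X := ra s8 fX.
have [X1 X2 X3 X4] := test_spec (agree_iwf A7 wJ) (erefl s8).
have F8 : same test s7 s8 by exact: eval_same.
seal s8.
have n8 : iv s8 vN = n by fr F8; fr F7; fr F6; fr F5.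
have Q8 : ia s8 aQ = Q by fr F8; fr F7; fr F6; fr F5; fr F4; fr F3; fr F2.
have b8 : bnd s8 = (n + n)%N.
  by rewrite (same_bnd F8) (same_bnd F7) (same_bnd F6) (same_bnd F5) (same_bnd F4) (same_bnd F3) (same_bnd F2).
set out := For vK vN _.
have ok9 : bounded_vars [:: vN] out by vm_compute.
have c9 := blk _ _ ok9 n8; set s9 := eval out s8.
have fE v : (v < n)%N -> rraw s9 v = X (pos v).
  pose P i t := forall k, (k < i)%N -> rraw t (Q k) = X k.
  have : P n s9.
    rewrite -n8; apply: (For_ind (P := P)) => // i t hi ek sm IH k; rewrite n8 in hi.
    have qt : ia t aQ = Q by fr sm.
    have xt : ra t fX = X by fr sm.
    have Qi := (T1 i hi).1.
    have b : (Q i < bnd t)%N by rewrite (same_bnd sm) b8 (leq_trans Qi) ?leq_addr.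
    rewrite ltnS => ki; rewrite [LHS]/= ek qt b xt updE.
    case: eqP => [e|ne].
      have kn := leq_ltn_trans ki hi.
      by rewrite -(T1 i hi).2 -/Q -e (T1 k kn).2.
    by apply: IH; rewrite ltn_neqAle ki andbT; apply/eqP => e; rewrite e in ne.
  by move=> H vn; have [pn {1}<-] := T2 v vn; rewrite H.
seal s9.
have {}X4 : forall k, (0 < k < n)%N -> X k + up_line J (par J k) eps <= 0.
  have oJ7 := agree_opt wJ A7 oJ.
  have [jz [jp jl]] := A7.
  (* The last test cannot fail, since the optimum is feasible. *)
  case: X4 => [[_ [_ h]] k hk|[_ []]]; last by rewrite T7 E7; case: (oJ) => -[_ fj] _; apply: (agree_feas wJ A7).
  have := h k; rewrite T7 -jz => /(_ hk); rewrite /up_line -jp //.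
  by have [_ _ -> ->] := jl _ (par_lt wJ hk).
have [jz [jp jl]] := A7.
have X1' : forall k, (k < n)%N -> lo_line J k eps <= X k.
  by move=> k hk; have := X1 k; rewrite T7 -jz => /(_ hk); rewrite /lo_line; have [-> -> _ _] := jl k hk.
have X2' : forall k, (0 < k < n)%N -> X k <= X (par J k).
  by move=> k hk; have := X2 k; rewrite -jz => /(_ hk); rewrite -jp.
have X3' : forall g, (forall k, (k < n)%N -> lo_line J k eps <= g k) ->
     (forall k, (0 < k < n)%N -> g k <= g (par J k)) -> forall k, (k < n)%N -> X k <= g k.
  move=> g g1 g2 k hk; apply: X3; rewrite -jz // => j hj.
    by rewrite T7; have := g1 j hj; rewrite /lo_line; have [-> -> _ _] := jl j hj.
  by rewrite -jp //; apply: g2.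
have [f1 f2] := start_output T2 T3 B0 oJ X1' X2' X3' X4.
split=> [|v p vn e|].
- exact: (leq_addM c1 (leq_addM c2 (leq_addM c3 (leq_addM c4 (leq_addM c5
    (leq_addM c6 (leq_addM c7 (leq_addM c8 c9)))))))).
- by rewrite (fE _ vn) (fE _ (raw_lt _ _ vn e)); exact: f1.
- exists eps; split=> [|v vn|g E E0 g1 g2].
  + by case: oJ => -[].
  + by rewrite fE //; apply: f2 => //; exact: w0.
  + exact: (start_opt_le n0 T1 T2 T3 raw_lt uniqR BDy B0 oJ E0 g1 g2).
Qed.
End MainSpec.

(** * The RAM program *)

Section Trees.
Variables (n : nat) (T : rooted_tree n).

Definition up (v : 'I_n) := odflt v (parent T v).

Lemma reaches_root v : exists k, iter k up v == tree_root T.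
Proof.
have /connectP[p ep ->] := connect_tree_root T v; exists (size p); apply/eqP.
elim: p v ep => //= x p IH v /andP[/eqP e1 /IH <-].
by rewrite -iterS iterSr /up e1.
Qed.

Definition depth v := ex_minn (reaches_root v).

Lemma depth_lt v p : parent T v = Some p -> (depth p < depth v)%N.
Proof.
move=> e; rewrite /depth; case: (ex_minnP (reaches_root v)) => -[|k] /eqP ek _.
  by move: e; rewrite -[v]/(iter 0 up v) ek parent_tree_root.
case: ex_minnP => m _; apply; rewrite -ek iterSr /up e //.
Qed.

Lemma parent_root v : parent T v = None -> v = tree_root T.
Proof.
move=> e; have /connectP[[|x p] /= + ->] := connect_tree_root T v; first by [].
by rewrite /parent_edge e.
Qed.

Lemma isotonicP (R : realType) (f : 'I_n -> R) :
  isotonic T f <-> forall v p, parent T v = Some p -> f v <= f p.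
Proof.
split=> [h v p e|h u v]; first by apply/h/connect1/eqP.
move/connectP => [p + ->]; elim: p u => //= x p IH u /andP[/eqP /h e /IH]; exact: le_trans.
Qed.

End Trees.

(** Stars provide an input of every positive size, without which a worst-case time would not
    exist. *)
Definition star_parent n (v : 'I_n.+1) : option 'I_n.+1 := if v == ord0 then None else Some ord0.

Lemma star_connect n v : connect (parent_edge (@star_parent n)) v ord0.
Proof.
have [->|ne] := eqVneq v ord0; first exact: connect0.
by apply: connect1; rewrite /parent_edge /star_parent (negbTE ne).
Qed.

Definition star n : rooted_tree n.+1 := RootedTree (erefl : @star_parent n ord0 = None) (@star_connect n).

(** The first instruction puts [2 * n], the number of input cells, into register 1, where the
    compiled code expects [bnd]. *)
Definition isotonic_program : program := IAdd 1 0 0 :: ccode 1 main.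

(** The first loop of [topo] alone makes [n] passes; this is the linear lower bound, valid for every
    input. *)
Lemma min_cost_main (R : realType) (s : state R) : (iv s vN <= min_cost main s)%N.
Proof.
have loS c d : (min_cost c s <= min_cost (c;; d) s)%N by exact: leq_addr.
by rewrite /main; apply: leq_trans (loS _ _); rewrite /topo; apply: leq_trans (loS _ _).
Qed.

(** * Runs on a given input *)

Section Run.
Variables (R : realType) (n : nat) (T : rooted_tree n) (y w : 'I_n -> R).
Hypothesis w0 : forall v, 0 <= w v.

Definition extend (x0 : R) (f : 'I_n -> R) a := if insub a is Some v then f v else x0.

Lemma extendE x0 f (v : 'I_n) : extend x0 f v = f v.
Proof. by rewrite /extend valK. Qed.

Let c0 := input_config T y w.

Definition start : state R :=
  State (fun x => if x == 0%N then n else 0%N) (fun=> 0) (fun _ _ => 0%N) (fun _ _ => 0)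
    (imem c0) (rmem c0) (n + n).

Lemma start_raw (v : 'I_n) : iraw start v = if parent T v is Some p then (val p).+1 else 0%N.
Proof. by rewrite /= valK. Qed.

Lemma run_correct : exists t c, [/\ (n <= t <= (main_const + 1) * n.+1)%N,
  halts_in isotonic_program c0 t c & is_Linf_isotonic_regression T y w (output n c)].
Proof.
have n0 : (0 < n)%N by case: (n) (tree_root T) => // -[].
pose c1 := Config 1 [eta ireg c0 with 1%N |-> n + n]%N (rreg c0) (imem c0) (rmem c0).
have st : step isotonic_program c0 = Some c1 by [].
(* Memory behind the input is 0, hence so are the arrays at the start. *)
have big a : (n + n <= a)%N -> insub a = None :> option 'I_n /\ insub (a - n)%N = None :> option 'I_n.
  by move=> h; rewrite !insubN // -leqNgt; lia.
have rep : represents start c1.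
  split=> [[|x]|x|||] //=; split=> // i k _; have [e1 e2] := big (16 * k + i + (n + n))%N (leq_addl _ _).
    by rewrite e1.
  by rewrite e1 e2.
have ca : code_at isotonic_program 1 (ccode 1 main) by [].
have [t [c [/andP[lt tl] rc [pcE [_ _ _ _ [_ rE']]]]]] := code_ok ca rep erefl cmd_wf_main.
have vE a (an : (a < n)%N) : exists v : 'I_n, a = v by exists (Ordinal an).
pose dep a := if insub a is Some v then depth T v else 0%N.
have [cM fM [eps [e0 err opt]]] : [/\ (cost main start <= main_const * n.+1)%N,
    forall v p, (v < n)%N -> iraw start v = p.+1 -> rraw (eval main start) v <= rraw (eval main start) p &
    exists eps, [/\ 0 <= eps,
      forall v, (v < n)%N -> extend 0 w v * `|extend 0 y v - rraw (eval main start) v| <= eps &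
      forall g E, 0 <= E -> (forall v p, (v < n)%N -> iraw start v = p.+1 -> g v <= g p) ->
      (forall v, (v < n)%N -> extend 0 w v * `|extend 0 y v - g v| <= E) -> eps <= E]].
  apply: (@main_spec R start n (extend 0 y) (extend 0 w) dep) => //.
  - move=> a /vE[v ->]; rewrite /= !extendE valK addKn valK; split=> //.
    by rewrite insubN // -leqNgt leq_addr.
  - move=> a p /vE[v ->]; rewrite start_raw; case E : (parent T v) => [q|] // [<-]; split=> //.
    by rewrite /dep !valK depth_lt.
  - move=> a b /vE[u ->] /vE[v ->]; rewrite !start_raw.
    case Eu : (parent T u) => //; case Ev : (parent T v) => //.
    by rewrite (parent_root Eu) (parent_root Ev).
  - by move=> a /vE[v ->]; rewrite extendE.
have out v : output n c v = rraw (eval main start) v.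
  by rewrite /output rE' // frame_bnd ltn_addr.
exists t.+1, c; split.
- have := leq_trans tl cM; have : (n <= min_cost main start)%N by exact: (min_cost_main start).
  move: lt; clear; move: (cost main start) (min_cost _ _) main_const => p q r h1 h2 h3; lia.
- split; first by rewrite -[run _ _ _]/(obind (run isotonic_program t) (step isotonic_program c0)) st.
  by rewrite /fetch pcE /isotonic_program; move: (ccode 1 main) => l; rewrite nth_default.
split.
  apply/isotonicP => v p e; rewrite !out; apply: fM => //.
  by rewrite start_raw e.
move=> g /isotonicP gi; apply: (@le_trans _ _ eps).
  apply: bigmax_le => // v _; rewrite out; have := err v (ltn_ord v).
  by rewrite !extendE.
apply: (opt (extend 0 g)) => [|a p /vE[v ->]|a /vE[v ->]].
- exact: bigmax_ge_id.
- by rewrite start_raw; case E : (parent T v) => [q|] // [<-]; rewrite !extendE gi.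
by rewrite !extendE; apply: (le_bigmax _ (fun v => w v * `|y v - g v|)).
Qed.

End Run.

(** * The worst-case time *)

Definition running_time (R : realType) n t := exists (T : rooted_tree n) (y w : 'I_n -> R),
  (forall v, 0 <= w v) /\ exists c, halts_in isotonic_program (input_config T y w) t c.

(** There are infinitely many inputs of size [n], but their running times are bounded natural
    numbers, so that a maximum is attained. *)
Lemma worst_case_exists (R : realType) n : (0 < n)%N -> exists m,
  is_worst_case_time R isotonic_program n m /\ (n <= m <= (main_const + 1) * n.+1)%N.
Proof.
move=> n0; set C := ((main_const + 1) * n.+1)%N.
pose S t := `[< running_time R n t /\ (t <= C)%N >].
have run T y w : (forall v, 0 <= w v) -> exists t c, [/\ S t, (n <= t)%N &
    halts_in isotonic_program (@input_config R n T y w) t c].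
  move=> w0; have [t [c [/andP[h1 h2] h3 _]]] := run_correct T y w0.
  by exists t, c; split=> //; apply/asboolP; split=> //; exists T, y, w; split=> //; exists c.
have [T0] : exists T : rooted_tree n, True by move: n0; case: (n) => // k _; exists (star k).
have [t0 [c0 [S0 n0' _]]] := run T0 (fun=> 0) (fun=> 0) (fun=> lexx 0).
have ub t : S t -> (t <= C)%N by move=> /asboolP[].
have ex : exists t, S t by exists t0.
case: (ex_maxnP ex ub) => m /asboolP[[T [y [w [w0 [c h]]]]] mC] max; exists m; split; last first.
  by rewrite mC (leq_trans n0' (max _ S0)).
split; last by exists T, y, w; split=> //; exists c.
by move=> T' y' w' w0'; have [t [c' [St _ ht]]] := run T' y' w' w0'; exists t, c'; split=> //; apply: max.
Qed.

Lemma linear_worst_case (R : realType) : exists2 C, (0 < C)%N & forall n, (0 < n)%N ->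
  exists m, is_worst_case_time R isotonic_program n m /\ (n <= m <= C * n)%N.
Proof.
have [K HK] : exists K, forall n, (0 < n)%N -> exists m,
    is_worst_case_time R isotonic_program n m /\ (n <= m <= (K + 1) * n.+1)%N.
  by exists main_const; exact: worst_case_exists.
exists ((K + 1) * 2)%N => [|n n0]; first by rewrite muln_gt0 addn_gt0 orbT.
have [m [h /andP[h1 h2]]] := HK n n0; exists m; split=> //; rewrite h1 (leq_trans h2) //.
by rewrite -mulnA leq_mul2l; apply/orP; right; move: n0; clear; lia.
Qed.

Local Open Scope classical_set_scope.
Local Open Scope ring_scope.

Theorem theorem2 (R : realType) :
  exists P : program,
    (forall (n : nat) (T : rooted_tree n) (y w : 'I_n -> R),
       (forall v, 0 <= w v) ->
       exists (t : nat) (c : config R),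
         halts_in P (input_config T y w) t c /\
         is_Linf_isotonic_regression T y w (output n c)) /\
    (exists time : nat -> nat,
       (forall n : nat, (0 < n)%N -> is_worst_case_time R P n (time n)) /\
       ((fun n : nat => (time n)%:R : R) : nat -> R)
         \is 'Theta_\oo (fun n : nat => n%:R : R)).
Proof.
exists isotonic_program; split.
  move=> n T y w w0; have [t [c [_ h1 h2]]] := run_correct T y w0; by exists t, c.
have [C C0 H] := linear_worst_case R.
have [|time tE] := @choice nat nat (fun n m => (0 < n)%N ->
    is_worst_case_time R isotonic_program n m /\ (n <= m <= C * n)%N).
  (* The value at 0 is arbitrary, as there is no rooted tree without vertices. *)
  by case=> [|n]; [exists 0%N|have [m h] := H _ (ltn0Sn n); exists m].
exists time; split; first by move=> n /tE[].
apply/asboolP; exists (1, C%:R) => /=; first by rewrite ltr01 ltr0n.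
exists 1%N => // n /= n0; have [_ /andP[h1 h2]] := tE n n0.
by rewrite !ger0_norm ?ler0n // mul1r -natrM !ler_nat.
Qed.
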